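(* Let $d\ge1$, $H\in(0,1)$, $T>0$, $x=(x_1,\dots,x_d)\in\mathbb{R}^d$, and let $\boldsymbol{\alpha}=(\alpha_1,\dots,\alpha_d)$ with $\alpha_\ell\ge0$ for all $\ell$. Assume $X\in G^{d,H}_{S,U}$ and $H(2|\boldsymbol{\alpha}|+d)\ge1$. When $x=0$, the following statements hold: (1) If $Hd\le1$, then $L^{(\boldsymbol{\alpha})}_{\pm,\varepsilon}(T,0)$ diverges in $L^2$ as $\varepsilon\downarrow0$. (2) If $Hd>1$ and $\sum_{1\le\ell\le d,\ \alpha_\ell\in\mathbb{Z}}\alpha_\ell$ is even, then $L^{(\boldsymbol{\alpha})}_{\pm,\varepsilon}(T,0)$ diverges in $L^2$ as $\varepsilon\downarrow0$. (3) If $Hd>1$ and $\sum_{1\le\ell\le d,\ \alpha_\ell\in\mathbb{Z}}\alpha_\ell$ is odd, then $L^{(\boldsymbol{\alpha})}_{\pm,\varepsilon}(T,0)$ diverges in $L^2$ as $\varepsilon\downarrow0$ provided $X\in\widehat{G}^{d,H}_{S,U}$. When $x\ne0$, the following statement holds: (4) If $X\in\widetilde{G}^{d,H}_{S,U}$ and there exists $\ell\in\{1,\dots,d\}$ such that $\alpha_\ell$ is an integer and $x_\ell\ne0$, then $L^{(\boldsymbol{\alpha})}_{\pm,\varepsilon}(T,x)$ diverges in $L^2$ as $\varepsilon\downarrow0$.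
   Context: Class $G^{d,H}_S$ ($d\ge1$, $H\in(0,1)$): all $d$-dimensional centered Gaussian processes $X=\{X_t=(X^1_t,\dots,X^d_t),\ t\ge 0\}$ whose components are independent copies of some one-dimensional centered Gaussian process and which satisfy the strong local nondeterminism property: there is a constant $\kappa_H>0$ such that for every integer $m\ge1$ and all times $s_1,\dots,s_m,t\in(0,\infty)$, $$\mathrm{Var}\big(X^1_t\,|\,X^1_{s_1},\dots,X^1_{s_m}\big)\ge\kappa_H\min\{|t-s_1|^{2H},\dots,|t-s_m|^{2H},t^{2H}\}.$$ Class $G^{d,H}_{S,U}$: those $X\in G^{d,H}_S$ for which there is a constant $K_H>0$ with $\mathbb{E}(X^1_t-X^1_s)^2\le K_H|t-s|^{2H}$ for all $t,s\ge0$. Class $\widetilde{G}^{d,H}_{S,U}$: those $X\in G^{d,H}_{S,U}$ for which there is a non-negative decreasing function $\beta_H:(1,\infty)\to\mathbb{R}$ with $\lim_{\gamma\to\infty}\beta_H(\gamma)=0$ such that for all $0<s<t<\infty$ and $\gamma>1$ with $\frac{t-s}{s}\le\frac1\gamma$, $$\big|\mathbb{E}[(X^1_t-X^1_s)X^1_s]\big|\le\beta_H(\gamma)\,[\mathbb{E}(X^1_t-X^1_s)^2]^{1/2}[\mathbb{E}(X^1_s)^2]^{1/2}.$$ Class $\widehat{G}^{d,H}_{S,U}$: those $X\in G^{d,H}_{S,U}$ with $\mathbb{E}(X^1_tX^1_s)\ge0$ for all $t,s\ge0$. Notation: $\iota=\sqrt{-1}$; $\mathrm{sgn}(u)=1,0,-1$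 for $u>0$, $u=0$, $u<0$ respectively; $|y|$ is the Euclidean norm; $|\boldsymbol{\alpha}|=\sum_{\ell=1}^d\alpha_\ell$. An empty sum equals $0$ (and is even). For $\varepsilon>0$ let $p_\varepsilon(x)=(2\pi\varepsilon)^{-d/2}e^{-|x|^2/(2\varepsilon)}$, $x\in\mathbb{R}^d$. For $\boldsymbol{\alpha}\in[0,\infty)^d$ put $$D^{(\boldsymbol{\alpha})}_{\pm}p_{\varepsilon}(x)=\frac{1}{(2\pi)^d}\int_{\mathbb{R}^d}\Big(\prod_{\ell=1}^{d}|y_\ell|^{\alpha_\ell}e^{\pm\iota\frac{\pi\alpha_\ell}{2}\mathrm{sgn}(y_\ell)}\Big)e^{\iota y\cdot x}e^{-\frac{\varepsilon}{2}|y|^2}\,dy ,\qquad L^{(\boldsymbol{\alpha})}_{\pm,\varepsilon}(T,x)=\int_0^T D^{(\boldsymbol{\alpha})}_{\pm}p_\varepsilon(X_t+x)\,dt .$$ ''Diverges in $L^2$ as $\varepsilon\downarrow0$'' means that it does not converge in $L^2$ as $\varepsilon\downarrow0$. Statements with $\pm$ are asserted for each of the two signs. *)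

(* Defs.v *)
From HB Require Import structures.
From mathcomp Require Import all_boot all_order all_algebra.
From mathcomp Require Import all_classical all_reals all_analysis.
From mathcomp Require Import complex.
Set Implicit Arguments.
Unset Strict Implicit.
Unset Printing Implicit Defensive.
Import Order.TTheory GRing.Theory Num.Theory.
Import numFieldNormedType.Exports.
Local Open Scope classical_set_scope.
Local Open Scope ring_scope.
Local Open Scope complex_scope.

(* Lebesgue measure on R^n, carried by the measurable type [n.-tuple R]: the
   image of the product measure (Lebesgue measure on R) \x (Lebesgue measure on
   R^(n-1)) by the isomorphism (x, y) |-> x :: y. *)
Section lebesgue_cons.
Context (R : realType) (n : nat).
Variable m : {sigma_finite_measure set (n.-tuple R) -> \bar R}.

Definition tuple_cons (p : R * n.-tuple R) : n.+1.-tuple R :=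
  [the n.+1.-tuple R of p.1 :: p.2].

Lemma measurable_tuple_cons : measurable_fun [set: R * n.-tuple R] tuple_cons.
Proof. exact: measurable_cons. Qed.

Definition lebesgue_cons : set (n.+1.-tuple R) -> \bar R :=
  pushforward ((@lebesgue_measure R) \x m)%E tuple_cons.

Let lebesgue_cons0 : lebesgue_cons set0 = 0%E.
Proof. by rewrite /lebesgue_cons /pushforward preimage_set0 measure0. Qed.

Let lebesgue_cons_ge0 A : (0 <= lebesgue_cons A)%E.
Proof. exact: (measure_ge0 (lebesgue_measure \x m)%E). Qed.

Let lebesgue_cons_sigma_additive : semi_sigma_additive lebesgue_cons.
Proof.
move=> F mF tF mUF; rewrite /lebesgue_cons /pushforward preimage_bigcup.
have mp A : measurable A -> measurable (tuple_cons @^-1` A).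
  by move=> mA; rewrite -[X in measurable X]setTI; exact: measurable_tuple_cons.
apply: measure_semi_sigma_additive => [i||].
- exact: mp.
- apply/trivIsetP => /= i j _ _ ij; rewrite -preimage_setI.
  by move/trivIsetP : tF => /(_ _ _ _ _ ij) ->//; rewrite preimage_set0.
- by rewrite -preimage_bigcup; exact: mp.
Qed.

HB.instance Definition _ := isMeasure.Build _ _ _ lebesgue_cons
  lebesgue_cons0 lebesgue_cons_ge0 lebesgue_cons_sigma_additive.

Let lebesgue_cons_sigma_finite : sigma_finite setT lebesgue_cons.
Proof.
have /sigma_finiteP[F [FT ndF Foo]] : sigma_finite setT (@lebesgue_measure R).
  exact: sigma_finiteT.
have /sigma_finiteP[G [GT ndG Goo]] := sigma_finiteT m.
pose g (t : n.+1.-tuple R) : R * n.-tuple R := (thead t, [tuple of behead t]).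
have mg : measurable_fun setT g.
  apply/measurable_fun_pairP; split; first exact: measurable_tnth.
  exact: measurable_behead.
exists (fun k => g @^-1` (F k `*` G k)).
  rewrite -preimage_bigcup (_ : \bigcup_k _ = setT) ?preimage_setT//.
  rewrite -subTset => -[x y] _.
  have [[k _ Fkx] [l _ Gly]] : (\bigcup_k F k) x /\ (\bigcup_k G k) y.
    by rewrite -FT -GT.
  exists (maxn k l) => //; split => /=.
    by move: x Fkx; exact/subsetPset/ndF/leq_maxl.
  by move: y Gly; exact/subsetPset/ndG/leq_maxr.
move=> k; have [mF Fk] := Foo k; have [mG Gk] := Goo k.
have mFG : measurable (F k `*` G k) by exact: measurableX.
split; first by rewrite -[X in measurable X]setTI; exact: mg.
rewrite /lebesgue_cons /pushforward -comp_preimage (_ : g \o tuple_cons = id).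
  rewrite preimage_id product_measure1E//.
  by rewrite lte_mul_pinfty// ge0_fin_numE.
by apply/funext => -[a t]; congr pair; exact/val_inj.
Qed.

HB.instance Definition _ := Measure_isSigmaFinite.Build _ _ _ lebesgue_cons
  lebesgue_cons_sigma_finite.

End lebesgue_cons.

Fixpoint lebesgue_tuple (R : realType) (n : nat) :
    {sigma_finite_measure set (n.-tuple R) -> \bar R} :=
  if n is k.+1 then lebesgue_cons (lebesgue_tuple R k)
  else \d_([tuple] : 0.-tuple R).

Section complex_valued.
Context disp (T : measurableType disp) (R : realType).

Definition cintegral (mu : {measure set T -> \bar R}) (D : set T)
    (f : T -> R[i]) : R[i] :=
  (\int[mu]_(x in D) complex.Re (f x)) +i* (\int[mu]_(x in D) complex.Im (f x)).

Definition cmeasurable (f : T -> R[i]) :=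
  measurable_fun setT (fun w => complex.Re (f w)) /\
  measurable_fun setT (fun w => complex.Im (f w)).

(* Norm of L^2(P; C), with values in [0, +oo]. *)
Definition cL2norm (P : probability T R) (f : T -> R[i]) : \bar R :=
  Lnorm P 2%:E (fun w => (Normc.normc (f w))%:E).

Definition converges_L2 (P : probability T R) (F : R -> T -> R[i]) :=
  exists Z : T -> R[i], [/\ cmeasurable Z, (cL2norm P Z < +oo)%E &
    cL2norm P (fun w => F eps w - Z w) @[eps --> 0^'+] --> 0%E].

End complex_valued.

Definition expi (R : realType) (theta : R) : R[i] := cos theta +i* sin theta.

Definition multi_abs (R : realType) (d : nat) (alpha : 'I_d -> R) : R :=
  \sum_(l < d) alpha l.

Definition int_entries_sum (R : realType) (d : nat) (alpha : 'I_d -> R) : R :=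
  \sum_(l < d | alpha l \is a Num.int) alpha l.

Definition even_real (R : realType) (r : R) := exists k : int, r = (2 * k)%:~R.
Definition odd_real (R : realType) (r : R) := exists k : int, r = (2 * k + 1)%:~R.

Section heat_kernel_derivative.
Context (R : realType) (d : nat).

(* The boolean [minus] encodes the sign: [false] stands for +, [true] for -. *)
Definition heat_derivative (minus : bool) (alpha : 'I_d -> R) (eps : R)
    (x : 'rV[R]_d) : R[i] :=
  ((2 * pi) ^- d)%:C *
  cintegral (lebesgue_tuple R d) setT (fun y : d.-tuple R =>
    (\prod_(l < d) ((`|tnth y l| `^ alpha l)%:C *
       expi ((-1) ^+ minus * (pi * alpha l / 2 * Num.sg (tnth y l))))) *
    expi (\sum_(l < d) tnth y l * x 0 l) *
    (expR (- (eps / 2 * \sum_(l < d) tnth y l ^+ 2)))%:C).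

Definition local_time_derivative (Omega : Type) (X : R -> Omega -> 'rV[R]_d)
    (minus : bool) (alpha : 'I_d -> R) (eps T : R) (x : 'rV[R]_d)
    (w : Omega) : R[i] :=
  cintegral lebesgue_measure `[0, T]
    (fun t => heat_derivative minus alpha eps (X t w + x)).

End heat_kernel_derivative.

(* Real-valued processes are functions R -> Omega -> R, of which only the times
   t >= 0 are relevant. *)
Section one_dimensional_processes.
Context disp (Omega : measurableType disp) (R : realType).
Variable P : probability Omega R.
Implicit Types (Y : R -> Omega -> R) (G : set (set Omega)) (U Z V : Omega -> R).

(* The degenerate case is separate because [normal_prob m 0] is by convention
   not a Dirac mass. *)
Definition centered_gaussian U :=
  measurable_fun setT U /\
  ((forall A, measurable A -> P (U @^-1` A) = \d_(0 : R) A) \/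
   (exists2 s : R, 0 < s &
      forall A, measurable A -> P (U @^-1` A) = normal_prob 0 s A)).

Definition centered_gaussian_process Y :=
  forall (n : nat) (t a : 'I_n -> R), (forall i, 0 <= t i) ->
    centered_gaussian (fun w => \sum_(i < n) a i * Y (t i) w).

Definition jointly_measurable Y :=
  measurable_fun ([set t : R | 0 <= t] `*` [set: Omega])
    (fun p : R * Omega => Y p.1 p.2).

Definition process_sigma_algebra Y : set (set Omega) :=
  <<s \bigcup_(t in [set t : R | 0 <= t])
        preimage_set_system setT (Y t) measurable >>.

Definition same_law Y Y' :=
  forall (n : nat) (t : 'I_n -> R), (forall i, 0 <= t i) ->
  forall A : set (n.-tuple R), measurable A ->
    P [set w | A [tuple Y (t i) w | i < n]] =
    P [set w | A [tuple Y' (t i) w | i < n]].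

(* [Z] is a version of E[U | G]. *)
Definition is_cond_exp G U Z :=
  [/\ P.-integrable setT (EFin \o U), P.-integrable setT (EFin \o Z),
      (forall A, measurable A -> G (Z @^-1` A)) &
      (forall E, G E -> \int[P]_(w in E) Z w = \int[P]_(w in E) U w)].

(* [V] is a version of Var(U | G) = E[(U - E[U | G])^2 | G]. *)
Definition is_cond_var G U V :=
  exists2 Z, is_cond_exp G U Z & is_cond_exp G (fun w => (U w - Z w) ^+ 2) V.

Definition strong_local_nondeterminism (H : R) Y :=
  exists2 kappa : R, 0 < kappa &
    forall (m : nat) (s : 'I_m.+1 -> R) (t : R), (forall i, 0 < s i) -> 0 < t ->
    exists2 V, is_cond_var (g_sigma_preimage (fun i => Y (s i))) (Y t) V &
      \forall w \ae P,
        kappa * \big[Num.min/t `^ (2 * H)]_(i < m.+1) `|t - s i| `^ (2 * H)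
          <= V w.

Definition increment_upper_bound (H : R) Y :=
  exists2 K : R, 0 < K &
    forall s t : R, 0 <= s -> 0 <= t ->
      ('E_P[fun w => ((Y t w - Y s w) ^+ 2)%R] <= (K * `|t - s| `^ (2 * H))%:E)%E.

Definition increment_decorrelation Y :=
  exists beta : R -> R,
  [/\ (forall g, 1 < g -> 0 <= beta g),
      (forall g g', 1 < g -> g <= g' -> beta g' <= beta g),
      beta g @[g --> +oo] --> 0 &
      (forall s t g : R, 0 < s -> s < t -> 1 < g -> (t - s) / s <= 1 / g ->
        (`| 'E_P[fun w => ((Y t w - Y s w) * Y s w)%R] | <=
         (beta g)%:E * 'E_P[fun w => ((Y t w - Y s w) ^+ 2)%R] `^ (1 / 2)
                     * 'E_P[fun w => (Y s w ^+ 2)%R] `^ (1 / 2))%E)].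

Definition nonneg_correlated Y :=
  forall s t : R, 0 <= s -> 0 <= t -> (0 <= 'E_P[fun w => (Y t w * Y s w)%R])%E.

End one_dimensional_processes.

Section multidimensional_processes.
Context disp (Omega : measurableType disp) (R : realType).
Variables (P : probability Omega R) (d : nat) (hd : (0 < d)%N).
Implicit Types X : R -> Omega -> 'rV[R]_d.

Definition component X (l : 'I_d) : R -> Omega -> R := fun t w => X t w 0 l.

Definition first_component X := component X (Ordinal hd).

(* Each sigma-algebra contains [setT], so the product rule over all the
   components contains the product rule over every subfamily. *)
Definition independent_components X :=
  forall E : 'I_d -> set Omega,
    (forall l, process_sigma_algebra (component X l) (E l)) ->
    P (\bigcap_(l in [set: 'I_d]) E l) = (\prod_(l < d) fine (P (E l)))%:E.

(* Joint measurability makes the time integrals of the process well defined. *)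
Definition class_S (H : R) X :=
  [/\ forall l, jointly_measurable (component X l),
      forall l, centered_gaussian_process P (component X l),
      independent_components X,
      forall l l', same_law P (component X l) (component X l') &
      strong_local_nondeterminism P H (first_component X)].

Definition class_SU (H : R) X :=
  class_S H X /\ increment_upper_bound P H (first_component X).

Definition class_SU_tilde (H : R) X :=
  class_SU H X /\ increment_decorrelation P (first_component X).

Definition class_SU_hat (H : R) X :=
  class_SU H X /\ nonneg_correlated P (first_component X).

End multidimensional_processes.

(* Main.v *)
Require Import Defs.
From HB Require Import structures.
From mathcomp Require Import all_boot all_order all_algebra.
From mathcomp Require Import all_classical all_reals all_analysis.
From mathcomp Require Import measurable_realfun complex.
From mathcomp Require Import ring lra.
Import Order.TTheory GRing.Theory Num.Theory.
Import numFieldNormedType.Exports.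

(** Divergence is detected by testing against superpositions of plane waves. If
    the regularised derivatives F_eps converged in mean square, then
    D = F_(N^-3) - F_(N^-1) would tend to zero as N tends to infinity. For each
    large integer M put N = M^H, a = T/2, and let G be the sum, over the M grid
    times s = a + (a/M) i and over about N^d frequency vectors v whose entries
    lie in [N, 2N], of the waves exp(i v.(X_s + x)), each multiplied by the
    phase and divided by the size of the multiplier at v. Two estimates
    contradict the convergence.

    Lower bound ([test_pairing_lower]): Re E[D conj(G)] >= g N^d with g > 0. By
    Fubini's theorem, independence of the components and the Gaussian
    characteristic function ([pairing_formula]), each wave contributes a time
    integral of a product of one-dimensional kernels. Such a kernel is the
    integral of the regularised multiplier against exp(-Var(y X_t - v X_s)/2),
    a Gaussian in y. It is centred at v Cov(X_t, X_s)/Var(X_t) and its total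
    mass carries the factor exp(-v^2 R/2), where the residual variance R of X_s
    given X_t is of the exact order |t - s|^(2H), by the two bounds that define
    the class. Near the diagonal the multiplier is nearly constant on the
    effective range of y, where the regularisation N^-3 is invisible and N^-1
    kills everything ([kernel_near]); so the contribution of the wave is, up
    to a small error, a positive function of N |t - s|^H ([pairing_near]). The
    condition on x enters here: the oscillation exp(i (y - v).x) has to be
    harmless, which holds if x = 0, and also if the increments decorrelate,
    since this makes the shift of the centre small with respect to
    N |t - s|^H ([regression_shift_small]). Because the grid has spacing of
    order N^(-1/H), summation over it turns these profiles into a bounded
    function of t that stays away from zero on the second half of the time
    interval ([pairing_grid_sum]).

    Upper bound ([test_function_second_moment]): E|G|^2 <= C N^(d - 2|alpha|) M.
    Indeed Var(v X_t - v' X_s) dominates (v - v')^2 + N^2 |t - s|^(2H)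
    ([increment_variance_ge]), so the correlations of the waves are summable
    over frequencies and over times, uniformly in N.

    By Young's inequality these bounds give
      2 g N^d <= mu N^d E|D|^2 + C N^(-2|alpha|) M / mu
    for every mu > 0, up to the value of the constants. The hypothesis
    H (2|alpha| + d) >= 1 says that M <= N^(2|alpha| + d)
    ([critical_scaling]). A large fixed mu then bounds E|D|^2 from below, for
    all large M. *)

Set Implicit Arguments.
Unset Strict Implicit.
Unset Printing Implicit Defensive.
Local Open Scope classical_set_scope.
Local Open Scope ring_scope.
Local Open Scope complex_scope.
Local Notation normc := Normc.normc.
Local Notation Re := complex.Re.
Local Notation Im := complex.Im.

(** * Complex-valued integrals *)

Section complex_facts.
Context (R : realType).
Implicit Types z w : R[i].

Lemma normcE' z : normc z = Num.sqrt (Re z ^+ 2 + Im z ^+ 2).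
Proof. by case: z. Qed.

Lemma normc_ge0 z : 0 <= normc z.
Proof. by rewrite normcE' sqrtr_ge0. Qed.

Lemma sqr_normcE z : normc z ^+ 2 = Re z ^+ 2 + Im z ^+ 2.
Proof. by rewrite normcE' sqr_sqrtr// addr_ge0// sqr_ge0. Qed.

Lemma normr_Re_le z : `|Re z| <= normc z.
Proof.
by rewrite -(@ler_pXn2r _ 2)// ?nnegrE ?normc_ge0// sqr_normcE real_normK ?num_real// lerDl sqr_ge0.
Qed.

Lemma normr_Im_le z : `|Im z| <= normc z.
Proof.
by rewrite -(@ler_pXn2r _ 2)// ?nnegrE ?normc_ge0// sqr_normcE real_normK ?num_real// lerDr sqr_ge0.
Qed.

Lemma normc_le_ReIm z : normc z <= `|Re z| + `|Im z|.
Proof.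
rewrite -(@ler_pXn2r _ 2)// ?nnegrE ?normc_ge0// ?addr_ge0//.
rewrite sqr_normcE sqrrD !real_normK ?num_real// lerD2r lerDl.
by rewrite mulrn_wge0// mulr_ge0.
Qed.

Lemma normcM z w : normc (z * w) = normc z * normc w.
Proof. exact: Normc.normcM. Qed.

Lemma normc_real (r : R) : normc r%:C = `|r|.
Proof. by rewrite normcE' /= expr0n addr0 sqrtr_sqr. Qed.

Lemma normc1 : normc (1 : R[i]) = 1.
Proof. exact: Normc.normc1. Qed.

Lemma normc_prod (I : Type) (r : seq I) (P : pred I) (F : I -> R[i]) :
  normc (\prod_(i <- r | P i) F i) = \prod_(i <- r | P i) normc (F i).
Proof. exact: (big_morph _ normcM normc1). Qed.

Lemma normcJ z : normc z^* = normc z.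
Proof. by rewrite !normcE'; case: z => a b /=; rewrite sqrrN. Qed.

Lemma normc_sum (I : Type) (r : seq I) (P : pred I) (F : I -> R[i]) :
  normc (\sum_(i <- r | P i) F i) <= \sum_(i <- r | P i) normc (F i).
Proof.
elim/big_ind2 : _ => [|x a y b xa yb|//]; first by rewrite Normc.normc0.
by rewrite (le_trans (le_normcD _ _))// lerD.
Qed.

Lemma normc_expi (t : R) : normc (expi t) = 1.
Proof. by rewrite normcE' /= cos2Dsin2 sqrtr1. Qed.

Lemma expiD (s t : R) : expi (s + t) = expi s * expi t.
Proof.
rewrite /expi cosD sinD; apply/eqP; rewrite eq_complex /=; apply/andP; split=> //.
by rewrite addrC.
Qed.

Lemma expi0 : expi (0 : R) = 1.
Proof. by rewrite /expi cos0 sin0. Qed.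

Lemma conj_expi (t : R) : (expi t)^* = expi (- t).
Proof. by rewrite /expi /= cosN sinN. Qed.

Lemma expi_sum (I : Type) (r : seq I) (P : pred I) (F : I -> R) :
  expi (\sum_(i <- r | P i) F i) = \prod_(i <- r | P i) expi (F i).
Proof. exact: (big_morph _ expiD expi0). Qed.

Lemma mulC_real (a b : R) : (a * b)%:C = a%:C * b%:C.
Proof. exact: rmorphM. Qed.

Lemma ReD z w : Re (z + w) = Re z + Re w.
Proof. by case: z w => ? ? []. Qed.

Lemma ImD z w : Im (z + w) = Im z + Im w.
Proof. by case: z w => ? ? []. Qed.

Lemma ReM z w : Re (z * w) = Re z * Re w - Im z * Im w.
Proof. by case: z w => ? ? []. Qed.

Lemma ImM z w : Im (z * w) = Re z * Im w + Im z * Re w.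
Proof. by case: z w => ? ? []. Qed.

Lemma ReN z : Re (- z) = - Re z.
Proof. by case: z. Qed.

Lemma ImN z : Im (- z) = - Im z.
Proof. by case: z. Qed.

Lemma eqc z w : Re z = Re w -> Im z = Im w -> z = w.
Proof. by case: z w => ? ? [? ?] /= -> ->. Qed.

Lemma Re_sum (I : Type) (r : seq I) (P : pred I) (F : I -> R[i]) :
  Re (\sum_(i <- r | P i) F i) = \sum_(i <- r | P i) Re (F i).
Proof. exact: (big_morph _ ReD). Qed.

End complex_facts.

Section complex_measurability.
Context d (T : measurableType d) (R : realType).
Implicit Types f g : T -> R[i].

Lemma cmeasurable_cst (c : R[i]) : cmeasurable (fun _ : T => c).
Proof. by split; exact: measurable_cst. Qed.

Lemma cmeasurableD f g : cmeasurable f -> cmeasurable g ->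
  cmeasurable (fun x => f x + g x).
Proof.
move=> [f1 f2] [g1 g2]; split.
- by under eq_fun do rewrite ReD; exact: measurable_funD.
- by under eq_fun do rewrite ImD; exact: measurable_funD.
Qed.

Lemma cmeasurableM f g : cmeasurable f -> cmeasurable g ->
  cmeasurable (fun x => f x * g x).
Proof.
move=> [f1 f2] [g1 g2]; split.
- under eq_fun do rewrite ReM.
  by apply: measurable_funB; exact: measurable_funM.
- under eq_fun do rewrite ImM.
  by apply: measurable_funD; exact: measurable_funM.
Qed.

Lemma cmeasurable_sum (I : Type) (r : seq I) (F : I -> T -> R[i]) :
  (forall i, cmeasurable (F i)) -> cmeasurable (fun x => \sum_(i <- r) F i x).
Proof.
move=> mF; elim: r => [|i r ih].
  by under eq_fun do rewrite big_nil; exact: cmeasurable_cst.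
by under eq_fun do rewrite big_cons; exact: cmeasurableD.
Qed.

Lemma cmeasurable_prod (I : Type) (r : seq I) (F : I -> T -> R[i]) :
  (forall i, cmeasurable (F i)) -> cmeasurable (fun x => \prod_(i <- r) F i x).
Proof.
move=> mF; elim: r => [|i r ih].
  by under eq_fun do rewrite big_nil; exact: cmeasurable_cst.
by under eq_fun do rewrite big_cons; exact: cmeasurableM.
Qed.

Lemma cmeasurable_real (f : T -> R) :
  measurable_fun setT f -> cmeasurable (fun x => (f x)%:C).
Proof. by split => //=; exact: measurable_cst. Qed.

Lemma cmeasurable_expi (f : T -> R) :
  measurable_fun setT f -> cmeasurable (fun x => expi (f x)).
Proof.
move=> mf; split => /=; apply: measurableT_comp => //; apply: continuous_measurable_fun.
- exact: continuous_cos.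
- exact: continuous_sin.
Qed.

Lemma cmeasurable_conj f : cmeasurable f -> cmeasurable (fun x => (f x)^*).
Proof.
move=> [f1 f2]; split.
- by rewrite (_ : (fun _ => _) = fun x => Re (f x))//; apply/funext => x; case: (f x).
- rewrite (_ : (fun _ => _) = fun x => - Im (f x)).
    exact: measurable_funN.
  by apply/funext => x; case: (f x).
Qed.

Lemma cmeasurable_comp d' (T' : measurableType d') (h : T' -> T) f :
  measurable_fun setT h -> cmeasurable f -> cmeasurable (fun x => f (h x)).
Proof. by move=> mh [f1 f2]; split; [exact: (measurableT_comp f1 mh)|exact: (measurableT_comp f2 mh)]. Qed.

Lemma measurable_normc f : cmeasurable f ->
  measurable_fun setT (fun x => normc (f x)).
Proof.
move=> [f1 f2]; under eq_fun do rewrite normcE'.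
apply: (measurableT_comp (f := @Num.sqrt R)).
  by apply: continuous_measurable_fun; exact: sqrt_continuous.
by apply: measurable_funD; exact: measurable_funX.
Qed.

End complex_measurability.

Section real_integrable.
Context d (T : measurableType d) (R : realType) (mu : {measure set T -> \bar R}).
Implicit Types f g : T -> R.

Lemma integrable_realD f g : mu.-integrable setT (EFin \o f) ->
  mu.-integrable setT (EFin \o g) ->
  mu.-integrable setT (EFin \o (fun x => f x + g x)).
Proof.
by move=> fi gi; have := integrableD measurableT fi gi; apply: eq_integrable.
Qed.

Lemma integrable_realB f g : mu.-integrable setT (EFin \o f) ->
  mu.-integrable setT (EFin \o g) ->
  mu.-integrable setT (EFin \o (fun x => f x - g x)).
Proof.
by move=> fi gi; have := integrableB measurableT fi gi; apply: eq_integrable.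
Qed.

Lemma integrable_realZ (k : R) f : mu.-integrable setT (EFin \o f) ->
  mu.-integrable setT (EFin \o (fun x => k * f x)).
Proof.
by move=> fi; have := integrableZl measurableT k fi; apply: eq_integrable.
Qed.

Lemma integrable_le f g : measurable_fun setT f ->
  mu.-integrable setT (EFin \o g) -> (forall x, `|f x| <= g x) ->
  mu.-integrable setT (EFin \o f).
Proof.
move=> mf ig fg; apply: le_integrable ig => //=; first exact/measurable_EFinP.
by move=> x _; rewrite lee_fin (le_trans (fg x))// ler_norm.
Qed.

Lemma Rintegral_le f g : mu.-integrable setT (EFin \o f) ->
  mu.-integrable setT (EFin \o g) -> (forall x, f x <= g x) ->
  \int[mu]_x f x <= \int[mu]_x g x.
Proof. by move=> fi gi fg; exact: le_Rintegral. Qed.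

End real_integrable.

Section complex_integral.
Context d (T : measurableType d) (R : realType) (mu : {measure set T -> \bar R}).
Implicit Types f g : T -> R[i].

Definition cintegrable f :=
  mu.-integrable setT (EFin \o (fun x => Re (f x))) /\
  mu.-integrable setT (EFin \o (fun x => Im (f x))).

Lemma cintegrable_dominated f (g : T -> R) : cmeasurable f ->
  mu.-integrable setT (EFin \o g) -> (forall x, normc (f x) <= g x) ->
  cintegrable f.
Proof.
move=> [f1 f2] ig fg; split; apply: le_integrable ig => //=.
- exact/measurable_EFinP.
- move=> x _; rewrite lee_fin (le_trans (normr_Re_le _))//.
  by rewrite (le_trans (fg x))// ler_norm.
- exact/measurable_EFinP.
- move=> x _; rewrite lee_fin (le_trans (normr_Im_le _))//.
  by rewrite (le_trans (fg x))// ler_norm.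
Qed.

Lemma eq_cintegral f g : f =1 g -> cintegral mu setT f = cintegral mu setT g.
Proof. by move=> /funext ->. Qed.

Lemma cintegralD f g : cintegrable f -> cintegrable g ->
  cintegral mu setT (fun x => f x + g x) =
  cintegral mu setT f + cintegral mu setT g.
Proof.
move=> [f1 f2] [g1 g2]; apply: eqc; rewrite ?ReD ?ImD /cintegral/= -RintegralD//.
- by apply: eq_Rintegral => x _; rewrite ReD.
- by apply: eq_Rintegral => x _; rewrite ImD.
Qed.

Lemma cintegrableD f g : cintegrable f -> cintegrable g ->
  cintegrable (fun x => f x + g x).
Proof.
move=> [f1 f2] [g1 g2]; split.
- under [X in EFin \o X]eq_fun do rewrite ReD.
  exact: integrable_realD.
- under [X in EFin \o X]eq_fun do rewrite ImD.
  exact: integrable_realD.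
Qed.

Lemma cintegrableZ (c : R[i]) f : cintegrable f -> cintegrable (fun x => c * f x).
Proof.
move=> [f1 f2]; split.
- under [X in EFin \o X]eq_fun do rewrite ReM.
  by apply: integrable_realB; exact: integrable_realZ.
- under [X in EFin \o X]eq_fun do rewrite ImM.
  by apply: integrable_realD; exact: integrable_realZ.
Qed.

Lemma cintegralZ (c : R[i]) f : cintegrable f ->
  cintegral mu setT (fun x => c * f x) = c * cintegral mu setT f.
Proof.
move=> [f1 f2]; apply: eqc; rewrite ?ReM ?ImM /cintegral/=.
- rewrite -!RintegralZl// -RintegralB//; try exact: integrable_realZ.
  by apply: eq_Rintegral => x _; rewrite ReM.
- rewrite -!RintegralZl// -RintegralD//; try exact: integrable_realZ.
  by apply: eq_Rintegral => x _; rewrite ImM.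
Qed.

Lemma cintegral0 : cintegral mu setT (fun=> 0) = 0 :> R[i].
Proof.
by apply: eqc; rewrite /cintegral/= Rintegral_cst// mul0r.
Qed.

Lemma cintegrable0 : cintegrable (fun=> 0).
Proof. by split; exact: integrable0. Qed.

Lemma cintegrable_sum (I : Type) (r : seq I) (F : I -> T -> R[i]) :
  (forall i, cintegrable (F i)) -> cintegrable (fun x => \sum_(i <- r) F i x).
Proof.
move=> iF; elim: r => [|i r ih].
  rewrite (_ : (fun _ => _) = fun=> 0); first exact: cintegrable0.
  by apply/funext => x; rewrite big_nil.
rewrite (_ : (fun _ => _) = fun x => F i x + \sum_(j <- r) F j x).
  exact: cintegrableD.
by apply/funext => x; rewrite big_cons.
Qed.

Lemma cintegral_sum (I : Type) (r : seq I) (F : I -> T -> R[i]) :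
  (forall i, cintegrable (F i)) ->
  cintegral mu setT (fun x => \sum_(i <- r) F i x) =
  \sum_(i <- r) cintegral mu setT (F i).
Proof.
move=> iF; elim: r => [|i r ih].
  rewrite big_nil; apply: etrans cintegral0.
  by apply: eq_cintegral => x; rewrite big_nil.
rewrite big_cons -ih -cintegralD//; last exact: cintegrable_sum.
by apply: eq_cintegral => x; rewrite big_cons.
Qed.

Lemma cintegral_real (f : T -> R) :
  cintegral mu setT (fun x => (f x)%:C) = (\int[mu]_x f x)%:C.
Proof. by apply: eqc; rewrite /cintegral/= ?Rintegral_cst// mul0r. Qed.

Lemma normc_cintegral_le f (g : T -> R) : cmeasurable f ->
  mu.-integrable setT (EFin \o g) -> (forall x, normc (f x) <= g x) ->
  normc (cintegral mu setT f) <= 2 * \int[mu]_x g x.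
Proof.
move=> mf ig fg; have [f1 f2] := cintegrable_dominated mf ig fg.
rewrite (le_trans (normc_le_ReIm _))//= mulr_natl mulr2n lerD//.
- rewrite (le_trans (le_normr_Rintegral _ _))//.
  apply: le_Rintegral => //; first exact: (integrable_norm f1).
  by move=> x _; rewrite (le_trans (normr_Re_le _)).
- rewrite (le_trans (le_normr_Rintegral _ _))//.
  apply: le_Rintegral => //; first exact: (integrable_norm f2).
  by move=> x _; rewrite (le_trans (normr_Im_le _)).
Qed.

End complex_integral.

(** * Fubini's theorem and product integrals *)

Section dominated_fubini.
Context d1 d2 (T1 : measurableType d1) (T2 : measurableType d2) (R : realType).
Variables (m1 : {sigma_finite_measure set T1 -> \bar R})
          (m2 : {sigma_finite_measure set T2 -> \bar R}).
Variables (g1 : T1 -> R) (g2 : T2 -> R).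
Hypothesis ig1 : m1.-integrable setT (EFin \o g1).
Hypothesis ig2 : m2.-integrable setT (EFin \o g2).

Lemma integrable_tensor :
  (m1 \x m2)%E.-integrable setT (EFin \o (fun p : T1 * T2 => g1 p.1 * g2 p.2)).
Proof.
have mg1 : measurable_fun setT g1 by exact/measurable_EFinP/(measurable_int m1).
have mg2 : measurable_fun setT g2 by exact/measurable_EFinP/(measurable_int m2).
apply/integrable12ltyP.
  apply/measurable_EFinP; apply: measurable_funM.
  - exact: (measurableT_comp mg1 measurable_fst).
  - exact: (measurableT_comp mg2 measurable_snd).
have i2 : (\int[m2]_y `|(g2 y)%:E| < +oo)%E by case/integrableP : ig2.
have i1 : (\int[m1]_x `|(g1 x)%:E| < +oo)%E by case/integrableP : ig1.
rewrite (@eq_integral _ _ _ m1 setT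
  (fun x => (`|g1 x|%:E * \int[m2]_y `|(g2 y)%:E|)%E)); last first.
  move=> x _; rewrite -ge0_integralZl//.
    by apply: eq_integral => y _ /=; rewrite normrM EFinM.
  by apply/measurable_EFinP; exact: measurableT_comp.
rewrite ge0_integralZr//; first last.
- exact: integral_ge0.
- by apply/measurable_EFinP; exact: measurableT_comp.
by rewrite lte_mul_pinfty// ?integral_ge0// ge0_fin_numE// integral_ge0.
Qed.

Section real_valued.
Variable h : T1 * T2 -> R.
Hypothesis mh : measurable_fun setT h.
Hypothesis hg : forall x y, `|h (x, y)| <= g1 x * g2 y.

Lemma integrable_dominated_tensor : (m1 \x m2)%E.-integrable setT (EFin \o h).
Proof.
by apply: (integrable_le mh integrable_tensor) => -[x y]; exact: hg.
Qed.

Lemma integrable_section1 x : m2.-integrable setT (EFin \o (fun y => h (x, y))).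
Proof.
apply: (@integrable_le _ _ _ _ (fun y => h (x, y)) (fun y => g1 x * g2 y)).
- exact: measurableT_comp.
- exact: integrable_realZ.
- by move=> y; exact: hg.
Qed.

Lemma integrable_section2 y : m1.-integrable setT (EFin \o (fun x => h (x, y))).
Proof.
apply: (@integrable_le _ _ _ _ (fun x => h (x, y)) (fun x => g2 y * g1 x)).
- exact: measurableT_comp.
- exact: integrable_realZ.
- by move=> x; rewrite mulrC; exact: hg.
Qed.

Lemma measurable_Rintegral_section :
  measurable_fun setT (fun x => \int[m2]_y h (x, y)).
Proof.
have /= := measurable_fubini_F integrable_dominated_tensor.
by move=> mF; apply: measurableT_comp mF => //; exact: measurable_fine.
Qed.

Lemma Rintegral12 :
  \int[m1]_x \int[m2]_y h (x, y) = \int[(m1 \x m2)%E]_p h p.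
Proof.
rewrite /Rintegral -(integral12_prod_meas1 integrable_dominated_tensor).
congr fine; apply: eq_integral => x _; rewrite fineK//.
by apply: integrable_fin_num => //; exact: integrable_section1.
Qed.

Lemma Rintegral21 :
  \int[m2]_y \int[m1]_x h (x, y) = \int[(m1 \x m2)%E]_p h p.
Proof.
rewrite /Rintegral -(integral21_prod_meas1 integrable_dominated_tensor).
congr fine; apply: eq_integral => x _; rewrite fineK//.
by apply: integrable_fin_num => //; exact: integrable_section2.
Qed.

Lemma Rfubini : \int[m1]_x \int[m2]_y h (x, y) = \int[m2]_y \int[m1]_x h (x, y).
Proof. by rewrite Rintegral12 Rintegral21. Qed.

End real_valued.

Variable f : T1 * T2 -> R[i].
Hypothesis mf : cmeasurable f.
Hypothesis fg : forall x y, normc (f (x, y)) <= g1 x * g2 y.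

Let fgRe x y : `|Re (f (x, y))| <= g1 x * g2 y.
Proof. by rewrite (le_trans (normr_Re_le _)). Qed.

Let fgIm x y : `|Im (f (x, y))| <= g1 x * g2 y.
Proof. by rewrite (le_trans (normr_Im_le _)). Qed.

Lemma cmeasurable_cintegral_section :
  cmeasurable (fun x => cintegral m2 setT (fun y => f (x, y))).
Proof.
case: mf => m_Re m_Im; split => /=.
- exact: (@measurable_Rintegral_section (fun p => Re (f p))).
- exact: (@measurable_Rintegral_section (fun p => Im (f p))).
Qed.

Lemma cfubini12 : cintegral m1 setT (fun x => cintegral m2 setT (fun y => f (x, y))) =
  cintegral (m1 \x m2)%E setT f.
Proof.
case: mf => m_Re m_Im; apply: eqc => /=.
- exact: (@Rintegral12 (fun p => Re (f p))).
- exact: (@Rintegral12 (fun p => Im (f p))).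
Qed.

Lemma cfubini : cintegral m1 setT (fun x => cintegral m2 setT (fun y => f (x, y))) =
  cintegral m2 setT (fun y => cintegral m1 setT (fun x => f (x, y))).
Proof.
case: mf => m_Re m_Im; apply: eqc => /=.
- exact: (@Rfubini (fun p => Re (f p))).
- exact: (@Rfubini (fun p => Im (f p))).
Qed.

End dominated_fubini.

Section tuple_integral.
Context (R : realType).
Implicit Types (n : nat).

Lemma Rintegral_pushforward_cons n (h : n.+1.-tuple R -> R) :
  measurable_fun setT h ->
  (@lebesgue_measure R \x lebesgue_tuple R n)%E.-integrable setT
    (EFin \o (fun p => h (tuple_cons p))) ->
  \int[lebesgue_tuple R n.+1]_y h y =
  \int[(@lebesgue_measure R \x lebesgue_tuple R n)%E]_p h (tuple_cons p).
Proof.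
move=> mh ih; rewrite /Rintegral; congr fine.
pose M : {measure set (g_sigma_algebraType R.-ocitv.-measurable * n.-tuple R)%type -> \bar R} :=
  (@lebesgue_measure R \x lebesgue_tuple R n)%E.
pose phi : (g_sigma_algebraType R.-ocitv.-measurable * n.-tuple R)%type -> n.+1.-tuple R :=
  @tuple_cons R n.
have mphi : measurable_fun setT phi := measurable_tuple_cons (n := n).
apply: (@integral_pushforward _ _ _ _ R phi mphi M setT (EFin \o h)) => //.
exact/measurable_EFinP.
Qed.

Lemma integrable_pushforward_cons n (h : n.+1.-tuple R -> R) :
  measurable_fun setT h ->
  (@lebesgue_measure R \x lebesgue_tuple R n)%E.-integrable setT
    (EFin \o (fun p => h (tuple_cons p))) ->
  (lebesgue_tuple R n.+1).-integrable setT (EFin \o h).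
Proof.
move=> mh ih.
pose M : {measure set (g_sigma_algebraType R.-ocitv.-measurable * n.-tuple R)%type -> \bar R} :=
  (@lebesgue_measure R \x lebesgue_tuple R n)%E.
pose phi : (g_sigma_algebraType R.-ocitv.-measurable * n.-tuple R)%type -> n.+1.-tuple R :=
  @tuple_cons R n.
have mphi : measurable_fun setT phi := measurable_tuple_cons (n := n).
apply: (@integrable_pushforward _ _ _ _ R phi mphi M setT (EFin \o h)) => //.
exact/measurable_EFinP.
Qed.

Lemma tnth_cons_ord0 n (p : R * n.-tuple R) : tnth (tuple_cons p) ord0 = p.1.
Proof. by rewrite (tnth_nth 0). Qed.

Lemma tnth_cons_lift n (p : R * n.-tuple R) (l : 'I_n) :
  tnth (tuple_cons p) (lift ord0 l) = tnth p.2 l.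
Proof. by rewrite !(tnth_nth 0). Qed.

Lemma measurable_prod_tnth n (g : 'I_n -> R -> R) :
  (forall l, measurable_fun setT (g l)) ->
  measurable_fun setT (fun y : n.-tuple R => \prod_(l < n) g l (tnth y l)).
Proof.
move=> mg; apply: measurable_prod => l _.
exact: (measurableT_comp (mg l) (measurable_tnth l)).
Qed.

Lemma integrable_tuple_prod n (g : 'I_n -> R -> R) :
  (forall l, lebesgue_measure.-integrable setT (EFin \o g l)) ->
  (lebesgue_tuple R n).-integrable setT
    (EFin \o (fun y : n.-tuple R => \prod_(l < n) g l (tnth y l))).
Proof.
elim: n g => [|n ih] g ig.
  rewrite (_ : (fun y => _) = cst 1); last by apply/funext => y; rewrite big_ord0.
  exact: finite_measure_integrable_cst.
have mg l : measurable_fun setT (g l) by have /integrableP[/measurable_EFinP] := ig l.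
apply: integrable_pushforward_cons; first by apply: measurable_prod_tnth => l; exact: mg.
have := integrable_tensor (ig ord0) (ih _ (fun l => ig (lift ord0 l))).
apply: eq_integrable => // p _ /=; congr EFin.
rewrite big_ord_recl tnth_cons_ord0; congr (_ * _).
by apply: eq_bigr => l _; rewrite tnth_cons_lift.
Qed.

Lemma cintegral_tuple_prod n (phi : 'I_n -> R -> R[i]) (g : 'I_n -> R -> R) :
  (forall l, cmeasurable (phi l)) ->
  (forall l, lebesgue_measure.-integrable setT (EFin \o g l)) ->
  (forall l y, normc (phi l y) <= g l y) ->
  cintegral (lebesgue_tuple R n) setT
    (fun y : n.-tuple R => \prod_(l < n) phi l (tnth y l)) =
  \prod_(l < n) cintegral lebesgue_measure setT (phi l).
Proof.
elim: n phi g => [|n ih] phi g mphi ig phig.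
  rewrite big_ord0 (_ : (fun y => _) = cst 1); last by apply/funext => y; rewrite big_ord0.
  apply: eqc; rewrite /= Rintegral_cst// ?mul0r// mul1r /=.
  by rewrite indicE mem_set.
have mP m (psi : 'I_m -> R -> R[i]) : (forall l, cmeasurable (psi l)) ->
    cmeasurable (fun y : m.-tuple R => \prod_(l < m) psi l (tnth y l)).
  move=> mpsi; apply: cmeasurable_prod => l.
  exact: (cmeasurable_comp (measurable_tnth l) (mpsi l)).
have mF := mP _ _ mphi.
pose F (p : (g_sigma_algebraType R.-ocitv.-measurable * n.-tuple R)%type) : R[i] :=
   phi ord0 p.1 * \prod_(l < n) phi (lift ord0 l) (tnth p.2 l).
have FE p : \prod_(l < n.+1) phi l (tnth (tuple_cons p) l) = F p.
  rewrite big_ord_recl tnth_cons_ord0; congr (_ * _).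
  by apply: eq_bigr => l _; rewrite tnth_cons_lift.
pose g2 (q : n.-tuple R) := \prod_(l < n) g (lift ord0 l) (tnth q l).
have ig2 : (lebesgue_tuple R n).-integrable setT (EFin \o g2).
  by apply: (@integrable_tuple_prod n (fun l => g (lift ord0 l))) => l; exact: ig.
have mFF : cmeasurable F.
  apply: cmeasurableM.
  - exact: (cmeasurable_comp measurable_fst (mphi ord0)).
  - apply: (cmeasurable_comp measurable_snd (mP _ (fun l => phi (lift ord0 l)) _)).
    by move=> l; exact: mphi.
have Fg x y : normc (F (x, y)) <= g ord0 x * g2 y.
  rewrite normcM ler_pM ?normc_ge0// normc_prod ler_prod// => l _.
  by rewrite normc_ge0 phig.
have [iF1 iF2] : cintegrable (@lebesgue_measure R \x lebesgue_tuple R n)%E F.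
  apply: (cintegrable_dominated mFF (integrable_tensor (ig ord0) ig2)).
  by move=> [x y]; exact: Fg.
transitivity (cintegral (@lebesgue_measure R \x lebesgue_tuple R n)%E setT F).
  case: mF => mF1 mF2; apply: eqc => /=.
  - rewrite Rintegral_pushforward_cons//; last by apply: eq_integrable iF1 => // p _ /=; rewrite FE.
    by apply: eq_Rintegral => p _; rewrite FE.
  - rewrite Rintegral_pushforward_cons//; last by apply: eq_integrable iF2 => // p _ /=; rewrite FE.
    by apply: eq_Rintegral => p _; rewrite FE.
rewrite -(cfubini12 (ig ord0) ig2 mFF Fg) big_ord_recl -(ih _ (fun l => g (lift ord0 l)))//.
have i0 : cintegrable lebesgue_measure (phi ord0).
  apply: (@cintegrable_dominated _ _ _ (@lebesgue_measure R) _ (g ord0)); [exact: mphi|exact: ig|exact: phig].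
rewrite mulrC -cintegralZ//; apply: eq_cintegral => x.
rewrite /F mulrC -cintegralZ//.
apply: (@cintegrable_dominated _ _ _ (lebesgue_tuple R n) _ g2) => //.
- by apply: (mP _ (fun l => phi (lift ord0 l))) => l; exact: mphi.
- move=> q; rewrite normc_prod ler_prod// => l _.
  by rewrite normc_ge0 phig.
Qed.

End tuple_integral.

(** * Orthogonality and independence *)

Section orthogonality.
Context d (T : measurableType d) (R : realType) (P : probability T R).
Local Notation leb := (@lebesgue_measure R).

(** Layer cake: [Z] is the integral over [u >= 0] of the indicators of [u < Z],
    and Fubini's theorem applies. *)
Lemma orthogonal_preimages_nonneg (D Z : T -> R) :
  P.-integrable setT (EFin \o D) -> measurable_fun setT Z ->
  (forall w, 0 <= Z w) ->
  P.-integrable setT (EFin \o (fun w => D w * Z w)) ->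
  (forall A, measurable A -> \int[P]_(w in Z @^-1` A) D w = 0) ->
  \int[P]_w (D w * Z w) = 0.
Proof.
move=> iD mZ Z0 iDZ orth.
have mD : measurable_fun setT D by case/integrableP : iD => /measurable_EFinP.
pose I (p : T * g_sigma_algebraType R.-ocitv.-measurable) : R :=
  if (0 <= p.2) && (p.2 < Z p.1) then 1 else 0.
have IE w u : I (w, u) = \1_(`[0, Z w[) u.
  by rewrite /I indicE mem_setE in_itv/=; case: ifP.
have I0 p : 0 <= I p by rewrite /I; case: ifP.
have mI : measurable_fun setT I.
  apply: measurable_fun_ifT => //; apply: measurable_and.
  - apply: measurable_fun_ler => //; exact: measurable_snd.
  - apply: measurable_fun_ltr; first exact: measurable_snd.
    exact: (measurableT_comp mZ measurable_fst).
pose h (p : T * g_sigma_algebraType R.-ocitv.-measurable) : R := D p.1 * I p.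
have mh : measurable_fun setT h.
  by apply: measurable_funM => //; exact: (measurableT_comp mD measurable_fst).
have intI w : (\int[leb]_u (I (w, u))%:E = (Z w)%:E)%E.
  under eq_integral do rewrite IE.
  rewrite integral_indic// setIT [LHS](lebesgue_measure_itv `[0, Z w[)/= lte_fin.
  case: ltgtP (Z0 w) => // [|<-] _; first by rewrite oppr0 adde0.
  by [].
have ih : (P \x leb)%E.-integrable setT (EFin \o h).
  apply/integrable12ltyP; first exact/measurable_EFinP.
  case/integrableP : iDZ => _; apply: le_lt_trans.
  rewrite le_eqVlt; apply/orP; left; apply/eqP; apply: eq_integral => w _ /=.
  rewrite (eq_integral (fun u => (`|D w|%:E * (I (w, u))%:E)%E)); last first.
    by move=> u _; rewrite /h/= normrM (ger0_norm (I0 _)) EFinM.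
  rewrite ge0_integralZl//.
  - by rewrite intI -EFinM normrM (ger0_norm (Z0 w)).
  - by apply/measurable_EFinP; exact: measurableT_comp.
  - by move=> u _; rewrite lee_fin.
have -> : \int[P]_w (D w * Z w) = fine (\int[P]_w \int[leb]_u (h (w, u))%:E)%E.
  congr fine; apply: eq_integral => w _.
  rewrite (eq_integral (fun u => ((D w)%:E * (I (w, u))%:E)%E)); last first.
    by move=> u _; rewrite /h/= EFinM.
  rewrite integralZl//; first by rewrite intI EFinM.
  apply/integrableP; split.
    by apply/measurable_EFinP; exact: measurableT_comp.
  under eq_integral do rewrite /= (ger0_norm (I0 _)).
  by rewrite intI ltry.
have -> : (\int[P]_w \int[leb]_u (h (w, u))%:E = \int[leb]_u \int[P]_w (h (w, u))%:E)%E.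
  exact: (Fubini ih).
rewrite (eq_integral (fun=> 0%E)) ?integral0// => u _ /=.
have [u0|u0] := leP 0 u; last first.
  rewrite (eq_integral (fun=> 0%E)) ?integral0// => w _ /=.
  by rewrite /h /I leNgt u0/= mulr0.
have := orth (`](u : R), +oo[)%classic (measurable_itv _).
have mE : measurable (Z @^-1` (`](u : R), +oo[)%classic).
  by rewrite -[X in measurable X]setTI; exact: mZ.
rewrite Rintegral_mkcond /Rintegral => E0.
have EQ : (\int[P]_x (D \_ (Z @^-1` (`](u : R), +oo[)%classic) x)%:E = \int[P]_w (h (w, u))%:E)%E.
  apply: eq_integral => w _; congr EFin.
  rewrite /h /I u0/= patchE.
  have -> : (w \in Z @^-1` (`](u : R), +oo[)%classic) = (u < Z w).
    by apply/idP/idP; rewrite inE/= in_itv/= andbT.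
  by case: (u < Z w); rewrite ?mulr1 ?mulr0.
rewrite -EQ -[LHS]fineK ?E0//.
apply: integrable_fin_num => //.
rewrite (_ : (fun _ => _) = (EFin \o D) \_ (Z @^-1` (`](u : R), +oo[)%classic)); last first.
  by apply/funext => w; rewrite /= !patchE; case: ifP.
by apply/(integrable_mkcond _ mE); exact: integrableS iD.
Qed.

(** The positive and the negative part of [Z] reduce to the previous case. *)
Lemma orthogonal_preimages (D Z : T -> R) :
  P.-integrable setT (EFin \o D) -> measurable_fun setT Z ->
  P.-integrable setT (EFin \o (fun w => D w * Z w)) ->
  (forall A, measurable A -> \int[P]_(w in Z @^-1` A) D w = 0) ->
  \int[P]_w (D w * Z w) = 0.
Proof.
move=> iD mZ iDZ orth.
have mD : measurable_fun setT D by case/integrableP : iD => /measurable_EFinP.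
have part (s : R) : `|s| = 1 ->
    P.-integrable setT (EFin \o (fun w => D w * Num.max (s * Z w) 0)) /\
    \int[P]_w (D w * Num.max (s * Z w) 0) = 0.
  move=> s1.
  have mM : measurable_fun setT (fun w => Num.max (s * Z w) 0).
    by apply: measurable_maxr => //; exact: measurable_funM.
  have iM : P.-integrable setT (EFin \o (fun w => D w * Num.max (s * Z w) 0)).
    apply: (integrable_le _ (integrable_norm iDZ)) => //.
      exact: measurable_funM.
    move=> w; rewrite normrM [leRHS]normrM ler_wpM2l//.
    have -> : `|Z w| = `|s * Z w| by rewrite normrM s1 mul1r.
    by case: (leP (s * Z w) 0) => sZ; rewrite ?normr0.
  split=> //; apply: orthogonal_preimages_nonneg => //.
    by move=> w; rewrite le_max lexx orbT.
  move=> A mA; apply: (orth ((fun z => Num.max (s * z) 0) @^-1` A)).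
  rewrite -[X in measurable X]setTI.
  suff : measurable_fun setT (fun z : R => Num.max (s * z) 0) by exact.
  by apply: measurable_maxr => //; exact: measurable_funM.
have [i1 e1] := part 1 (normr1 _).
have [i2 e2] := part (-1) (normrN1 _).
rewrite (_ : \int[P]_w (D w * Z w) = \int[P]_w (D w * Num.max (1 * Z w) 0 -
    D w * Num.max (-1 * Z w) 0)); first by rewrite RintegralB// e1 e2 subrr.
apply: eq_Rintegral => w _; rewrite -mulrBr; congr (_ * _).
by rewrite mul1r mulN1r /Num.max/=; case: ltP => ?; case: ltP => ?; lra.
Qed.

End orthogonality.

Section independence.
Context d (T : measurableType d) (R : realType) (P : probability T R).

Lemma corthogonal (D Z : T -> R[i]) (C : R) : cmeasurable D -> cmeasurable Z ->
  (forall w, normc (D w) <= C) -> (forall w, normc (Z w) <= 1) ->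
  (forall A, measurable A ->
     cintegral P setT (fun w => D w * (\1_((fun w => Re (Z w)) @^-1` A) w)%:C) = 0) ->
  (forall A, measurable A ->
     cintegral P setT (fun w => D w * (\1_((fun w => Im (Z w)) @^-1` A) w)%:C) = 0) ->
  cintegral P setT (fun w => D w * Z w) = 0.
Proof.
move=> mD mZ DC Z1 oRe oIm.
have iC : P.-integrable setT (EFin \o (fun=> C)) by exact: finite_measure_integrable_cst.
have [iD1 iD2] : cintegrable P D by exact: (cintegrable_dominated mD iC).
have key (D' Z' : T -> R) : P.-integrable setT (EFin \o D') ->
    (forall w, `|D' w| <= C) -> measurable_fun setT Z' -> (forall w, `|Z' w| <= 1) ->
    (forall A, measurable A -> \int[P]_w (D' w * \1_(Z' @^-1` A) w) = 0) ->
    P.-integrable setT (EFin \o (fun w => D' w * Z' w)) /\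
    \int[P]_w (D' w * Z' w) = 0.
  move=> iD' D'C mZ' Z'1 o.
  have mD' : measurable_fun setT D' by case/integrableP : iD' => /measurable_EFinP.
  have i' : P.-integrable setT (EFin \o (fun w => D' w * Z' w)).
    apply: (integrable_le _ iC); first exact: measurable_funM.
    by move=> w; rewrite normrM -[leRHS]mulr1 ler_pM.
  split=> //; apply: orthogonal_preimages => // A mA.
  rewrite Rintegral_mkcond -[RHS](o _ mA); apply: eq_Rintegral => w _.
  by rewrite patchE indicE; case: ifP; rewrite ?mulr1 ?mulr0.
case: mZ => mZ1 mZ2.
have C1 w : `|Re (D w)| <= C by rewrite (le_trans (normr_Re_le _)).
have C2 w : `|Im (D w)| <= C by rewrite (le_trans (normr_Im_le _)).
have N1 w : `|Re (Z w)| <= 1 by rewrite (le_trans (normr_Re_le _)).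
have N2 w : `|Im (Z w)| <= 1 by rewrite (le_trans (normr_Im_le _)).
have RE (u : T -> R) : cintegral P setT (fun w => D w * (u w)%:C) = 0 ->
    \int[P]_w (Re (D w) * u w) = 0 /\ \int[P]_w (Im (D w) * u w) = 0.
  move=> E; split.
  - transitivity (Re (cintegral P setT (fun w => D w * (u w)%:C))); last by rewrite E.
    by apply: eq_Rintegral => w _; rewrite -[RHS]/(Re (D w * (u w)%:C)) ReM /= mulr0 subr0.
  - transitivity (Im (cintegral P setT (fun w => D w * (u w)%:C))); last by rewrite E.
    by apply: eq_Rintegral => w _; rewrite -[RHS]/(Im (D w * (u w)%:C)) ImM /= mulr0 add0r.
have [i11 e11] := key _ _ iD1 C1 mZ1 N1 (fun A mA => (RE _ (oRe A mA)).1).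
have [i12 e12] := key _ _ iD1 C1 mZ2 N2 (fun A mA => (RE _ (oIm A mA)).1).
have [i21 e21] := key _ _ iD2 C2 mZ1 N1 (fun A mA => (RE _ (oRe A mA)).2).
have [i22 e22] := key _ _ iD2 C2 mZ2 N2 (fun A mA => (RE _ (oIm A mA)).2).
apply: eqc => /=.
- transitivity (\int[P]_w (Re (D w) * Re (Z w) - Im (D w) * Im (Z w))).
    by apply: eq_Rintegral => w _; rewrite ReM.
  by rewrite RintegralB// e11 e22 subrr.
- transitivity (\int[P]_w (Re (D w) * Im (Z w) + Im (D w) * Re (Z w))).
    by apply: eq_Rintegral => w _; rewrite ImM.
  by rewrite RintegralD// e12 e21 addr0.
Qed.

Lemma prod_normc_le1 (I : Type) (r : seq I) (p : pred I) (F : I -> R[i]) :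
  (forall i, p i -> normc (F i) <= 1) -> \prod_(i <- r | p i) normc (F i) <= 1.
Proof.
move=> F1; suff /andP[] : 0 <= \prod_(i <- r | p i) normc (F i) <= 1 by [].
elim/big_ind : _ => [|x y /andP[x0 x1] /andP[y0 y1]|i pi].
- by rewrite ler01 lexx.
- by rewrite mulr_ge0//= -[leRHS]mulr1 ler_pM.
- by rewrite normc_ge0 F1.
Qed.

Lemma rmorph_prod_indic (n : nat) (E : 'I_n -> set T) (w : T) :
  \prod_(l < n) (\1_(E l) w)%:C =
  (\1_(\bigcap_(l in [set: 'I_n]) E l) w)%:C :> R[i].
Proof.
have [wE|] := pselect ((\bigcap_(l in [set: 'I_n]) E l) w).
  rewrite indicE mem_set// big1// => l _; rewrite indicE mem_set//.
  exact: wE.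
move=> wE; rewrite indicE memNset//.
have [l nEl] : exists l, ~ E l w by apply/existsNP => H; apply: wE => l _; exact: H.
by rewrite (bigD1 l)//= indicE memNset// mul0r.
Qed.

(** The product rule is the case where all the factors are indicators. They are
    replaced one at a time: with the other factors fixed, the difference of the
    two sides is a linear functional of the remaining factor that vanishes on
    indicators. *)
Lemma cintegral_prod_independent (n : nat) (G : 'I_n -> set (set T))
    (f : 'I_n -> T -> R[i]) :
  (forall l A, G l A -> measurable A) -> (forall l, G l setT) ->
  (forall E : 'I_n -> set T, (forall l, G l (E l)) ->
    P (\bigcap_(l in [set: 'I_n]) E l) = (\prod_(l < n) fine (P (E l)))%:E) ->
  (forall l A, measurable A -> G l ((fun w => Re (f l w)) @^-1` A)) ->
  (forall l A, measurable A -> G l ((fun w => Im (f l w)) @^-1` A)) ->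
  (forall l w, normc (f l w) <= 1) ->
  cintegral P setT (fun w => \prod_(l < n) f l w) =
  \prod_(l < n) cintegral P setT (f l).
Proof.
move=> mG GT ind fRe fIm f1.
have mf l : cmeasurable (f l).
  split => _ A mA; rewrite setTI; apply: (mG l); [exact: fRe|exact: fIm].
(* The first [k] factors are those of [f], the others are indicators. *)
pose F k (E : 'I_n -> set T) (l : 'I_n) (w : T) : R[i] :=
  if (l < k)%N then f l w else (\1_(E l) w)%:C.
have F1 k E l w : normc (F k E l w) <= 1.
  rewrite /F; case: ifP => // _; rewrite normc_real indicE.
  by case: (_ \in _); rewrite ?normr1 ?normr0.
have mF k E l : (forall l, G l (E l)) -> cmeasurable (F k E l).
  move=> GE; rewrite /F; case: (l < k)%N => //; apply: cmeasurable_real.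
  by apply: measurable_indic; exact: (mG l).
have claim k E : (forall l, G l (E l)) ->
    cintegral P setT (fun w => \prod_(l < n) F k E l w) =
    \prod_(l < n) cintegral P setT (F k E l).
  elim: k E => [|k ih] E GE.
    transitivity ((fine (P (\bigcap_(l in [set: 'I_n]) E l)))%:C).
      have mE : measurable (\bigcap_(l in [set: 'I_n]) E l).
        by apply: fin_bigcap_measurable => // l _; exact: (mG l).
      rewrite -(setIT (\bigcap_(l in [set: 'I_n]) E l)) -(integral_indic P)//.
      rewrite -cintegral_real; apply: eq_cintegral => w.
      by rewrite -[RHS]rmorph_prod_indic; apply: eq_bigr.
    rewrite ind//= rmorph_prod; apply: eq_bigr => l _.
    rewrite /F/= cintegral_real /Rintegral integral_indic ?setIT//.
    exact: (mG l).
  have [nk|kn] := leqP n k.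
    have -> : F k.+1 E = F k E; last exact: ih.
    apply/funext => l; apply/funext => w; rewrite /F ltnS.
    by rewrite (leq_trans (ltnW (ltn_ord l)) nk) (leq_trans (ltn_ord l) nk).
  pose l0 := Ordinal kn.
  have Fne E1 E2 l w : l != l0 -> E1 l = E2 l -> F k.+1 E1 l w = F k E2 l w.
    move=> ll0 E12; rewrite /F ltnS leq_eqVlt E12.
    by have -> : (l == k :> nat) = false by apply/negbTE.
  pose W w := \prod_(l < n | l != l0) F k E l w.
  pose c := \prod_(l < n | l != l0) cintegral P setT (F k E l).
  have WE w : W w = \prod_(l <- [seq l <- index_enum 'I_n | l != l0]) F k E l w.
    by rewrite /W big_filter.
  have mW : cmeasurable W.
    rewrite (_ : W = fun w => \prod_(l <- [seq l <- index_enum 'I_n | l != l0]) F k E l w).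
      by apply: cmeasurable_prod => l; exact: mF.
    by apply/funext.
  have W1 w : normc (W w) <= 1.
    rewrite /W normc_prod; by apply: prod_normc_le1 => l _; exact: F1.
  have i1 (h : T -> R[i]) : cmeasurable h -> (forall w, normc (h w) <= 1) -> cintegrable P h.
    move=> mh h1; apply: (@cintegrable_dominated _ _ _ P _ (fun=> 1)) => //.
    exact: finite_measure_integrable_cst.
  have m1 B : G l0 B -> cmeasurable (fun w => (\1_B w)%:C : R[i]).
    by move=> GB; apply: cmeasurable_real; apply: measurable_indic; exact: mG GB.
  have n1 (B : set T) w : normc ((\1_B w)%:C : R[i]) <= 1.
    by rewrite normc_real indicE; case: (_ \in _); rewrite ?normr1 ?normr0.
  have WB B : G l0 B -> cintegral P setT (fun w => (\1_B w)%:C * W w) =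
      cintegral P setT (fun w => (\1_B w)%:C) * c.
    move=> GB; pose E' l := if l == l0 then B else E l.
    have GE' l : G l (E' l) by rewrite /E'; case: eqP => [->|].
    have Fl0 w : F k E' l0 w = (\1_B w)%:C by rewrite /F ltnn /E' eqxx.
    have FE' l w : l != l0 -> F k E' l w = F k E l w.
      by move=> /negbTE ll0; rewrite /F /E' ll0.
    have := ih E' GE'; rewrite (bigD1 l0)//= => IH.
    rewrite -(eq_cintegral _ Fl0) /c.
    have -> : \prod_(l < n | l != l0) cintegral P setT (F k E l) =
        \prod_(l < n | l != l0) cintegral P setT (F k E' l).
      apply: eq_bigr => l ll0; apply: eq_cintegral => w.
      by rewrite FE'.
    rewrite -IH; apply: eq_cintegral => w; rewrite (bigD1 l0)//= Fl0; congr (_ * _).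
    by apply: eq_bigr => l ll0; rewrite FE'.
  have iW := i1 _ mW W1.
  have orth B : G l0 B -> cintegral P setT (fun w => (W w - c) * (\1_B w)%:C) = 0.
    move=> GB; have iB := i1 _ (m1 _ GB) (n1 B).
    have iWB : cintegrable P (fun w => (\1_B w)%:C * W w).
      apply: i1; first by apply: cmeasurableM => //; exact: m1.
      by move=> w; rewrite normcM -[leRHS]mulr1 ler_pM ?normc_ge0.
    transitivity (cintegral P setT (fun w => (\1_B w)%:C * W w + (- c) * (\1_B w)%:C)).
      by apply: eq_cintegral => w; ring.
    by rewrite cintegralD ?cintegralZ ?WB//; [ring|exact: cintegrableZ].
  have O : cintegral P setT (fun w => (W w - c) * f l0 w) = 0.
    apply: (@corthogonal _ _ (1 + normc c)) => //.
    - by apply: cmeasurableD => //; exact: cmeasurable_cst.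
    - by move=> w; rewrite (le_trans (le_normcD _ _))// normcN lerD2r.
    - by move=> A mA; apply: orth; exact: fRe.
    - by move=> A mA; apply: orth; exact: fIm.
  have iWf : cintegrable P (fun w => f l0 w * W w).
    apply: i1; first exact: cmeasurableM.
    by move=> w; rewrite normcM -[leRHS]mulr1 ler_pM ?normc_ge0.
  have if0 := i1 _ (mf l0) (f1 l0).
  have Wf : cintegral P setT (fun w => f l0 w * W w) = cintegral P setT (f l0) * c.
    apply/eqP; rewrite -subr_eq0 -O; apply/eqP.
    rewrite mulrC -mulNr -cintegralZ// -cintegralD//; last exact: cintegrableZ.
    by apply: eq_cintegral => w; ring.
  have Fl0 : F k.+1 E l0 = f l0 by apply/funext => w; rewrite /F ltnSn.
  transitivity (cintegral P setT (fun w => f l0 w * W w)).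
    apply: eq_cintegral => w; rewrite (bigD1 l0)//= Fl0; congr (_ * _).
    by apply: eq_bigr => l ll0; rewrite (Fne _ E).
  rewrite Wf (bigD1 l0)//= Fl0; congr (_ * _); apply: eq_bigr => l ll0.
  by apply: eq_cintegral => w; rewrite (Fne _ E).
transitivity (cintegral P setT (fun w => \prod_(l < n) F n (fun=> setT) l w)).
  by apply: eq_cintegral => w; apply: eq_bigr => l _; rewrite /F ltn_ord.
rewrite claim//; apply: eq_bigr => l _; apply: eq_cintegral => w.
by rewrite /F ltn_ord.
Qed.

End independence.

(** * Gaussian integrals *)

Section gaussian_integrals.
Context (R : realType).
Local Notation leb := (@lebesgue_measure R).
Implicit Types (A m y th : R).

Definition gauss A m y : R := expR (- (A / 2 * (y - m) ^+ 2)).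

Lemma gauss_ge0 A m y : 0 <= gauss A m y.
Proof. exact: expR_ge0. Qed.

Lemma gauss_normal_fun A m : 0 < A ->
  gauss A m = normal_fun m (Num.sqrt A)^-1.
Proof.
move=> A0; apply/funext => y; rewrite /gauss /normal_fun; congr expR.
rewrite exprVn sqr_sqrtr ?ltW// -mulr_natr; field.
by rewrite gt_eqF.
Qed.

Lemma sqrtV_neq0 A : 0 < A -> (Num.sqrt A)^-1 != 0.
Proof. by move=> A0; rewrite invr_neq0// gt_eqF// sqrtr_gt0. Qed.

Lemma gauss_pdf A m : 0 < A ->
  gauss A m = fun y => Num.sqrt (2 * pi / A) * normal_pdf m (Num.sqrt A)^-1 y.
Proof.
move=> A0; rewrite gauss_normal_fun// normal_pdfE ?sqrtV_neq0//.
apply/funext => y; rewrite mulrA /normal_peak exprVn sqr_sqrtr ?ltW//.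
rewrite (_ : A^-1 * pi *+ 2 = 2 * pi / A); last by rewrite -mulr_natr; ring.
by rewrite divff ?mul1r// gt_eqF// sqrtr_gt0 divr_gt0// mulr_gt0// pi_gt0.
Qed.

Lemma integrable_gauss A m : 0 < A -> leb.-integrable setT (EFin \o gauss A m).
Proof.
move=> A0; rewrite gauss_pdf//.
exact: (integrable_realZ _ (integrable_normal_pdf m (Num.sqrt A)^-1)).
Qed.

Lemma Rintegral_gauss A m : 0 < A -> \int[leb]_y gauss A m y = Num.sqrt (2 * pi / A).
Proof.
move=> A0; rewrite gauss_pdf// RintegralZl//; last exact: integrable_normal_pdf.
by rewrite /Rintegral integral_normal_pdf mulr1.
Qed.

Lemma exp_ge_pow (x : R) (k : nat) : 0 <= x -> x ^+ k <= k`!%:R * expR x.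
Proof.
move=> x0; case: k => [|k].
  rewrite expr0 fact0 mul1r (le_trans _ (expR_ge1Dx x))// lerDl//.
rewrite mulrC -ler_pdivrMr ?ltr0n ?fact_gt0//.
by rewrite (le_trans _ (expR_ge1Dxn k x0))// lerDr.
Qed.

(** Half of the exponent absorbs the power. *)
Lemma pow_gauss_le A m y (k : nat) : 0 < A ->
  (y - m) ^+ (2 * k) * gauss A m y <= k`!%:R * (4 / A) ^+ k * gauss (A / 2) m y.
Proof.
move=> A0; pose v := A / 4 * (y - m) ^+ 2.
have v0 : 0 <= v by rewrite mulr_ge0 ?sqr_ge0// divr_ge0// ltW.
have vk : v ^+ k * expR (- v) <= k`!%:R.
  by rewrite expRN ler_pdivrMr ?expR_gt0// exp_ge_pow.
have -> : gauss A m y = gauss (A / 2) m y * expR (- v).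
  by rewrite /gauss -expRD; congr expR; rewrite /v; field.
have -> : (y - m) ^+ (2 * k) = (4 / A) ^+ k * v ^+ k.
  by rewrite exprM -exprMn /v; congr (_ ^+ k); field; rewrite gt_eqF.
rewrite [leLHS](_ : _ = (4 / A) ^+ k * gauss (A / 2) m y * (v ^+ k * expR (- v))); last by ring.
rewrite [leRHS](_ : _ = (4 / A) ^+ k * gauss (A / 2) m y * k`!%:R); last by ring.
by rewrite ler_wpM2l// mulr_ge0 ?gauss_ge0// exprn_ge0// divr_ge0// ltW.
Qed.

Lemma normr_gauss_le A m y : 0 < A ->
  `|y - m| * gauss A m y <= (1 + 4 / A) * gauss (A / 2) m y.
Proof.
move=> A0; have h1 := pow_gauss_le m y 1 A0.
have h0 : gauss A m y <= gauss (A / 2) m y.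
  have := pow_gauss_le m y 0 A0.
  by rewrite muln0 !expr0 fact0 !mul1r.
have : `|y - m| <= 1 + (y - m) ^+ 2.
  rewrite -real_normK ?num_real//.
  by have := sqr_ge0 (`|y - m| - 1); have := normr_ge0 (y - m); nra.
move=> /(ler_wpM2r (gauss_ge0 A m y)) /le_trans; apply.
rewrite [leLHS]mulrDl [leRHS]mulrDl !mul1r lerD//.
by move: h1; rewrite muln1 expr1 (_ : 1`! = 1%N)// mul1r.
Qed.

Lemma measurable_gauss A m : measurable_fun setT (gauss A m).
Proof.
apply: measurableT_comp => //=; apply: measurableT_comp => //=.
apply: measurable_funM => //=; apply: measurable_funX => //=; exact: measurable_funB.
Qed.

Lemma cvg_gauss_pinfty A m : 0 < A -> gauss A m y @[y --> +oo] --> (0 : R).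
Proof.
move=> A0.
rewrite (_ : gauss A m = gauss_fun \o (fun y => Num.sqrt (A / 2) * (y - m))).
  apply: cvg_comp (@cvg_gauss_fun R).
  apply/gt0_cvgMry; last exact: cvg_addrr.
  by rewrite sqrtr_gt0 divr_gt0.
apply/funext => y; rewrite /gauss_fun /gauss/= exprMn sqr_sqrtr//.
by rewrite divr_ge0// ltW.
Qed.

Lemma cvg_gauss_nat A m : 0 < A -> gauss A m n%:R @[n --> \oo] --> (0 : R).
Proof.
by move=> A0; apply: cvg_comp (cvg_gauss_pinfty m A0); exact: cvgr_idn.
Qed.

Lemma is_derive_sin_gauss A m th phi y : is_derive y (1 : R)
  (fun y => sin (th * (y - m) + phi) * gauss A m y)
  (th * (cos (th * (y - m) + phi) * gauss A m y) -
   A * ((y - m) * sin (th * (y - m) + phi) * gauss A m y)).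
Proof.
rewrite /gauss; apply: is_derive_eq.
by rewrite /GRing.scale/=; field.
Qed.

Lemma continuous_is_derive (f f' : R -> R) :
  (forall y, is_derive y (1 : R) f (f' y)) -> continuous f.
Proof.
move=> df y; apply/differentiable_continuous/derivable1_diffP.
by have [] := df y.
Qed.

Lemma continuous_sin_gauss A m th phi :
  continuous (fun y : R => sin (th * (y - m) + phi) * gauss A m y).
Proof. exact: (continuous_is_derive (is_derive_sin_gauss A m th phi)). Qed.

Lemma continuous_cos_gauss A m th phi :
  continuous (fun y : R => cos (th * (y - m) + phi) * gauss A m y).
Proof.
rewrite (_ : (fun y => _) = fun y => sin (th * (y - m) + (phi + pi / 2)) * gauss A m y).
  exact: continuous_sin_gauss.
by apply/funext => y; rewrite addrA sinDpihalf.
Qed.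

Lemma cvg_Rintegral_symm (u : R -> R) : leb.-integrable setT (EFin \o u) ->
  \int[leb]_(y in `[- n%:R, n%:R]) u y @[n --> \oo] --> \int[leb]_y u y.
Proof.
move=> iu.
have mu : measurable_fun setT u by case/integrableP : iu => /measurable_EFinP.
under eq_fun do rewrite Rintegral_mkcond.
apply: fine_cvg; rewrite fineK; last exact: integrable_fin_num.
apply: (@dominated_cvg _ _ R leb setT measurableT
  (fun n : nat => EFin \o (u \_ `[- n%:R, n%:R])) (EFin \o u)
  (EFin \o (fun y => `|u y|))).
- move=> n; apply/measurable_EFinP.
  apply/(measurable_restrictT u) => //; exact: measurable_funS mu.
- move=> y _; apply: cvg_near_cst.
  near=> n; rewrite /= patchE ifT// inE/= in_itv/= -ler_norml.
  near: n; exact: nbhs_infty_ger.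
- by [].
- exact: integrable_norm.
- move=> n y _; rewrite /= patchE lee_fin; case: ifP => //.
  by rewrite normr0.
Unshelve. all: by end_near. Qed.

(** The boundary terms in the fundamental theorem of calculus tend to zero. *)
Lemma Rintegral_derive_gauss0 (F u : R -> R) (C A m : R) : 0 < A ->
  (forall y, is_derive y (1 : R) F (u y)) -> continuous u ->
  leb.-integrable setT (EFin \o u) -> (forall y, `|F y| <= C * gauss A m y) ->
  \int[leb]_y u y = 0.
Proof.
move=> A0 dF cu iu FG.
have cF : continuous F := continuous_is_derive dF.
have FTC (n : nat) : \int[leb]_(y in `[- n.+1%:R, n.+1%:R]) u y = F n.+1%:R - F (- n.+1%:R).
  rewrite /Rintegral (@continuous_FTC2 _ u F)//.
  - by rewrite gtrN.
  - exact: continuous_subspaceT.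
  - split => [y _||].
    + by have [] := dF y.
    + exact/cvg_at_right_filter/cF.
    + exact/cvg_at_left_filter/cF.
  - by move=> y _; rewrite derive1E; have [_ ->] := dF y.
have F0 (s : R) : `|s| = 1 -> F (s * n.+1%:R) @[n --> \oo] --> (0 : R).
  move=> s1; apply: norm_cvg0.
  have gc : C * gauss A (s * m) n.+1%:R @[n --> \oo] --> (0 : R).
    rewrite -(mulr0 C); apply: cvgM; first exact: cvg_cst.
    by have := cvg_gauss_nat (s * m) A0; rewrite -(cvg_shiftS _).
  apply: (squeeze_cvgr _ (cvg_cst (0 : R)) gc); near=> n.
  rewrite normr_ge0/=.
  have -> : gauss A (s * m) n.+1%:R = gauss A m (s * n.+1%:R).
    rewrite /gauss; congr (expR (- (_ * _))).
    have ss : s * s = 1 by rewrite -expr2 -real_normK ?num_real// s1 expr1n.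
    rewrite (_ : s * n.+1%:R - m = s * (n.+1%:R - s * m)); first by rewrite exprMn (expr2 s) ss mul1r.
    by rewrite mulrBr [s * (s * m)]mulrA ss mul1r.
  exact: FG.
have lim1 : \int[leb]_(y in `[- n.+1%:R, n.+1%:R]) u y @[n --> \oo] --> \int[leb]_y u y.
  by have := cvg_Rintegral_symm iu; rewrite -(cvg_shiftS _).
have lim2 : \int[leb]_(y in `[- n.+1%:R, n.+1%:R]) u y @[n --> \oo] --> (0 : R).
  under eq_fun do rewrite FTC.
  rewrite -[0]subr0; apply: cvgB.
  - by have := F0 1 (normr1 _); under eq_fun do rewrite mul1r.
  - by have := F0 (-1) (normrN1 _); under eq_fun do rewrite mulN1r.
exact: (cvg_unique _ lim1 lim2).
Unshelve. all: by end_near. Qed.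

(** Integration by parts. *)
Lemma Rintegral_derive_sin_gauss A m th phi : 0 < A ->
  A * \int[leb]_y ((y - m) * sin (th * (y - m) + phi) * gauss A m y) =
  th * \int[leb]_y (cos (th * (y - m) + phi) * gauss A m y).
Proof.
move=> A0.
have A20 : 0 < A / 2 by rewrite divr_gt0.
have c1 : continuous (fun y : R => (y - m) * sin (th * (y - m) + phi) * gauss A m y).
  rewrite (_ : (fun y => _) = fun y : R => (y - m) * (sin (th * (y - m) + phi) * gauss A m y)).
    move=> y; apply: cvgM; last exact: continuous_sin_gauss.
    by apply: cvgB; [exact: cvg_id|exact: cvg_cst].
  by apply/funext => y; rewrite mulrA.
have i1 : leb.-integrable setT
    (EFin \o (fun y => (y - m) * sin (th * (y - m) + phi) * gauss A m y)).
  apply: (@integrable_le _ _ _ leb _ (fun y => (1 + 4 / A) * gauss (A / 2) m y)).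
  - exact: (continuous_measurable_fun c1).
  - exact/integrable_realZ/integrable_gauss.
  - move=> y; rewrite normrM (ger0_norm (gauss_ge0 _ _ _)).
    apply: le_trans (normr_gauss_le m y A0); rewrite ler_wpM2r ?gauss_ge0//.
    by rewrite normrM -[leRHS]mulr1 ler_wpM2l// sin_max.
have i2 : leb.-integrable setT
    (EFin \o (fun y => cos (th * (y - m) + phi) * gauss A m y)).
  apply: (@integrable_le _ _ _ leb _ (gauss A m)).
  - exact: (continuous_measurable_fun (@continuous_cos_gauss A m th phi)).
  - exact: integrable_gauss.
  - move=> y; rewrite normrM (ger0_norm (gauss_ge0 _ _ _)) -[leRHS]mul1r.
    by rewrite ler_wpM2r ?gauss_ge0// cos_max.
rewrite -!RintegralZl//; apply/eqP; rewrite eq_sym -subr_eq0 -RintegralB//; first last.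
- exact: integrable_realZ.
- exact: integrable_realZ.
apply/eqP; set u := fun y => _ - _.
have iu : leb.-integrable setT (EFin \o u).
  by apply: integrable_realB; exact: integrable_realZ.
have cu : continuous u.
  move=> y; apply: cvgB; apply: cvgM; try exact: cvg_cst.
    exact: continuous_cos_gauss.
  exact: c1.
apply: (@Rintegral_derive_gauss0 (fun y => sin (th * (y - m) + phi) * gauss A m y) u 1 A m) => // y.
  exact: is_derive_sin_gauss.
rewrite mul1r normrM (ger0_norm (gauss_ge0 _ _ _)) -[leRHS]mul1r.
by rewrite ler_wpM2r ?gauss_ge0// sin_max.
Qed.

Lemma integrable_sqr_gauss A m : 0 < A ->
  leb.-integrable setT (EFin \o (fun y => (y - m) ^+ 2 * gauss A m y)).
Proof.
move=> A0; apply: (@integrable_le _ _ _ leb _ (fun y => 1`!%:R * (4 / A) ^+ 1 * gauss (A / 2) m y)).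
- suff : measurable_fun setT (fun y : R => (y - m) ^+ 2 * gauss A m y) by [].
  apply: measurable_funM; last exact: measurable_gauss.
  by apply: (@measurable_funX _ _ _ setT (fun y : R => y - m) 2); exact: measurable_funB.
- by apply: integrable_realZ; apply: integrable_gauss; rewrite divr_gt0.
- move=> y; rewrite ger0_norm; first exact: (pow_gauss_le m y 1 A0).
  by rewrite mulr_ge0 ?gauss_ge0// sqr_ge0.
Qed.

Lemma Rintegral_sqr_gauss A m : 0 < A ->
  \int[leb]_y ((y - m) ^+ 2 * gauss A m y) = Num.sqrt (2 * pi / A) / A.
Proof.
move=> A0; have An0 : A != 0 by rewrite gt_eqF.
apply: (mulfI An0); rewrite mulrCA divff// mulr1 -(Rintegral_gauss m A0).
rewrite -RintegralZl//; last exact: integrable_sqr_gauss.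
apply/eqP; rewrite eq_sym -subr_eq0 -RintegralB//; first last.
- by apply: integrable_realZ; exact: integrable_sqr_gauss.
- exact: integrable_gauss.
apply/eqP; set u := fun y => _ - _.
have dF y : is_derive y (1 : R) (fun y => (y - m) * gauss A m y) (u y).
  rewrite /u /gauss; apply: is_derive_eq.
  by rewrite /GRing.scale/=; field.
have cg : continuous (gauss A m).
  suff H y : is_derive y (1 : R) (gauss A m) (- (A * (y - m)) * gauss A m y).
    exact: (continuous_is_derive H).
  rewrite /gauss; apply: is_derive_eq.
  by rewrite /GRing.scale/=; field.
have iu : leb.-integrable setT (EFin \o u).
  apply: integrable_realB; first exact: integrable_gauss.
  by apply: integrable_realZ; exact: integrable_sqr_gauss.
have cu : continuous u.
  move=> y; apply: cvgB; first exact: cg.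
  apply: cvgM; first exact: cvg_cst.
  apply: cvgM; last exact: cg.
  suff : continuous (fun y : R => (y - m) ^+ 2) by exact.
  move=> z; under eq_fun do rewrite expr2.
  by apply: cvgM; apply: cvgB; try exact: cvg_id; exact: cvg_cst.
apply: (Rintegral_derive_gauss0 (divr_gt0 A0 (ltr0Sn _ 1)) dF cu iu) => y.
rewrite normrM (ger0_norm (gauss_ge0 _ _ _)); exact: normr_gauss_le.
Qed.

End gaussian_integrals.

Section gaussian_characteristic_function.
Context (R : realType).
Local Notation leb := (@lebesgue_measure R).

Lemma integrable_cos_gauss (A m th phi : R) : 0 < A -> leb.-integrable setT
  (EFin \o (fun y => cos (th * (y - m) + phi) * gauss A m y)).
Proof.
move=> A0; apply: (@integrable_le _ _ _ leb _ (gauss A m)).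
- exact: (continuous_measurable_fun (@continuous_cos_gauss R A m th phi)).
- exact: integrable_gauss.
- move=> y; rewrite normrM (ger0_norm (gauss_ge0 _ _ _)) -[leRHS]mul1r.
  by rewrite ler_wpM2r ?gauss_ge0// cos_max.
Qed.

Lemma is_derive_Rintegral_cos_gauss (A m th phi : R) : 0 < A ->
  is_derive th (1 : R) (fun t => \int[leb]_y (cos (t * (y - m) + phi) * gauss A m y))
    (- \int[leb]_y ((y - m) * sin (th * (y - m) + phi) * gauss A m y)).
Proof.
move=> A0.
pose f (t : R) (y : g_sigma_algebraType R.-ocitv.-measurable) : R :=
  cos (t * (y - m) + phi) * gauss A m y.
have df t y : is_derive t (1 : R) (f ^~ y) (- ((y - m) * sin (t * (y - m) + phi) * gauss A m y)).
  rewrite /f; apply: is_derive_eq.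
  by rewrite /GRing.scale/=; ring.
have p1 t y : partial1of2 f t y = - ((y - m) * sin (t * (y - m) + phi) * gauss A m y).
  by rewrite partial1of2E; have [_ ->] := df t y.
have thI : th \in `]th - 1, th + 1[ by rewrite in_itv/= ltrBlDr ltrDl ltr01.
have int_f t : `]th - 1, th + 1[%classic t -> leb.-integrable setT (EFin \o f t).
  by move=> _; exact: integrable_cos_gauss.
have der_f t y : `]th - 1, th + 1[%classic t -> setT y -> derivable (f ^~ y) t 1.
  by move=> _ _; have [] := df t y.
pose G (y : g_sigma_algebraType R.-ocitv.-measurable) : R := (1 + 4 / A) * gauss (A / 2) m y.
have G0 y : 0 <= G y by rewrite mulr_ge0 ?gauss_ge0// addr_ge0// divr_ge0// ltW.
have iG : leb.-integrable setT (EFin \o G).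
  by apply: integrable_realZ; apply: integrable_gauss; rewrite divr_gt0.
have Gub t y : `]th - 1, th + 1[%classic t -> setT y -> `|partial1of2 f t y| <= G y.
  move=> _ _; rewrite p1 normrN normrM (ger0_norm (gauss_ge0 _ _ _)).
  apply: le_trans (normr_gauss_le m y A0); rewrite ler_wpM2r ?gauss_ge0//.
  by rewrite normrM -[leRHS]mulr1 ler_wpM2l// sin_max.
have D := derivable_under_integral measurableT thI int_f der_f G0 iG Gub.
have E := differentiation_under_integral measurableT thI int_f der_f G0 iG Gub.
apply: DeriveDef; first exact: D.
rewrite -derive1E E.
transitivity (\int[leb]_y ((-1) * ((y - m) * sin (th * (y - m) + phi) * gauss A m y))).
  by apply: eq_Rintegral => y _; rewrite p1 mulN1r.
rewrite RintegralZl// ?mulN1r//.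
apply: (@integrable_le _ _ _ leb _ G) => //.
- suff : measurable_fun setT (fun y : R => (y - m) * sin (th * (y - m) + phi) * gauss A m y) by [].
  apply: measurable_funM; last exact: measurable_gauss.
  apply: measurable_funM; first exact: measurable_funB.
  apply: (measurableT_comp (f := @sin R)).
    by apply: continuous_measurable_fun; exact: continuous_sin.
  by apply: measurable_funD => //; apply: measurable_funM => //; exact: measurable_funB.
- move=> y; have := Gub th y thI I.
  by rewrite p1 normrN.
Qed.

(** As a function of [th] the integral [g] solves [g' = - th / A * g]. *)
Lemma Rintegral_cos_gauss (A m th phi : R) : 0 < A ->
  \int[leb]_y (cos (th * (y - m) + phi) * gauss A m y) =
  cos phi * Num.sqrt (2 * pi / A) * expR (- (th ^+ 2 / (2 * A))).
Proof.
move=> A0.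
pose g t := \int[leb]_y (cos (t * (y - m) + phi) * gauss A m y).
have dg t : is_derive t (1 : R) g (- (t / A * g t)).
  have H := is_derive_Rintegral_cos_gauss m t phi A0.
  apply: is_derive_eq; congr (- _).
  apply: (@mulfI _ A); first by rewrite gt_eqF.
  rewrite Rintegral_derive_sin_gauss// /g; field; by rewrite gt_eqF.
pose k t := g t * expR (t ^+ 2 / (2 * A)).
have dk t : is_derive t (1 : R) k 0.
  rewrite /k; have dgt := dg t; apply: is_derive_eq.
  by rewrite /GRing.scale/=; field; rewrite gt_eqF.
have := is_derive_0_is_cst th 0 dk.
rewrite /k expr0n/= mul0r expR0 mulr1 => kE.
have -> : cos phi * Num.sqrt (2 * pi / A) = g 0.
  rewrite /g -(Rintegral_gauss m A0) -RintegralZl//; last exact: integrable_gauss.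
  by apply: eq_Rintegral => y _; rewrite mul0r add0r.
by rewrite -kE -mulrA -expRD subrr expR0 mulr1.
Qed.

Lemma cintegral_expi_gauss (A m th : R) : 0 < A ->
  cintegral leb setT (fun y => expi (th * (y - m)) * (gauss A m y)%:C) =
  (Num.sqrt (2 * pi / A) * expR (- (th ^+ 2 / (2 * A))))%:C.
Proof.
move=> A0; apply: eqc => /=.
- transitivity (\int[leb]_y (cos (th * (y - m) + 0) * gauss A m y)).
    by apply: eq_Rintegral => y _; rewrite addr0 mulr0 subr0.
  by rewrite Rintegral_cos_gauss// cos0 mul1r.
- transitivity (\int[leb]_y (cos (th * (y - m) + - (pi / 2)) * gauss A m y)).
    by apply: eq_Rintegral => y _; rewrite cosBpihalf mulr0 add0r.
  by rewrite Rintegral_cos_gauss// cosN cos_pihalf !mul0r.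
Qed.

End gaussian_characteristic_function.

(** * Centred Gaussian variables *)

Section gaussian_law.
Context disp (T : measurableType disp) (R : realType) (P : probability T R).
Local Notation leb := (@lebesgue_measure R).
Local Notation RT := (g_sigma_algebraType R.-ocitv.-measurable).

Lemma ge0_integral_normal_prob (s : R) (f : RT -> \bar R) : s != 0 ->
  measurable_fun setT f -> (forall x, (0 <= f x)%E) ->
  (\int[normal_prob 0 s]_x f x = \int[leb]_x (f x * (normal_pdf 0 s x)%:E))%E.
Proof.
move=> s0 mf f0.
have dom := normal_prob_dominates 0 s.
rewrite -(Radon_Nikodym_SigmaFinite.change_of_variables dom)//.
have iRN := Radon_Nikodym_SigmaFinite.f_integrable dom.
have mpdf : measurable_fun setT (fun x : RT => (normal_pdf 0 s x)%:E).
  by apply/measurable_EFinP; exact: measurable_normal_pdf.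
apply: ae_eq_integral => //.
- by apply: emeasurable_funM => //; exact: (measurable_int leb).
- exact: emeasurable_funM.
- apply: ae_eqe_mul2l; apply: integral_ae_eq => //.
  by move=> E _ mE; rewrite -(Radon_Nikodym_SigmaFinite.f_integral dom mE).
Qed.

Lemma ge0_integral_law (U : T -> R) (Q : probability RT R) (f : RT -> \bar R) :
  measurable_fun setT U -> (forall A, measurable A -> P (U @^-1` A) = Q A) ->
  measurable_fun setT f -> (forall x, (0 <= f x)%E) ->
  (\int[P]_w f (U w) = \int[Q]_x f x)%E.
Proof.
move=> mU law mf f0.
rewrite -(@ge0_integral_pushforward _ _ _ _ R (U : T -> RT) mU P setT f)//.
by apply: eq_measure_integral => A mA _; exact: law.
Qed.

Lemma integrable_bounded (f : T -> R) (C : R) : measurable_fun setT f ->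
  (forall w, `|f w| <= C) -> P.-integrable setT (EFin \o f).
Proof.
move=> mf fC; apply: (@integrable_le _ _ _ P _ (fun=> C)) => //.
exact: finite_measure_integrable_cst.
Qed.

Lemma Rintegral_law (U : T -> R) (Q : probability RT R) (f : RT -> R) :
  measurable_fun setT U -> (forall A, measurable A -> P (U @^-1` A) = Q A) ->
  measurable_fun setT f -> (forall x, `|f x| <= 1) ->
  \int[P]_w f (U w) = \int[Q]_x f x.
Proof.
move=> mU law mf f1; congr fine.
rewrite -(@integral_pushforward _ _ _ _ R (U : T -> RT) mU P setT (EFin \o f))//.
- by apply: eq_measure_integral => A mA _; exact: law.
- exact/measurable_EFinP.
- apply: integrable_bounded (fun w => f1 (U w)); exact: (measurableT_comp mf mU).
Qed.

Lemma Rintegral_normal_prob (s : R) (f : RT -> R) : s != 0 ->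
  measurable_fun setT f -> (forall x, `|f x| <= 1) ->
  \int[normal_prob 0 s]_x f x = \int[leb]_x (f x * normal_pdf 0 s x).
Proof.
move=> s0 mf f1.
have f0 x : 0 <= 1 + f x by have := f1 x; rewrite ler_norml => /andP[]; lra.
have mf1 : measurable_fun setT (fun x => (1 + f x)%:E).
  by apply/measurable_EFinP; exact: measurable_funD.
have E := ge0_integral_normal_prob s0 mf1 (fun x => f0 x).
have bi (g : RT -> R) (C : R) : measurable_fun setT g -> (forall x, `|g x| <= C) ->
    (normal_prob 0 s).-integrable setT (EFin \o g).
  move=> mg gC; apply: (@integrable_le _ _ _ (normal_prob 0 s) _ (fun=> C)) => //.
  exact: finite_measure_integrable_cst.
have ipdf := integrable_normal_pdf 0 s.
have ifp : leb.-integrable setT (EFin \o (fun x => f x * normal_pdf 0 s x)).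
  apply: (integrable_le _ ipdf).
    by apply: measurable_funM => //; exact: measurable_normal_pdf.
  move=> x; rewrite normrM -[leRHS]mul1r (ger0_norm (normal_pdf_ge0 _ _ _)).
  by rewrite ler_wpM2r// normal_pdf_ge0.
have : \int[normal_prob 0 s]_x (1 + f x) = \int[leb]_x (normal_pdf 0 s x + f x * normal_pdf 0 s x).
  by rewrite /Rintegral E; congr fine; apply: eq_integral => x _; rewrite -EFinM mulrDl mul1r.
rewrite RintegralD//; last by exact: bi f1.
  have e1 : \int[normal_prob 0 s]_x 1 = 1 :> R.
    by rewrite Rintegral_cst// mul1r [X in fine X]probability_setT.
  have e2 : \int[leb]_x normal_pdf 0 s x = 1 by rewrite /Rintegral integral_normal_pdf.
  by rewrite RintegralD// e1 e2 => /addrI.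
by apply: (bi _ 1) => // x; rewrite normr1.
Qed.

Lemma normal_pdf_gauss (s x : R) : 0 < s ->
  normal_pdf 0 s x = (Num.sqrt (2 * pi / s ^- 2))^-1 * gauss (s ^- 2) 0 x.
Proof.
move=> s0; have A0 : 0 < s ^- 2 by rewrite invr_gt0 exprn_gt0.
rewrite gauss_pdf// mulrA mulVf ?mul1r; last first.
  by rewrite gt_eqF// sqrtr_gt0 divr_gt0// mulr_gt0// pi_gt0.
by rewrite -exprVn sqrtr_sqr gtr0_norm ?invr_gt0// invrK.
Qed.

Definition variance0 (U : T -> R) : R := \int[P]_w (U w ^+ 2).

(** The law is either a Dirac mass at the origin or has the density
    [normal_pdf]; in the second case the shift [phi] treats the real and the
    imaginary part together. *)
Lemma centered_gaussian_characteristic (U : T -> R) : centered_gaussian P U ->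
  P.-integrable setT (EFin \o (fun w => U w ^+ 2)) /\
  cintegral P setT (fun w => expi (U w)) = (expR (- (variance0 U / 2)))%:C.
Proof.
move=> [mU law].
have msq : measurable_fun setT (fun x : RT => (x ^+ 2)%:E).
  by apply/measurable_EFinP; exact: exprn_measurable.
have sq0 (x : RT) : (0 <= (x ^+ 2)%:E)%E by rewrite lee_fin sqr_ge0.
have mU2 : measurable_fun setT (fun w => U w ^+ 2) by exact: measurable_funX.
have iU2 (V : R) : (\int[P]_w (U w ^+ 2)%:E = V%:E)%E ->
    P.-integrable setT (EFin \o (fun w => U w ^+ 2)) /\ variance0 U = V.
  move=> E; split; last by rewrite /variance0 /Rintegral E.
  apply/integrableP; split; first exact/measurable_EFinP.
  under eq_integral do rewrite /= ger0_norm ?sqr_ge0//.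
  by rewrite E ltry.
have mcos : measurable_fun setT (@cos R : RT -> R).
  by apply: continuous_measurable_fun; exact: continuous_cos.
have msin : measurable_fun setT (@sin R : RT -> R).
  by apply: continuous_measurable_fun; exact: continuous_sin.
case: law => [law|[s s0 law]].
  have [|i V0] := iU2 0.
    rewrite (ge0_integral_law (Q := \d_(0 : RT)) mU law msq sq0).
    by rewrite integral_dirac// diracT mul1e expr0n.
  split=> //; rewrite V0 mul0r oppr0 expR0.
  apply: eqc => /=.
  - rewrite (Rintegral_law (Q := \d_(0 : RT)) mU law mcos (@cos_max R)).
    by rewrite /Rintegral integral_dirac//; [rewrite diracT mul1e/= cos0|exact/measurable_EFinP].
  - rewrite (Rintegral_law (Q := \d_(0 : RT)) mU law msin (@sin_max R)).
    by rewrite /Rintegral integral_dirac//; [rewrite diracT mul1e/= sin0|exact/measurable_EFinP].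
have sn0 : s != 0 by rewrite gt_eqF.
have A0 : 0 < s ^- 2 by rewrite invr_gt0 exprn_gt0.
set c := (Num.sqrt (2 * pi / s ^- 2)).
have c0 : c != 0 by rewrite gt_eqF// sqrtr_gt0 divr_gt0// mulr_gt0// pi_gt0.
have [|i V0] := iU2 (s ^+ 2).
  rewrite (ge0_integral_law (Q := normal_prob 0 s) mU law msq sq0).
  rewrite ge0_integral_normal_prob//.
  have -> : s ^+ 2 = c^-1 * \int[leb]_x ((x - 0) ^+ 2 * gauss (s ^- 2) 0 x).
    by rewrite Rintegral_sqr_gauss// -/c invrK mulrA mulVf// mul1r.
  rewrite -RintegralZl//; last exact: integrable_sqr_gauss.
  rewrite /Rintegral fineK; last first.
    apply: integrable_fin_num => //.
    by apply: integrable_realZ; exact: integrable_sqr_gauss.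
  apply: eq_integral => x _; rewrite normal_pdf_gauss// -EFinM subr0 -/c.
  by congr EFin; ring.
split=> //; rewrite V0.
have key phi : \int[P]_w cos (U w + phi) = cos phi * expR (- (s ^+ 2 / 2)).
  have mc : measurable_fun setT (fun x : RT => cos (x + phi)).
    by apply: (measurableT_comp mcos); exact: measurable_funD.
  rewrite (Rintegral_law (Q := normal_prob 0 s) mU law mc (fun x => cos_max _)).
  rewrite Rintegral_normal_prob//; last by move=> x; exact: cos_max.
  transitivity (\int[leb]_x (c^-1 * (cos (1 * (x - 0) + phi) * gauss (s ^- 2) 0 x))).
    by apply: eq_Rintegral => x _; rewrite normal_pdf_gauss// subr0 mul1r -/c; ring.
  rewrite RintegralZl//; last exact: integrable_cos_gauss.
  rewrite Rintegral_cos_gauss// -/c expr1n.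
  have -> : 1 / (2 * s ^- 2) = s ^+ 2 / 2 by field; rewrite sn0.
  by field.
apply: eqc => /=.
- transitivity (\int[P]_w cos (U w + 0)).
    by apply: eq_Rintegral => w _; rewrite addr0.
  by rewrite key cos0 mul1r.
- transitivity (\int[P]_w cos (U w + - (pi / 2))).
    by apply: eq_Rintegral => w _; rewrite cosBpihalf.
  by rewrite key cosN cos_pihalf mul0r.
Qed.

End gaussian_law.

(** * Conditional variance as a distance *)

Section square_integrable.
Context disp (T : measurableType disp) (R : realType) (P : probability T R).
Implicit Types f g : T -> R.

Definition square_integrable f :=
  measurable_fun setT f /\ P.-integrable setT (EFin \o (fun w => f w ^+ 2)).

Lemma square_integrableM f g : square_integrable f -> square_integrable g ->
  P.-integrable setT (EFin \o (fun w => f w * g w)).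
Proof.
move=> [mf if2] [mg ig2].
apply: (integrable_le (measurable_funM mf mg) (integrable_realD if2 ig2)) => w.
have H (a b : R) : `|a * b| <= a ^+ 2 + b ^+ 2.
  by rewrite ler_norml; apply/andP; split; nra.
exact: H.
Qed.

Lemma square_integrableD f g : square_integrable f -> square_integrable g ->
  square_integrable (fun w => f w + g w).
Proof.
move=> f2 g2; have fg := square_integrableM f2 g2.
case: f2 g2 => [mf if2] [mg ig2]; split; first exact: measurable_funD.
have := integrable_realD if2 (integrable_realD ig2 (integrable_realZ 2 fg)).
by apply: eq_integrable => // w _ /=; congr EFin; ring.
Qed.

Lemma square_integrableZ (k : R) f : square_integrable f ->
  square_integrable (fun w => k * f w).
Proof.
move=> [mf if2]; split; first exact: measurable_funM.
have := integrable_realZ (k ^+ 2) if2.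
by apply: eq_integrable => // w _ /=; congr EFin; ring.
Qed.

Lemma square_integrable1 f : square_integrable f -> P.-integrable setT (EFin \o f).
Proof.
move=> f2; have c1 : square_integrable (fun=> 1).
  by split => //; exact: finite_measure_integrable_cst.
have := square_integrableM f2 c1.
by apply: eq_integrable => // w _ /=; rewrite mulr1.
Qed.

Lemma Rintegral_sqr_ge0 f : 0 <= \int[P]_w (f w ^+ 2).
Proof. by apply: Rintegral_ge0 => w _; exact: sqr_ge0. Qed.

Lemma Rintegral_sqr_comb f g (a b : R) : square_integrable f -> square_integrable g ->
  \int[P]_w ((a * f w - b * g w) ^+ 2) =
  a ^+ 2 * \int[P]_w (f w ^+ 2) - 2 * a * b * \int[P]_w (f w * g w) +
  b ^+ 2 * \int[P]_w (g w ^+ 2).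
Proof.
move=> f2 g2; have fg := square_integrableM f2 g2.
case: f2 g2 => [mf if2] [mg ig2].
rewrite -!RintegralZl// -RintegralB//; try exact: integrable_realZ.
rewrite -RintegralD//; try exact: integrable_realZ.
  by apply: eq_Rintegral => w _; ring.
by apply: integrable_realB; exact: integrable_realZ.
Qed.

(** The conditional expectation is the orthogonal projection, so that the
    conditional variance bounds from below the distance to any square
    integrable variable that is measurable with respect to the conditioning. *)
Lemma cond_var_le_dist (K : set (set T)) (U V W : T -> R) (c : R) :
  (forall A, <<s K >> A -> measurable A) ->
  is_cond_var P <<s K >> U V -> (\forall w \ae P, c <= V w) ->
  square_integrable U -> square_integrable W ->
  (forall A, measurable A -> <<s K >> (W @^-1` A)) ->
  c <= \int[P]_w ((U w - W w) ^+ 2).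
Proof.
move=> Km [Z [iU iZ ZG Zavg] [iD2 iV VG Vavg]] cV U2 W2 WG.
have setTK : <<s K >> setT by exact: (@measurableT _ (g_sigma_algebraType K)).
have mU : measurable_fun setT U by case: U2.
have mZ : measurable_fun setT Z by case/integrableP : iZ => /measurable_EFinP.
have D2 : square_integrable (fun w => U w - Z w).
  by split => //; exact: measurable_funB.
have X2 : square_integrable (fun w => Z w - W w).
  have := square_integrableD (square_integrableD U2 (square_integrableZ (-1) D2))
    (square_integrableZ (-1) W2).
  by congr square_integrable; apply/funext => w; ring.
have iDX := square_integrableM D2 X2.
have iD := square_integrable1 D2.
have orth : \int[P]_w ((U w - Z w) * (Z w - W w)) = 0.
  apply: orthogonal_preimages => //; first by case: X2.
  move=> A mA.
  have EG : <<s K >> ((fun w => Z w - W w) @^-1` A).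
    pose T' := g_sigma_algebraType K.
    have mZ' : measurable_fun setT (Z : T' -> R) by move=> _ B mB; rewrite setTI; exact: ZG.
    have mW' : measurable_fun setT (W : T' -> R) by move=> _ B mB; rewrite setTI; exact: WG.
    have := measurable_funB mZ' mW' measurableT mA.
    by rewrite setTI.
  have mE := Km _ EG.
  rewrite RintegralB//; first by rewrite Zavg// subrr.
  - exact: integrableS iU.
  - exact: integrableS iZ.
have -> : \int[P]_w ((U w - W w) ^+ 2) = \int[P]_w ((U w - Z w) ^+ 2) +
    \int[P]_w ((Z w - W w) ^+ 2).
  case: (D2) => _ iDD; case: (X2) => _ iXX.
  transitivity (\int[P]_w ((U w - Z w) ^+ 2 +
      ((Z w - W w) ^+ 2 + 2 * ((U w - Z w) * (Z w - W w))))).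
    by apply: eq_Rintegral => w _; ring.
  rewrite RintegralD//; last by apply: integrable_realD => //; exact: integrable_realZ.
  rewrite RintegralD//; last exact: integrable_realZ.
  by rewrite RintegralZl// orth mulr0 addr0.
rewrite -[leLHS]addr0 lerD ?Rintegral_sqr_ge0//.
rewrite -(Vavg _ setTK).
have -> : c = \int[P]_w c by rewrite Rintegral_cst// [X in fine X]probability_setT mulr1.
have mV : measurable_fun setT V by case/integrableP : iV => /measurable_EFinP.
have mM : measurable_fun setT (fun w => Num.max (V w) c) by exact: measurable_maxr.
have VM : \int[P]_w V w = \int[P]_w Num.max (V w) c.
  congr fine; apply: ae_eq_integral => //; try exact/measurable_EFinP.
  by apply: filterS cV => w cVw _; rewrite max_l.
rewrite VM; apply: Rintegral_le.
- exact: finite_measure_integrable_cst.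
- apply: (integrable_le mM (integrable_realD (integrable_norm iV) _) (g := fun w => `|V w| + `|c|)).
    exact: finite_measure_integrable_cst.
  by move=> w; rewrite /Num.max; case: ifP => _; rewrite ?lerDl ?lerDr.
- by move=> w; rewrite le_max lexx orbT.
Qed.

End square_integrable.

(** * Covariance of a process *)

Section covariance.
Context disp (Omega : measurableType disp) (R : realType).
Variables (P : probability Omega R).
Local Notation RT := (g_sigma_algebraType R.-ocitv.-measurable).

Lemma ge0_integral_same_law (U U' : Omega -> R) (f : RT -> \bar R) :
  measurable_fun setT U -> measurable_fun setT U' ->
  (forall A, measurable A -> P (U @^-1` A) = P (U' @^-1` A)) ->
  measurable_fun setT f -> (forall x, (0 <= f x)%E) ->
  (\int[P]_w f (U w) = \int[P]_w f (U' w))%E.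
Proof.
move=> mU mU' law mf f0.
rewrite -(@ge0_integral_pushforward _ _ _ _ R (U : Omega -> RT) mU P setT f)//.
rewrite -(@ge0_integral_pushforward _ _ _ _ R (U' : Omega -> RT) mU' P setT f)//.
by apply: eq_measure_integral => A mA _; exact: law.
Qed.

Section one_process.
Variable Y : R -> Omega -> R.
Hypothesis gY : centered_gaussian_process P Y.

Definition cov (s t : R) : R := \int[P]_w (Y s w * Y t w).

Lemma covC s t : cov s t = cov t s.
Proof. by apply: eq_Rintegral => w _; rewrite mulrC. Qed.

Lemma centered_gaussian_comb (s t y v : R) : 0 <= s -> 0 <= t ->
  centered_gaussian P (fun w => y * Y t w - v * Y s w).
Proof.
move=> s0 t0.
have h (i : 'I_2) : 0 <= (if i == ord0 then t else s) by case: ifP.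
have := gY; move=> /(_ 2 (fun i => if i == ord0 then t else s)
  (fun i => if i == ord0 then y else - v) h); congr centered_gaussian; apply/funext => w.
by rewrite !big_ord_recl big_ord0 /= addr0 mulNr.
Qed.

Lemma square_integrable_process (t : R) : 0 <= t -> square_integrable P (Y t).
Proof.
move=> t0; have := centered_gaussian_comb 1 0 t0 t0.
rewrite (_ : (fun w => _) = Y t); last by apply/funext => w; rewrite mul1r mul0r subr0.
by move=> g; have [i _] := centered_gaussian_characteristic g; case: g.
Qed.

Lemma variance_comb (s t y v : R) : 0 <= s -> 0 <= t ->
  \int[P]_w ((y * Y t w - v * Y s w) ^+ 2) =
  y ^+ 2 * cov t t - 2 * y * v * cov t s + v ^+ 2 * cov s s.
Proof.
move=> s0 t0; rewrite Rintegral_sqr_comb//; try exact: square_integrable_process.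
Qed.

Lemma variance_comb_ge0 (s t y v : R) : 0 <= s -> 0 <= t ->
  0 <= y ^+ 2 * cov t t - 2 * y * v * cov t s + v ^+ 2 * cov s s.
Proof. by move=> s0 t0; rewrite -variance_comb// Rintegral_sqr_ge0. Qed.

(** The conditional variance of [Y t] given [Y s] is at most the squared
    distance from [Y t] to [lam * Y s]. *)
Lemma cov_slnd (H : R) : strong_local_nondeterminism P H Y ->
  exists2 kappa : R, 0 < kappa & forall s t lam : R, 0 < s -> 0 < t ->
    kappa * Num.min (`|t - s| `^ (2 * H)) (t `^ (2 * H)) <=
    cov t t - 2 * lam * cov t s + lam ^+ 2 * cov s s.
Proof.
move=> [kappa k0 slnd]; exists kappa => // s t lam s0 t0.
have [V] := slnd 0%N (fun=> s) t (fun=> s0) t0.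
rewrite big_ord_recl big_ord0 /g_sigma_preimage.
set K := \big[setU/set0]_(i < 1) _ => cV Vae.
have [mYs _] := square_integrable_process (ltW s0).
have KE : K = preimage_set_system setT (Y s) measurable by rewrite /K big_ord_recl big_ord0 setU0.
have Km A : <<s K >> A -> measurable A.
  apply: smallest_sub; first exact: sigma_algebra_measurable.
  by rewrite KE => _ [B mB <-]; exact: mYs.
have := cond_var_le_dist Km cV Vae (square_integrable_process (ltW t0))
  (square_integrableZ lam (square_integrable_process (ltW s0))).
have -> : \int[P]_w ((Y t w - lam * Y s w) ^+ 2) =
    cov t t - 2 * lam * cov t s + lam ^+ 2 * cov s s.
  transitivity (\int[P]_w ((1 * Y t w - lam * Y s w) ^+ 2)).
    by apply: eq_Rintegral => w _; rewrite mul1r.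
  by rewrite variance_comb ?ltW// expr1n mul1r mulr1.
apply => A mA; apply: sub_sigma_algebra; rewrite KE.
exists ((fun z => lam * z) @^-1` A); last by rewrite setTI.
rewrite -[X in measurable X]setTI.
suff : measurable_fun setT (fun z : R => lam * z) by exact.
exact: measurable_funM.
Qed.

Lemma cov_increment (H : R) : increment_upper_bound P H Y ->
  exists2 K : R, 0 < K & forall s t : R, 0 <= s -> 0 <= t ->
    cov t t - 2 * cov t s + cov s s <= K * `|t - s| `^ (2 * H).
Proof.
move=> [K K0 h]; exists K => // s t s0 t0.
have := h s t s0 t0; rewrite unlock.
have := variance_comb 1 1 s0 t0; rewrite expr1n !mulr1 !mul1r => <-.
have i := square_integrableD (square_integrable_process t0)
  (square_integrableZ (-1) (square_integrable_process s0)).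
rewrite -lee_fin /Rintegral fineK.
  move=> hh; apply: le_trans hh; rewrite le_eqVlt; apply/orP; left; apply/eqP.
  by apply: eq_integral => w _; rewrite !mul1r.
apply: integrable_fin_num => //; case: i => _.
by apply: eq_integrable => // w _ /=; rewrite !mul1r mulN1r.
Qed.

Lemma cov_decorrelation : increment_decorrelation P Y ->
  forall eta : R, 0 < eta -> exists2 g : R, 1 < g &
    forall s t : R, 0 < s -> s < t -> (t - s) / s <= 1 / g ->
    `|cov t s - cov s s| <=
    eta * Num.sqrt (cov t t - 2 * cov t s + cov s s) * Num.sqrt (cov s s).
Proof.
move=> [beta [b0 bnd blim h]] eta eta0.
have [g g1 bg] : exists2 g : R, 1 < g & beta g <= eta.
  have : \forall g \near +oo, 1 < g /\ beta g <= eta.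
    near=> g; split; near: g; first exact: nbhs_pinfty_gt.
    by apply: cvgr_le blim _ eta0.
  by move=> /pinfty_ex_gt0 [g g0 [g1 bg]]; exists g.
exists g => // s t s0 st tsg.
have t0 := lt_trans s0 st.
have Ys := square_integrable_process (ltW s0).
have Yt := square_integrable_process (ltW t0).
have := h s t g s0 st g1 tsg; rewrite unlock.
have D2 := square_integrableD Yt (square_integrableZ (-1) Ys).
have EE (f : Omega -> R) (c : R) : P.-integrable setT (EFin \o f) ->
    \int[P]_w f w = c -> (\int[P]_w (f w)%:E = c%:E)%E.
  by move=> fi <-; rewrite /Rintegral fineK//; exact: integrable_fin_num.
rewrite (EE _ (cov t s - cov s s)); first last.
- rewrite /cov -RintegralB//; try exact: square_integrableM.
  by apply: eq_Rintegral => w _; ring.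
- have := square_integrableM D2 Ys.
  by apply: eq_integrable => // w _ /=; congr EFin; ring.
rewrite (EE _ (cov t t - 2 * cov t s + cov s s)); first last.
- have := variance_comb 1 1 (ltW s0) (ltW t0); rewrite expr1n !mulr1 !mul1r => <-.
  by apply: eq_Rintegral => w _; rewrite !mul1r.
- by case: D2 => _; apply: eq_integrable => // w _ /=; rewrite mulN1r.
rewrite (EE _ (cov s s)); first last.
- by apply: eq_Rintegral => w _; rewrite expr2.
- by case: Ys.
rewrite !poweR_EFin -!EFinM lee_fin div1r !powR12_sqrt; first last.
- have := variance_comb_ge0 1 1 (ltW s0) (ltW t0).
  by rewrite expr1n !mulr1 !mul1r.
- by have := variance_comb_ge0 0 1 (ltW s0) (ltW t0);
    rewrite expr0n/= expr1n mulr0 !mul0r mul1r subrr add0r.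
move=> /le_trans; apply.
by rewrite ler_wpM2r ?sqrtr_ge0// ler_wpM2r ?sqrtr_ge0.
Unshelve. all: by end_near. Qed.

End one_process.
End covariance.

(** * Joint characteristic function of two times *)

Section joint_characteristic_function.
Context disp (Omega : measurableType disp) (R : realType).
Variables (P : probability Omega R) (d : nat) (hd : (0 < d)%N).
Variable X : R -> Omega -> 'rV[R]_d.
Hypothesis gX : forall l, centered_gaussian_process P (component X l).
Hypothesis indX : independent_components P X.
Hypothesis lawX : forall l l', same_law P (component X l) (component X l').
Local Notation cov0 := (cov P (first_component hd X)).

Definition increment_form (s t y v : R) : R :=
  y ^+ 2 * cov0 t t - 2 * y * v * cov0 t s + v ^+ 2 * cov0 s s.

Lemma measurable_component l t : 0 <= t -> measurable_fun setT (component X l t).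
Proof. by move=> t0; have [] := square_integrable_process (gX l) t0. Qed.

Lemma variance_component l (s t y v : R) : 0 <= s -> 0 <= t ->
  variance0 P (fun w => y * component X l t w - v * component X l s w) =
  increment_form s t y v.
Proof.
move=> s0 t0; rewrite /increment_form -(variance_comb (gX _))// /variance0.
pose l0 := Ordinal hd.
pose U k w := y * component X k t w - v * component X k s w.
have mU k : measurable_fun setT (U k).
  by apply: measurable_funB; apply: measurable_funM => //; exact: measurable_component.
congr fine; apply: (@ge0_integral_same_law _ _ _ P (U l) (U l0)
    (fun x => (x ^+ 2)%:E)) => //; first last.
- by move=> x; rewrite lee_fin sqr_ge0.
- by apply/measurable_EFinP; exact: exprn_measurable.
move=> A mA.
pose tt (i : 'I_2) := if i == ord0 then t else s.
have tt0 i : 0 <= tt i by rewrite /tt; case: ifP.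
pose B : set (2.-tuple R) := (fun p => y * tnth p ord0 - v * tnth p (lift ord0 ord0)) @^-1` A.
have mB : measurable B.
  rewrite -[X in measurable X]setTI.
  suff : measurable_fun setT (fun p : 2.-tuple R => y * tnth p ord0 - v * tnth p (lift ord0 ord0)).
    by exact.
  by apply: measurable_funB; apply: measurable_funM => //; exact: measurable_tnth.
have := lawX l l0 tt0 mB; rewrite /B /=.
congr (P _ = P _); apply/seteqP; split => w /=; by rewrite /U !tnth_mktuple.
Qed.

Lemma process_sigma_algebra_measurable l A :
  process_sigma_algebra (component X l) A -> measurable A.
Proof.
apply: smallest_sub; first exact: sigma_algebra_measurable.
move=> _ [t /= t0 [B mB <-]]; exact: measurable_component.
Qed.

Lemma process_sigma_algebra_comb l (s t y v : R) (phi : R -> R) : 0 <= s -> 0 <= t ->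
  measurable_fun setT phi -> forall A, measurable A ->
  process_sigma_algebra (component X l)
    ((fun w => phi (y * component X l t w - v * component X l s w)) @^-1` A).
Proof.
move=> s0 t0 mphi A mA; rewrite /process_sigma_algebra.
set K := \bigcup_(_ in _) _.
pose T' := g_sigma_algebraType K.
have mY r : 0 <= r -> measurable_fun setT (component X l r : T' -> R).
  move=> r0 _ B mB; apply: sub_sigma_algebra; exists r => //.
  by exists B.
have mF : measurable_fun setT (fun w : T' => phi (y * component X l t w - v * component X l s w)).
  apply: measurableT_comp => //.
  by apply: measurable_funB; apply: measurable_funM => //; exact: mY.
by have := mF measurableT A mA; rewrite setTI.
Qed.

(** Independence and equality in law reduce the joint characteristic function
    to that of one component. *)
Lemma joint_characteristic (y v : 'I_d -> R) (s t : R) : 0 <= s -> 0 <= t ->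
  cintegral P setT (fun w => \prod_(l < d) expi (y l * X t w 0 l - v l * X s w 0 l)) =
  \prod_(l < d) (expR (- (increment_form s t (y l) (v l) / 2)))%:C.
Proof.
move=> s0 t0.
rewrite (@cintegral_prod_independent _ _ _ P d (fun l => process_sigma_algebra (component X l))
  (fun l w => expi (y l * component X l t w - v l * component X l s w))).
- apply: eq_bigr => l _.
  have [_ ->] := centered_gaussian_characteristic (centered_gaussian_comb (gX l) (y l) (v l) s0 t0).
  by rewrite variance_component.
- exact: process_sigma_algebra_measurable.
- move=> l; exact: (@measurableT _ (g_sigma_algebraType _)).
- exact: indX.
- move=> l A mA; apply: (@process_sigma_algebra_comb l s t (y l) (v l) (@cos R)) => //.
  by apply: continuous_measurable_fun; exact: continuous_cos.
- move=> l A mA; apply: (@process_sigma_algebra_comb l s t (y l) (v l) (@sin R)) => //.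
  by apply: continuous_measurable_fun; exact: continuous_sin.
- by move=> l w; rewrite normc_expi.
Qed.

End joint_characteristic_function.

(** * Symbols of fractional derivatives *)

Section fourier_multiplier.
Context (R : realType).
Local Notation leb := (@lebesgue_measure R).
Local Notation RT := (g_sigma_algebraType R.-ocitv.-measurable).

(** The symbol of the fractional derivative of order [a]. *)
Definition symbol (minus : bool) (a y : R) : R[i] :=
  (`|y| `^ a)%:C * expi ((-1) ^+ minus * (pi * a / 2 * Num.sg y)).

Lemma normc_symbol minus a y : normc (symbol minus a y) = `|y| `^ a.
Proof. by rewrite normcM normc_expi mulr1 normc_real ger0_norm ?powR_ge0. Qed.

Lemma measurable_sgr : measurable_fun setT (@Num.sg R).
Proof.
rewrite (_ : Num.sg = fun x : R => if x == 0 then 0 else if x < 0 then -1 else 1); last first.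
  by apply/funext => x; case: sgrP.
apply: measurable_fun_ifT => //; first exact: measurable_fun_eqr.
by apply: measurable_fun_ifT => //; exact: measurable_fun_ltr.
Qed.

Lemma measurable_powR_norm a : measurable_fun setT (fun y : R => `|y| `^ a).
Proof. by apply: (measurableT_comp (measurable_powR a)). Qed.

Lemma cmeasurable_symbol minus a : cmeasurable (symbol minus a).
Proof.
apply: cmeasurableM.
- by apply: cmeasurable_real; exact: measurable_powR_norm.
- apply: cmeasurable_expi; apply: measurable_funM => //; apply: measurable_funM => //.
  exact: measurable_sgr.
Qed.

Lemma powR_le_exp (z a : R) (m : nat) : 0 <= a -> a <= (2 * m)%:R -> 0 <= z ->
  z `^ a <= 1 + z ^+ (2 * m).
Proof.
move=> a0 am z0; have [z1|z1] := leP z 1.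
  rewrite (le_trans (_ : _ <= 1)) ?lerDl ?exprn_ge0//.
  have -> : 1 = 1 `^ a :> R by rewrite powR1.
  by apply: ge0_ler_powR => //; rewrite nnegrE.
rewrite (le_trans (_ : _ <= z ^+ (2 * m))) ?lerDr//.
by rewrite -powR_mulrn// ler_powR// ltW.
Qed.

Lemma powR_gauss_bound (a : R) : 0 <= a -> exists (m : nat) (C : R), 0 < C /\
  forall eps y : R, 0 < eps -> eps <= 1 ->
  `|y| `^ a * gauss eps 0 y <= C * eps ^- m * gauss (eps / 2) 0 y.
Proof.
move=> a0; pose m := (Num.truncn a).+1.
have am : a <= (2 * m)%:R.
  rewrite (le_trans (ltW (truncnS_gt a)))// ler_nat -/m mul2n -addnn leq_addr//.
exists m, (1 + m`!%:R * 4 ^+ m); split.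
  by rewrite ltr_pwDl// mulr_ge0// ?ler0n// exprn_ge0.
move=> eps y e0 e1.
have h := pow_gauss_le 0 y m e0.
have h0 : gauss eps 0 y <= gauss (eps / 2) 0 y.
  have := pow_gauss_le 0 y 0 e0.
  by rewrite muln0 !expr0 fact0 !mul1r.
rewrite (le_trans (ler_wpM2r (gauss_ge0 _ _ _) (powR_le_exp a0 am (normr_ge0 y))))//.
rewrite mulrDl mul1r exprM real_normK ?num_real// -exprM.
rewrite [leRHS](_ : _ = eps ^- m * gauss (eps / 2) 0 y +
  m`!%:R * (4 / eps) ^+ m * gauss (eps / 2) 0 y); last by rewrite exprMn exprVn; ring.
rewrite lerD//; last by rewrite subr0 in h.
rewrite (le_trans h0)// ler_peMl ?gauss_ge0// -exprVn exprn_ege1//.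
by rewrite invf_ge1.
Qed.

End fourier_multiplier.

(** * Correlation with plane waves *)

Lemma bool_mulC (R : realType) (b : bool) (z : R[i]) :
  (b%:R : R)%:C * z = if b then z else 0.
Proof.
by case: b; [rewrite (_ : (true%:R : R)%:C = 1)// mul1r|rewrite (_ : (false%:R : R)%:C = 0)// mul0r].
Qed.

Lemma bool_mulC_ind (R : realType) (A : set R) (t : R) (z : R[i]) :
  (\1_A t : R)%:C * z = if t \in A then z else 0.
Proof. by rewrite indicE bool_mulC. Qed.

Section bounded_section.
Context d1 d2 (T1 : measurableType d1) (T2 : measurableType d2) (R : realType).
Variable m2 : {sigma_finite_measure set T2 -> \bar R}.

(** Fubini's theorem gives this for every measure on the parameter space, and
    a Dirac mass is one. *)
Lemma cmeasurable_cintegral_bounded (f : T1 * T2 -> R[i]) (g : T2 -> R) :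
  cmeasurable f -> m2.-integrable setT (EFin \o g) ->
  (forall x y, normc (f (x, y)) <= g y) ->
  cmeasurable (fun x => cintegral m2 setT (fun y => f (x, y))).
Proof.
move=> mf ig fg.
pose m1 : {sigma_finite_measure set T1 -> \bar R} := \d_(point : T1).
have i1 : m1.-integrable setT (EFin \o (fun=> 1 : R)) by exact: finite_measure_integrable_cst.
apply: (cmeasurable_cintegral_section i1 ig mf) => x y.
by rewrite mul1r.
Qed.

End bounded_section.

Section pairing.
Context disp (Omega : measurableType disp) (R : realType).
Variables (P : probability Omega R) (d : nat) (hd : (0 < d)%N).
Variable X : R -> Omega -> 'rV[R]_d.
Hypothesis jmX : forall l, jointly_measurable (component X l).
Hypothesis gX : forall l, centered_gaussian_process P (component X l).
Hypothesis indX : independent_components P X.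
Hypothesis lawX : forall l l', same_law P (component X l) (component X l').
Variables (minus : bool) (alpha : 'I_d -> R) (x : 'rV[R]_d) (T : R).
Hypothesis alpha_ge0 : forall l, 0 <= alpha l.
Local Notation leb := (@lebesgue_measure R).
Local Notation lebd := (lebesgue_tuple R d).
Local Notation RT := (g_sigma_algebraType R.-ocitv.-measurable).
Local Notation cov0 := (cov P (first_component hd X)).

Definition wave (v : 'I_d -> R) (s : R) (w : Omega) : R[i] :=
  \prod_(l < d) expi (v l * (X s w 0 l + x 0 l)).

(** The contribution of one component to the correlation of the regularised
    derivative at time [t] with a plane wave at time [s], for a process with
    [A], [c] and [B] the covariances of the pairs (t, t), (t, s) and (s, s). *)
Definition kernel1 (eps a x1 A c B v : R) : R[i] :=
  ((2 * pi)^-1)%:C * cintegral leb setT (fun y =>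
    symbol minus a y * (gauss eps 0 y)%:C * expi ((y - v) * x1) *
    (expR (- ((y ^+ 2 * A - 2 * y * v * c + v ^+ 2 * B) / 2)))%:C).

Variable eps : R.
Hypothesis eps_gt0 : 0 < eps.
Hypothesis eps_le1 : eps <= 1.

Definition symbol_weight (a y : R) : R := `|y| `^ a * gauss eps 0 y.

Lemma symbol_weight_ge0 a y : 0 <= symbol_weight a y.
Proof. by rewrite mulr_ge0 ?powR_ge0 ?gauss_ge0. Qed.

Lemma integrable_symbol_weight a : 0 <= a -> leb.-integrable setT (EFin \o symbol_weight a).
Proof.
move=> a0; have [m [C [C0 h]]] := powR_gauss_bound a0.
apply: (@integrable_le _ _ _ leb _ (fun y => C * eps ^- m * gauss (eps / 2) 0 y)).
- suff : measurable_fun setT (symbol_weight a) by [].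
  by apply: measurable_funM; [exact: measurable_powR_norm|exact: measurable_gauss].
- by apply: integrable_realZ; apply: integrable_gauss; rewrite divr_gt0.
- by move=> y; rewrite ger0_norm ?symbol_weight_ge0//; exact: h.
Qed.

Definition symbol_weights (y : d.-tuple R) : R := \prod_(l < d) symbol_weight (alpha l) (tnth y l).

Lemma integrable_symbol_weights : lebd.-integrable setT (EFin \o symbol_weights).
Proof. by apply: (integrable_tuple_prod (g := fun l => symbol_weight (alpha l))) => l; exact: integrable_symbol_weight. Qed.

(* Kept constant at negative times, the process is measurable on the whole line. *)
Let Xp (t : R) := X (Num.max t 0).

Lemma XpE t : 0 <= t -> Xp t = X t.
Proof. by move=> t0; rewrite /Xp max_l. Qed.

Lemma measurable_Xp l : measurable_fun setT (fun p : Omega * RT => Xp p.2 p.1 0 l).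
Proof.
have jm := jmX l.
have mh : measurable_fun setT (fun p : Omega * RT => (Num.max p.2 0, p.1) : R * Omega).
  apply/measurable_fun_pairP; split => /=; last exact: measurable_fst.
  by apply: measurable_maxr => //; exact: measurable_snd.
have mD : measurable ([set t : R | 0 <= t] `*` [set: Omega]).
  apply: measurableX => //.
  rewrite (_ : [set t : R | 0 <= t] = `[0, +oo[%classic); first exact: measurable_itv.
  by apply/seteqP; split => z /=; rewrite in_itv/= andbT.
have := @measurable_comp _ _ _ _ _ _ _ _ _ _ mD _ jm mh.
apply.
by move=> _ [p _ <-]; split => //=; rewrite le_max lexx orbT.
Qed.

Definition integrand (q : (Omega * RT) * d.-tuple R) : R[i] :=
  \prod_(l < d) (symbol minus (alpha l) (tnth q.2 l) * (gauss eps 0 (tnth q.2 l))%:C *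
    expi (tnth q.2 l * (Xp q.1.2 q.1.1 0 l + x 0 l))).

Lemma normc_integrand q : normc (integrand q) = symbol_weights q.2.
Proof.
rewrite normc_prod; apply: eq_bigr => l _.
by rewrite normcM normc_expi mulr1 normcM normc_symbol normc_real (ger0_norm (gauss_ge0 _ _ _)).
Qed.

Lemma cmeasurable_integrand : cmeasurable integrand.
Proof.
apply: cmeasurable_prod => l.
have mt : measurable_fun setT (fun q : (Omega * RT) * d.-tuple R => tnth q.2 l).
  exact: (measurableT_comp (measurable_tnth l) measurable_snd).
apply: cmeasurableM; first apply: cmeasurableM.
- exact: (cmeasurable_comp mt (cmeasurable_symbol minus (alpha l))).
- by apply: cmeasurable_real; exact: (measurableT_comp (measurable_gauss eps 0) mt).
- apply: cmeasurable_expi; apply: measurable_funM => //; apply: measurable_funD => //.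
  exact: (measurableT_comp (measurable_Xp l) measurable_fst).
Qed.

Lemma heat_derivativeE t w : 0 <= t ->
  heat_derivative minus alpha eps (X t w + x) =
  ((2 * pi) ^- d)%:C * cintegral lebd setT (fun y => integrand ((w, t), y)).
Proof.
move=> t0; rewrite /heat_derivative; congr (_ * _); apply: eq_cintegral => y.
rewrite /integrand/= XpE// !big_split/= mulrAC; congr (_ * _ * _).
- rewrite expi_sum; apply: eq_bigr => l _.
  by rewrite !mxE.
- transitivity ((\prod_(l < d) gauss eps 0 (tnth y l))%:C); last by rewrite rmorph_prod.
  congr (_%:C); rewrite -expR_sum; congr expR.
  by rewrite mulr_sumr -sumrN; apply: eq_bigr => l _; rewrite subr0.
Qed.

Lemma normc_inner_le w t :
  normc (cintegral lebd setT (fun y => integrand ((w, t), y))) <= 2 * \int[lebd]_y symbol_weights y.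
Proof.
apply: normc_cintegral_le; last by move=> y; rewrite normc_integrand.
- apply: (cmeasurable_comp _ cmeasurable_integrand).
  exact: pair1_measurable.
- exact: integrable_symbol_weights.
Qed.

Lemma cmeasurable_inner :
  cmeasurable (fun p : Omega * RT => cintegral lebd setT (fun y => integrand (p, y))).
Proof.
apply: (cmeasurable_cintegral_bounded cmeasurable_integrand integrable_symbol_weights).
by move=> p y; rewrite normc_integrand.
Qed.

Definition time_integrand (p : Omega * RT) : R[i] :=
  (\1_(`[0, T]%classic : set R) p.2)%:C *
  (((2 * pi) ^- d)%:C * cintegral lebd setT (fun y => integrand (p, y))).

Lemma local_time_derivativeE w :
  local_time_derivative X minus alpha eps T x w =
  cintegral leb setT (fun t => time_integrand (w, t)).
Proof.
have H t : time_integrand (w, t) =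
    if t \in (`[0, T]%classic : set R) then heat_derivative minus alpha eps (X t w + x) else 0.
  rewrite /time_integrand [(w, t).2]/= indicE bool_mulC; case: ifPn => // tT.
  rewrite heat_derivativeE//.
  by move: tT; rewrite inE/= in_itv/= => /andP[].
rewrite /local_time_derivative /cintegral.
by congr Complex; rewrite Rintegral_mkcond; apply: eq_Rintegral => t _; rewrite patchE H; case: ifP.
Qed.

Definition time_bound : R := (2 * pi) ^- d * (2 * \int[lebd]_y symbol_weights y).

Let time_ind (t : RT) : R := \1_(`[0, T]%classic : set R) t.

Lemma normc_time_integrand w t :
  normc (time_integrand (w, t)) <= time_bound * time_ind t.
Proof.
rewrite /time_integrand [(w, t).2]/= bool_mulC_ind /time_ind indicE.
case: ifPn => _; last by rewrite Normc.normc0 mulr0.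
rewrite mulr1 normcM normc_real ger0_norm ?invr_ge0 ?exprn_ge0 ?mulr_ge0 ?pi_ge0//.
rewrite ler_wpM2l ?invr_ge0 ?exprn_ge0 ?mulr_ge0 ?pi_ge0//.
exact: normc_inner_le.
Qed.

Lemma cmeasurable_time_integrand : cmeasurable time_integrand.
Proof.
apply: cmeasurableM.
- apply: cmeasurable_real.
  have mI : measurable_fun setT (\1_(`[0, T]%classic : set R) : R -> R) by exact: measurable_indic.
  exact: (measurableT_comp mI measurable_snd).
- by apply: cmeasurableM; [exact: cmeasurable_cst|exact: cmeasurable_inner].
Qed.

Lemma integrable_time_ind (C : R) : leb.-integrable setT (EFin \o (fun t => C * time_ind t)).
Proof.
apply: integrable_realZ.
have := integrable_indic_itv 0 T true false; apply: eq_integrable => //.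
Qed.

Lemma cmeasurable_local_time_derivative :
  cmeasurable (local_time_derivative X minus alpha eps T x).
Proof.
rewrite (_ : local_time_derivative _ _ _ _ _ _ =
    fun w => cintegral leb setT (fun t => time_integrand (w, t))); last first.
  by apply/funext => w; exact: local_time_derivativeE.
apply: (cmeasurable_cintegral_bounded cmeasurable_time_integrand (integrable_time_ind time_bound)).
exact: normc_time_integrand.
Qed.

Lemma local_time_derivative_bounded : exists C : R, forall w,
  normc (local_time_derivative X minus alpha eps T x w) <= C.
Proof.
exists (2 * \int[leb]_t (time_bound * time_ind t)) => w.
rewrite local_time_derivativeE; apply: normc_cintegral_le.
- apply: (cmeasurable_comp _ cmeasurable_time_integrand).
  exact: pair1_measurable.
- exact: integrable_time_ind.
- exact: normc_time_integrand.
Qed.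

Lemma normc_wave v s w : normc (wave v s w) = 1.
Proof. by rewrite normc_prod big1// => l _; rewrite normc_expi. Qed.

Lemma cmeasurable_wave v s : 0 <= s -> cmeasurable (wave v s).
Proof.
move=> s0; apply: cmeasurable_prod => l; apply: cmeasurable_expi.
apply: measurable_funM => //; apply: measurable_funD => //.
exact: (measurable_component gX l s0).
Qed.

Lemma integrand_wave v s w t y : 0 <= t ->
  integrand ((w, t), y) * conjc (wave v s w) =
  (\prod_(l < d) (symbol minus (alpha l) (tnth y l) * (gauss eps 0 (tnth y l))%:C *
     expi ((tnth y l - v l) * x 0 l))) *
  \prod_(l < d) expi (tnth y l * X t w 0 l - v l * X s w 0 l).
Proof.
move=> t0.
have -> : conjc (wave v s w) = \prod_(l < d) expi (- (v l * (X s w 0 l + x 0 l))).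
  rewrite /wave rmorph_prod; apply: eq_bigr => l _; exact: conj_expi.
rewrite /integrand -!big_split; apply: eq_bigr => l _.
rewrite [(w, t, y).1.2]/= [(w, t, y).1.1]/= XpE// -[LHS]mulrA -[RHS]mulrA; congr (_ * _).
by rewrite -!expiD; congr expi; ring.
Qed.

(** The frequencies [y] of the heat kernel separate, and each of them meets one
    component only. *)
Lemma expectation_integrand_wave v s t : 0 <= s -> 0 <= t ->
  cintegral P setT (fun w =>
    cintegral lebd setT (fun y => integrand ((w, t), y)) * conjc (wave v s w)) =
  \prod_(l < d) cintegral leb setT (fun y =>
    symbol minus (alpha l) y * (gauss eps 0 y)%:C * expi ((y - v l) * x 0 l) *
    (expR (- ((y ^+ 2 * cov0 t t - 2 * y * v l * cov0 t s + v l ^+ 2 * cov0 s s) / 2)))%:C).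
Proof.
move=> s0 t0.
have i1 : P.-integrable setT (EFin \o (fun=> 1 : R)) by exact: finite_measure_integrable_cst.
pose f (q : Omega * d.-tuple R) : R[i] := integrand ((q.1, t), q.2) * conjc (wave v s q.1).
have mint : measurable_fun setT (fun q : Omega * d.-tuple R => ((q.1, t), q.2) : (Omega * RT) * d.-tuple R).
  apply/measurable_fun_pairP; split => /=; last exact: measurable_snd.
  apply/measurable_fun_pairP; split => /=; last exact: measurable_cst.
  exact: (@measurable_fst _ _ Omega (d.-tuple R)).
have mf : cmeasurable f.
  apply: cmeasurableM; first exact: (@cmeasurable_comp _ _ _ _ _ _ integrand mint cmeasurable_integrand).
  apply: cmeasurable_conj; exact: (cmeasurable_comp measurable_fst (cmeasurable_wave v s0)).
have fg w y : normc (f (w, y)) <= 1 * symbol_weights y.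
  by rewrite normcM normcJ normc_wave mulr1 normc_integrand mul1r.
transitivity (cintegral P setT (fun w => cintegral lebd setT (fun y => f (w, y)))).
  apply: eq_cintegral => w; rewrite mulrC -cintegralZ.
    by apply: eq_cintegral => y; rewrite mulrC.
  apply: (@cintegrable_dominated _ _ _ lebd _ symbol_weights).
  - apply: (cmeasurable_comp _ cmeasurable_integrand).
    exact: pair1_measurable.
  - exact: integrable_symbol_weights.
  - by move=> y; rewrite normc_integrand.
rewrite (cfubini i1 integrable_symbol_weights mf fg).
pose phi l (y : R) : R[i] := symbol minus (alpha l) y * (gauss eps 0 y)%:C *
    expi ((y - v l) * x 0 l) *
    (expR (- ((y ^+ 2 * cov0 t t - 2 * y * v l * cov0 t s + v l ^+ 2 * cov0 s s) / 2)))%:C.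
transitivity (cintegral lebd setT (fun y : d.-tuple R => \prod_(l < d) phi l (tnth y l))).
  apply: eq_cintegral => y; rewrite /f/=.
  under eq_cintegral do rewrite integrand_wave//.
  rewrite cintegralZ.
    by rewrite (joint_characteristic hd gX indX lawX)// -big_split.
  apply: (@cintegrable_dominated _ _ _ P _ (fun=> 1)) => //.
    apply: cmeasurable_prod => l; apply: cmeasurable_expi.
    by apply: measurable_funB; apply: measurable_funM => //; exact: (measurable_component gX l).
  by move=> w; rewrite normc_prod big1// => l _; rewrite normc_expi.
apply: (cintegral_tuple_prod (g := fun l => symbol_weight (alpha l))).
- move=> l; apply: cmeasurableM; first apply: cmeasurableM; first apply: cmeasurableM.
  + exact: cmeasurable_symbol.
  + by apply: cmeasurable_real; exact: measurable_gauss.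
  + apply: cmeasurable_expi; apply: measurable_funM => //; exact: measurable_funB.
  + apply: cmeasurable_real; apply: measurableT_comp => //; apply: measurableT_comp => //.
    apply: measurable_funM => //; apply: measurable_funD => //; apply: measurable_funB.
      by apply: measurable_funM => //.
    by do 2 apply: measurable_funM => //; exact: measurable_funM.
- by move=> l; exact: integrable_symbol_weight.
- move=> l y; rewrite normcM [normc (_ * expi _)]normcM normc_expi mulr1 normcM normc_symbol !normc_real.
  rewrite (ger0_norm (gauss_ge0 _ _ _)) (ger0_norm (expR_ge0 _)) -[leRHS]mulr1.
  rewrite ler_wpM2l ?symbol_weight_ge0// expR_le1 oppr_le0 divr_ge0//.
  exact: (variance_comb_ge0 (gX _)).
Qed.

(** Fubini's theorem moves the expectation inside the time and the frequency
    integrals, where the characteristic function of the process is explicit. *)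
Lemma pairing_formula v s : 0 <= s ->
  let kernels t := (\1_(`[0, T]%classic : set R) t)%:C *
    \prod_(l < d) kernel1 eps (alpha l) (x 0 l) (cov0 t t) (cov0 t s) (cov0 s s) (v l) in
  cintegrable leb kernels /\
  cintegral P setT (fun w => local_time_derivative X minus alpha eps T x w * conjc (wave v s w)) =
  cintegral leb setT kernels.
Proof.
move=> s0 kernels.
have i1 : P.-integrable setT (EFin \o (fun=> 1 : R)) by exact: finite_measure_integrable_cst.
pose f (p : Omega * RT) : R[i] := time_integrand p * conjc (wave v s p.1).
have mf : cmeasurable f.
  apply: cmeasurableM; first exact: cmeasurable_time_integrand.
  apply: cmeasurable_conj; exact: (cmeasurable_comp measurable_fst (cmeasurable_wave v s0)).
have fg w t : normc (f (w, t)) <= 1 * (time_bound * time_ind t).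
  by rewrite normcM normcJ normc_wave mulr1 mul1r normc_time_integrand.
have kE t : cintegral P setT (fun w => f (w, t)) = kernels t.
  rewrite /kernels bool_mulC_ind.
  have [tT|tnT] := boolP (t \in (`[0, T]%classic : set R)); last first.
    under eq_cintegral do rewrite /f /time_integrand [(_, t).2]/= bool_mulC_ind (negbTE tnT) mul0r.
    exact: cintegral0.
  have t0 : 0 <= t by move: tT; rewrite inE/= in_itv/= => /andP[].
  under eq_cintegral do rewrite /f /time_integrand [(_, t).2]/= bool_mulC_ind tT -mulrA.
  rewrite cintegralZ.
    rewrite expectation_integrand_wave// /kernel1 big_split/=; congr (_ * _).
    by rewrite prodr_const card_ord -rmorphXn exprVn.
  apply: (@cintegrable_dominated _ _ _ P _ (fun=> 2 * \int[lebd]_y symbol_weights y)).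
  - apply: cmeasurableM.
      apply: (cmeasurable_comp _ cmeasurable_inner).
      exact: pair2_measurable.
    by apply: cmeasurable_conj; exact: cmeasurable_wave.
  - exact: finite_measure_integrable_cst.
  - by move=> w; rewrite normcM normcJ normc_wave mulr1 normc_inner_le.
split.
  rewrite (_ : kernels = fun t => cintegral P setT (fun w => f (w, t))); last first.
    by apply/funext => t; rewrite kE.
  have bd t : normc (cintegral P setT (fun w => f (w, t))) <= 2 * (time_bound * time_ind t).
    have -> : time_bound * time_ind t = \int[P]_w (time_bound * time_ind t).
      by rewrite Rintegral_cst//= probability_setT mulr1.
    apply: normc_cintegral_le.
    - exact: (cmeasurable_comp (pair2_measurable _) mf).
    - exact: finite_measure_integrable_cst.
    - by move=> w; have := fg w t; rewrite mul1r.
  apply: (@cintegrable_dominated _ _ _ leb _ (fun t => 2 * (time_bound * time_ind t))) => //.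
  - pose f' (q : RT * Omega) := f (q.2, q.1).
    have mf' : cmeasurable f'.
      have ms : measurable_fun setT (fun q : RT * Omega => (q.2, q.1) : Omega * RT).
        by apply/measurable_fun_pairP; split => /=; [exact: measurable_snd|exact: measurable_fst].
      exact: (cmeasurable_comp ms mf).
    apply: (@cmeasurable_cintegral_bounded _ _ _ _ _ P f' (fun=> time_bound)) => //.
      exact: finite_measure_integrable_cst.
    move=> t w; have := fg w t; rewrite mul1r => h; apply: (le_trans h).
    have b0 : 0 <= time_bound.
      rewrite /time_bound mulr_ge0 ?invr_ge0 ?exprn_ge0 ?mulr_ge0 ?pi_ge0//.
      apply: Rintegral_ge0 => y _; apply: prodr_ge0 => l _; exact: symbol_weight_ge0.
    by rewrite ler_piMr// /time_ind indicE; case: (_ \in _).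
  - exact/integrable_realZ/integrable_time_ind.
transitivity (cintegral P setT (fun w => cintegral leb setT (fun t => f (w, t)))).
  apply: eq_cintegral => w; rewrite local_time_derivativeE mulrC -cintegralZ.
    by apply: eq_cintegral => t; rewrite mulrC.
  apply: (@cintegrable_dominated _ _ _ leb _ (fun t => time_bound * time_ind t)).
  - apply: (cmeasurable_comp _ cmeasurable_time_integrand).
    exact: pair1_measurable.
  - exact: integrable_time_ind.
  - exact: normc_time_integrand.
rewrite (cfubini i1 (integrable_time_ind time_bound) mf fg).
by apply: eq_cintegral => t; rewrite kE.
Qed.

End pairing.

(** * Asymptotics of the one-dimensional kernels *)

Section kernel_asymptotics.
Context (R : realType).
Local Notation leb := (@lebesgue_measure R).
Local Notation RT := (g_sigma_algebraType R.-ocitv.-measurable).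

Lemma powR_near1 (a eta : R) : 0 < eta -> exists2 w0 : R, 0 < w0 <= 2^-1 &
  forall w, `|w| <= w0 -> `|(1 + w) `^ a - 1| <= eta.
Proof.
move=> eta0.
have c1 : {for (1 : R), continuous (fun z : R => z `^ a)}.
  apply/differentiable_continuous/derivable1_diffP.
  by apply: derivable_powR; rewrite in_itv/= ltr01.
have /cvgrPdist_le /(_ eta eta0) := c1.
move=> /nbhs_ballP [e /= e0 be].
exists (Num.min (e / 2) 2^-1).
  by rewrite lt_min divr_gt0// invr_gt0 ltr0n/= ge_min lexx orbT.
move=> w; rewrite le_min => /andP[we _].
rewrite distrC.
have := be (1 + w); rewrite /= powR1; apply; rewrite /ball/= opprD addNKr normrN.
by rewrite (le_lt_trans we)// ltr_pdivrMr// ltr_pMr// ltr1n.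
Qed.

Definition phase (minus : bool) (a : R) : R[i] := expi ((-1) ^+ minus * (pi * a / 2)).

(** Two regularisations at the frequency scale [N]: frequencies of order [N]
    pass almost unchanged if [b] holds and are damped otherwise. *)
Definition regularisation (b : bool) (N : R) : R := if b then N ^- 3 else N^-1.

Lemma regularisation_bounds b (N : R) : 1 <= N ->
  0 < regularisation b N /\ regularisation b N <= 1 :> R.
Proof.
move=> N1; have N0 := lt_le_trans ltr01 N1.
rewrite /regularisation; case: (b); rewrite invr_gt0 ?exprn_gt0//.
  by rewrite invf_le1 ?exprn_gt0// exprn_ege1.
by rewrite invf_le1.
Qed.

Lemma symbol_pos minus a y : 0 < y -> symbol minus a y = (y `^ a)%:C * phase minus a.
Proof. by move=> y0; rewrite /symbol gtr0_sg// mulr1 gtr0_norm. Qed.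

(** Near the frequency [v] the regularised symbol is close to its unregularised
    value if [b] holds, and close to zero otherwise; elsewhere a crude polynomial
    bound is enough. *)
Lemma symbol_approx (minus : bool) (a eta : R) : 0 <= a -> 0 < eta ->
  exists (C : R) (m : nat) (N0 : R), [/\ 0 < C, (0 < m)%N, 1 <= N0 &
  forall (N v y : R) (b : bool), N0 <= N -> N <= v -> v <= 2 * N ->
  normc (symbol minus a y * (gauss (regularisation b N) 0 y)%:C -
         (b%:R * v `^ a)%:C * phase minus a)
    <= v `^ a * (eta + C * ((y - v) / v) ^+ (2 * m))].
Proof.
move=> a0 eta0.
have [w0 /andP[w00 w0h] Hw] := powR_near1 a (divr_gt0 eta0 (ltr0Sn _ 1)).
pose m := (Num.truncn a).+1.
have am : a <= (2 * m)%:R.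
  by rewrite (le_trans (ltW (truncnS_gt a)))// ler_nat -/m mul2n -addnn leq_addr.
pose C0 : R := 1 + w0^-1.
have C00 : 0 < C0 by rewrite addr_gt0// invr_gt0.
pose N0 : R := 1 + 16 / eta + 8.
exists (2 * C0 ^+ (2 * m)), m, N0; split => //.
- by rewrite mulr_gt0// exprn_gt0.
- by rewrite /N0 -addrA lerDl addr_ge0// divr_ge0// ltW.
move=> N v y b N0N Nv v2N.
have N1 : 1 <= N by rewrite (le_trans _ N0N)// /N0 -addrA lerDl addr_ge0// divr_ge0// ltW.
have N00 : 0 < N by rewrite (lt_le_trans ltr01).
have v0 : 0 < v by rewrite (lt_le_trans N00).
have va0 : 0 <= v `^ a by exact: powR_ge0.
set w := (y - v) / v.
have yE : y = v * (1 + w) by rewrite /w; field; rewrite gt_eqF.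
have Ew : 0 <= w ^+ (2 * m) by rewrite exprM exprn_ge0// sqr_ge0.
set e := regularisation b N.
have [e0 _] : 0 < e /\ e <= 1 := regularisation_bounds b N1.
have [ww0|ww0] := leP `|w| w0.
  have := ww0; rewrite ler_norml => /andP[w1 w2].
  have y0 : 0 < y by rewrite yE mulr_gt0//; lra.
  have yl : N / 2 <= y by rewrite yE; nra.
  have yu : y <= 4 * N by rewrite yE; nra.
  set p := (1 + w) `^ a; have p0 : 0 <= p by exact: powR_ge0.
  have pE : y `^ a = v `^ a * p by rewrite yE powRM//; lra.
  have p1 : `|p - 1| <= eta / 2 by exact: Hw.
  set g := gauss e 0 y; have g0 : 0 <= g by exact: gauss_ge0.
  have gE : g = expR (- (e / 2 * y ^+ 2)) by rewrite /g /gauss subr0.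
  have key : `|p * g - b%:R| <= eta.
    have [bT|bF] : b = true \/ b = false by case: (b); [left|right].
      have eE : e = N ^- 3 by rewrite /e /regularisation bT.
      rewrite bT.
      rewrite eE in gE e0.
      have g1 : g <= 1 by rewrite gE expR_le1 oppr_le0 mulr_ge0 ?sqr_ge0// divr_ge0// ltW.
      have gN : 1 - g <= 8 / N.
        have : 1 + - (N ^- 3 / 2 * y ^+ 2) <= g by rewrite gE expR_ge1Dx.
        have : N ^- 3 / 2 * y ^+ 2 <= 8 / N.
          have -> : 8 / N = N ^- 3 / 2 * (4 * N) ^+ 2 by field; rewrite gt_eqF.
          rewrite ler_wpM2l ?divr_ge0 ?invr_ge0 ?exprn_ge0 ?(ltW N00)//.
          by rewrite ler_pXn2r// ?nnegrE ?mulr_ge0 ?(ltW y0) ?(ltW N00).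
        by lra.
      have N8 : 8 / N <= eta / 2.
        rewrite ler_pdivrMr// -ler_pdivrMl ?divr_gt0//.
        rewrite (le_trans _ N0N)// /N0.
        rewrite (_ : (eta / 2)^-1 * 8 = 16 / eta); first lra.
        by field; rewrite gt_eqF.
      have -> : p * g - 1 = (p - 1) * g - (1 - g) by ring.
      rewrite (le_trans (ler_normB _ _))// normrM (ger0_norm g0) (ger0_norm (_ : 0 <= 1 - g)) ?subr_ge0//.
      have : `|p - 1| * g <= eta / 2 by rewrite -[leRHS]mulr1 ler_pM.
      by lra.
    have eE : e = N^-1 by rewrite /e /regularisation bF.
    rewrite bF.
    rewrite eE in gE e0.
    have gN : g <= 8 / N.
      rewrite gE expRN -[8 / N]invf_div lef_pV2 ?posrE ?expR_gt0 ?divr_gt0//.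
      rewrite (le_trans _ (expR_ge1Dx _))//.
      have : N / 8 <= N^-1 / 2 * y ^+ 2.
        have -> : N / 8 = N^-1 / 2 * (N / 2) ^+ 2 by field; rewrite gt_eqF.
        rewrite ler_wpM2l ?divr_ge0 ?invr_ge0 ?(ltW N00)//.
        by rewrite ler_pXn2r// ?nnegrE ?divr_ge0 ?(ltW y0) ?(ltW N00).
      by lra.
    have pe : p <= 1 + eta / 2 by move: p1; rewrite ler_norml => /andP[]; lra.
    rewrite subr0 ger0_norm ?mulr_ge0//.
    rewrite (le_trans (ler_pM p0 g0 pe gN))// mulrA ler_pdivrMr//.
    have : eta * N0 <= eta * N by rewrite ler_wpM2l// ltW.
    rewrite /N0 !mulrDr mulr1 (_ : eta * (16 / eta) = 16); first lra.
    by field; rewrite gt_eqF.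
  rewrite symbol_pos// (_ : _ - _ = phase minus a * ((y `^ a * g - b%:R * v `^ a)%:C)); last first.
    by rewrite rmorphB/= !rmorphM/=; ring.
  rewrite normcM normc_expi mul1r normc_real pE.
  rewrite (_ : _ - _ = v `^ a * (p * g - b%:R)); last by ring.
  rewrite normrM (ger0_norm va0) ler_wpM2l// (le_trans key)// lerDl.
  by rewrite mulr_ge0// mulr_ge0// exprn_ge0// ltW.
have wb : 1 <= C0 * `|w|.
  by rewrite /C0 mulrDl mul1r -[leLHS]add0r lerD// mulrC ler_pdivlMr// mul1r ltW.
rewrite (le_trans (le_normcD _ _))// normcN normcM normcM normc_symbol.
rewrite normc_expi mulr1 !normc_real (ger0_norm (gauss_ge0 _ _ _)).
have b1 : `|b%:R * v `^ a| <= v `^ a.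
  by case: (b); rewrite ?mul1r ?mul0r ?normr0// ger0_norm.
have ge1 : gauss e 0 y <= 1.
  by rewrite expR_le1 oppr_le0 mulr_ge0 ?sqr_ge0// divr_ge0// ltW.
have ya : `|y| `^ a <= v `^ a * (C0 * `|w|) ^+ (2 * m).
  rewrite yE normrM (gtr0_norm v0) powRM// ?(ltW v0)// ler_wpM2l//.
  rewrite (le_trans (_ : _ <= (C0 * `|w|) `^ a)) //.
    apply: ge0_ler_powR => //; rewrite ?nnegrE ?mulr_ge0 ?(ltW C00)//.
    rewrite (le_trans (ler_normD _ _))// normr1 /C0 mulrDl mul1r addrC lerD2l.
    by rewrite mulrC ler_pdivlMr// mul1r ltW.
  rewrite -powR_mulrn ?mulr_ge0 ?(ltW C00)//.
  by rewrite ler_powR.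
have w2 : (C0 * `|w|) ^+ (2 * m) = C0 ^+ (2 * m) * w ^+ (2 * m).
  by rewrite exprMn [`|w| ^+ _]exprM real_normK ?num_real// -exprM.
have le1 : 1 <= (C0 * `|w|) ^+ (2 * m) by exact: exprn_ege1.
rewrite (le_trans (lerD (ler_piMr (powR_ge0 _ _) ge1) b1))//.
rewrite (le_trans (lerD ya (ler_peMr va0 le1)))// w2 -mulrDr ler_wpM2l//.
set X := C0 ^+ _; set Y := w ^+ _; by have : 0 < eta by []; nra.
Qed.

End kernel_asymptotics.

Section kernel_estimates.
Context (R : realType).
Local Notation leb := (@lebesgue_measure R).
Implicit Types a A c B v : R.

(** The variance of [X_s] that is left after regression on [X_t]. *)
Definition residual (A c B : R) : R := B - c ^+ 2 / A.

(** The density at [x1] of the centred normal law of variance [A]. *)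
Definition density (A x1 : R) : R := (2 * pi)^-1 * (Num.sqrt (2 * pi / A) * expR (- (x1 ^+ 2 / (2 * A)))).

(** Completing the square in [y]. *)
Lemma form_gauss A c B v y : 0 < A ->
  expR (- ((y ^+ 2 * A - 2 * y * v * c + v ^+ 2 * B) / 2)) =
  expR (- (v ^+ 2 * residual A c B / 2)) * gauss A (v * c / A) y.
Proof.
move=> A0; rewrite /gauss -expRD; congr expR; rewrite /residual.
by field; rewrite gt_eqF.
Qed.

Lemma cmeasurable_kernel_factor minus a eps x1 v : cmeasurable (fun y : R =>
  symbol minus a y * (gauss eps 0 y)%:C * expi ((y - v) * x1)).
Proof.
apply: cmeasurableM; first apply: cmeasurableM.
- exact: cmeasurable_symbol.
- by apply: cmeasurable_real; exact: measurable_gauss.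
- by apply: cmeasurable_expi; apply: measurable_funM => //; exact: measurable_funB.
Qed.

Lemma kernel1E minus eps a x1 A c B v : 0 < eps -> eps <= 1 -> 0 <= a -> 0 < A ->
  kernel1 minus eps a x1 A c B v =
  ((2 * pi)^-1 * expR (- (v ^+ 2 * residual A c B / 2)))%:C *
  cintegral leb setT (fun y => symbol minus a y * (gauss eps 0 y)%:C *
    expi ((y - v) * x1) * (gauss A (v * c / A) y)%:C).
Proof.
move=> e0 e1 a0 A0; rewrite /kernel1 mulC_real -mulrA; congr (_ * _).
rewrite -cintegralZ.
  by apply: eq_cintegral => y; rewrite form_gauss// mulC_real; ring.
apply: (@cintegrable_dominated _ _ _ leb _ (symbol_weight eps a)).
- apply: cmeasurableM; first exact: cmeasurable_kernel_factor.
  by apply: cmeasurable_real; exact: measurable_gauss.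
- exact: integrable_symbol_weight.
- move=> y; rewrite normcM [normc (_ * expi _)]normcM normc_expi mulr1 normcM normc_symbol !normc_real.
  rewrite !(ger0_norm (gauss_ge0 _ _ _)) -[leRHS]mulr1 ler_wpM2l ?symbol_weight_ge0//.
  by rewrite expR_le1 oppr_le0 mulr_ge0 ?sqr_ge0// divr_ge0// ltW.
Qed.

(** Away from the diagonal the regularisation alone controls the kernel. *)
Lemma kernel_far a : 0 <= a -> exists (C : R) (m : nat), 0 < C /\
  forall minus eps x1 A c B v, 0 < eps -> eps <= 1 -> 0 < A ->
  normc (kernel1 minus eps a x1 A c B v) <=
    C * eps ^- m * expR (- (v ^+ 2 * residual A c B / 2)).
Proof.
move=> a0; have [m [C [C0 h]]] := powR_gauss_bound a0.
pose S : R := Num.sqrt (2 * pi / 2^-1).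
have p2 : 0 < 2 * pi :> R by rewrite mulr_gt0// pi_gt0.
exists ((2 * pi)^-1 * (2 * (C * S)) + 1), m.+1; split.
  by rewrite ltr_pwDr// mulr_ge0 ?invr_ge0 ?(ltW p2)// mulr_ge0// mulr_ge0 ?sqrtr_ge0// ltW.
move=> minus eps x1 A c B v e0 e1 A0; rewrite kernel1E// normcM normc_real.
rewrite (gtr0_norm (_ : 0 < _ * expR _)) ?mulr_gt0 ?invr_gt0 ?expR_gt0//.
rewrite mulrAC ler_wpM2r ?expR_ge0//.
have iG : leb.-integrable setT (EFin \o (fun y => C * eps ^- m * gauss (eps / 2) 0 y)).
  by apply: integrable_realZ; apply: integrable_gauss; rewrite divr_gt0.
have B1 : normc (cintegral leb setT (fun y => symbol minus a y * (gauss eps 0 y)%:C *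
    expi ((y - v) * x1) * (gauss A (v * c / A) y)%:C)) <=
    2 * \int[leb]_y (C * eps ^- m * gauss (eps / 2) 0 y).
  apply: normc_cintegral_le => //.
    apply: cmeasurableM; first exact: cmeasurable_kernel_factor.
    by apply: cmeasurable_real; exact: measurable_gauss.
  move=> y; apply: le_trans (h _ _ e0 e1).
  rewrite normcM [normc (_ * expi _)]normcM normc_expi mulr1 normcM normc_symbol !normc_real.
  rewrite !(ger0_norm (gauss_ge0 _ _ _)) -[leRHS]mulr1 ler_wpM2l ?mulr_ge0 ?powR_ge0 ?gauss_ge0//.
  by rewrite expR_le1 oppr_le0 mulr_ge0 ?sqr_ge0// divr_ge0// ltW.
rewrite (le_trans (ler_wpM2l _ B1)) ?invr_ge0 ?(ltW p2)//.
rewrite RintegralZl//; last by apply: integrable_gauss; rewrite divr_gt0.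
rewrite Rintegral_gauss ?divr_gt0//.
have SE : Num.sqrt (2 * pi / (eps / 2)) <= S * eps^-1.
  have ei : 1 <= eps^-1 by rewrite invf_ge1.
  have -> : 2 * pi / (eps / 2) = (2 * pi / 2^-1) * eps^-1 by field; rewrite gt_eqF.
  rewrite sqrtrM ?divr_ge0 ?(ltW p2)// ler_wpM2l ?sqrtr_ge0//.
  rewrite -[leRHS](ger0_norm (le_trans ler01 ei)) -sqrtr_sqr ler_wsqrtr//.
  by rewrite expr2 ler_peMl// (le_trans ler01).
move: SE; set W := Num.sqrt (2 * pi / (eps / 2)) => SE.
have em0 : 0 <= eps ^- m by rewrite invr_ge0 exprn_ge0// ltW.
have emS : eps ^- m.+1 = eps ^- m * eps^-1 by rewrite -!exprVn exprSr.
rewrite [leRHS]mulrDl mul1r -[leLHS]addr0 lerD//; last by rewrite invr_ge0 exprn_ge0// ltW.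
rewrite emS -!mulrA ler_wpM2l ?invr_ge0 ?(ltW p2)// ler_wpM2l// ler_wpM2l ?(ltW C0)//.
by rewrite [leRHS]mulrCA ler_wpM2l.
Qed.

Lemma pow_sum_le (p q : R) (m : nat) : 0 <= p -> 0 <= q ->
  (p + q) ^+ m <= 2 ^+ m * (p ^+ m + q ^+ m).
Proof.
move=> p0 q0; wlog pq : p q p0 q0 / p <= q.
  by move=> h; case: (leP p q) => [/h|/ltW/h]; [exact|rewrite addrC [q ^+ m + _]addrC; exact].
rewrite (le_trans (_ : _ <= (2 * q) ^+ m))//.
  by rewrite lerXn2r ?nnegrE ?addr_ge0 ?mulr_ge0//; lra.
by rewrite exprMn ler_wpM2l ?exprn_ge0// lerDr exprn_ge0.
Qed.

Lemma sqrt_le_mono (A0 A : R) : 0 < A0 -> A0 <= A ->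
  Num.sqrt (2 * pi / A) <= Num.sqrt (2 * pi / A0) :> R.
Proof.
move=> A00 A0A; rewrite ler_wsqrtr// ler_wpM2l ?mulr_ge0 ?pi_ge0//.
by rewrite lef_pV2// posrE// (lt_le_trans A00).
Qed.

Lemma gauss_le_rate (A0 A m y : R) : A0 <= A -> gauss A m y <= gauss A0 m y.
Proof.
by move=> AA; rewrite ler_expR lerN2 ler_wpM2r ?sqr_ge0// ler_wpM2r.
Qed.

(** Near the diagonal the kernel is asymptotic to the value of the symbol at the
    frequency [v] times the Gaussian density, with a small relative error: the
    [y]-integral is a Gaussian one centred at [v * c / A], a frequency close
    to [v], and of bounded width. *)
Lemma kernel_near minus (a x1 A0 eta : R) : 0 <= a -> 0 < A0 -> 0 < eta ->
  exists (r0 N0 : R), [/\ 0 < r0, 1 <= N0 &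
  forall (N v A c B : R) (b : bool), N0 <= N -> N <= v -> v <= 2 * N -> A0 <= A ->
    `|c / A - 1| <= r0 ->
    exists e : R[i], normc e <= eta /\
    kernel1 minus (regularisation b N) a x1 A c B v =
    (v `^ a * expR (- (v ^+ 2 * residual A c B / 2)))%:C * phase minus a *
    ((b%:R * density A x1)%:C * expi ((v * c / A - v) * x1) + e)].
Proof.
move=> a0 A00 eta0.
pose S : R := Num.sqrt (2 * pi / (A0 / 2)).
have S0 : 0 <= S by exact: sqrtr_ge0.
pose eta1 := eta / (4 * (1 + S)).
have S4 : 0 < 4 * (1 + S) by rewrite mulr_gt0// ltr_pwDl.
have eta10 : 0 < eta1 by rewrite divr_gt0.
have [C [m [N1 [C0 m0 N11 happ]]]] := symbol_approx minus a0 eta10.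
pose L := m`!%:R * (4 / A0) ^+ m.
have L0 : 0 <= L by rewrite mulr_ge0// exprn_ge0// divr_ge0// ltW.
pose Q := C * 4 ^+ m.
have Q0 : 0 < Q by rewrite mulr_gt0// exprn_gt0.
pose r0 := Num.min 1 (eta1 / Q).
pose N0 := N1 + Q * L / eta1.
have r00 : 0 < r0 by rewrite lt_min ltr01 divr_gt0.
have N01 : 1 <= N0 by rewrite (le_trans N11)// lerDl divr_ge0 ?(ltW eta10)// mulr_ge0// ltW.
exists r0, N0; split=> // N v A c B b N0N Nv v2N A0A cA.
have N1N : N1 <= N by rewrite (le_trans _ N0N)// lerDl divr_ge0 ?(ltW eta10)// mulr_ge0// ltW.
have N1' : 1 <= N by rewrite (le_trans N11).
have N00 : 0 < N by rewrite (lt_le_trans ltr01).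
have v0 : 0 < v by rewrite (lt_le_trans N00).
have A_gt0 : 0 < A by rewrite (lt_le_trans A00).
have va0 : 0 < v `^ a by rewrite powR_gt0.
set eps := regularisation b N.
have [e0 e1] : 0 < eps /\ eps <= 1 := regularisation_bounds b N1'.
rewrite kernel1E//.
set y0 := v * c / A; set E := expR (- _).
set I := cintegral _ _ _.
pose D y := symbol minus a y * (gauss eps 0 y)%:C - (b%:R * v `^ a)%:C * phase minus a.
pose f1 y : R[i] := D y * expi ((y - v) * x1) * (gauss A y0 y)%:C.
pose f2 y : R[i] := (b%:R * v `^ a)%:C * phase minus a * (expi ((y0 - v) * x1) *
  (expi (x1 * (y - y0)) * (gauss A y0 y)%:C)).
pose kap := v `^ a * (3 * eta1).
have mD : cmeasurable D.
  apply: cmeasurableD; last exact: cmeasurable_cst.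
  apply: cmeasurableM; first exact: cmeasurable_symbol.
  by apply: cmeasurable_real; exact: measurable_gauss.
have mf1 : cmeasurable f1.
  apply: cmeasurableM; last by apply: cmeasurable_real; exact: measurable_gauss.
  apply: cmeasurableM => //; apply: cmeasurable_expi; apply: measurable_funM => //.
  exact: measurable_funB.
have i0 : leb.-integrable setT (EFin \o (fun y => kap * gauss (A0 / 2) y0 y)).
  by apply: integrable_realZ; apply: integrable_gauss; rewrite divr_gt0.
have f1le y : normc (f1 y) <= kap * gauss (A0 / 2) y0 y.
  rewrite normcM normcM normc_expi mulr1 normc_real (ger0_norm (gauss_ge0 _ _ _)).
  have := happ N v y b N1N Nv v2N; rewrite -/eps -/(D y) => Dle.
  rewrite (le_trans (ler_wpM2r (gauss_ge0 _ _ _) Dle))// /kap -[leLHS]mulrA -[leRHS]mulrA.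
  rewrite ler_wpM2l ?(ltW va0)//.
  have gA : gauss A y0 y <= gauss (A0 / 2) y0 y.
    by apply: gauss_le_rate; rewrite (le_trans _ A0A)// ler_pdivrMr// ler_peMr ?(ltW A00)// ler1n.
  have g0 := gauss_ge0 A y0 y; have g0' := gauss_ge0 (A0 / 2) y0 y.
  pose p := ((y - y0) / v) ^+ 2; pose q := (c / A - 1) ^+ 2.
  have p0 : 0 <= p by exact: sqr_ge0.
  have q0 : 0 <= q by exact: sqr_ge0.
  have wE : (y - v) / v = (y - y0) / v + (c / A - 1).
    by rewrite /y0; field; rewrite !gt_eqF.
  have wle : ((y - v) / v) ^+ (2 * m) <= 4 ^+ m * (p ^+ m + q ^+ m).
    rewrite exprM; apply: (@le_trans _ _ ((2 * (p + q)) ^+ m)).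
      rewrite lerXn2r ?nnegrE ?sqr_ge0 ?mulr_ge0 ?addr_ge0//.
      rewrite wE /p /q; set P := (y - y0) / v; set K := c / A - 1.
      by have := sqr_ge0 (P - K); nra.
    rewrite exprMn (_ : 4 = 2 * 2); last by ring.
    by rewrite exprMn -mulrA ler_wpM2l ?exprn_ge0// pow_sum_le.
  have pg : p ^+ m * gauss A y0 y <= L / N * gauss (A0 / 2) y0 y.
    have pE : p ^+ m = (y - y0) ^+ (2 * m) * v ^- (2 * m).
      by rewrite /p -exprM exprMn exprVn.
    rewrite pE mulrAC.
    have h1 : (y - y0) ^+ (2 * m) * gauss A y0 y <= L * gauss (A0 / 2) y0 y.
      rewrite (le_trans (ler_wpM2l _ (gauss_le_rate y0 y A0A)))//.
        by rewrite exprM exprn_ge0// sqr_ge0.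
      exact: pow_gauss_le.
    rewrite (le_trans (ler_wpM2r _ h1)) ?invr_ge0 ?exprn_ge0 ?(ltW v0)//.
    rewrite mulrAC ler_wpM2r// ler_wpM2l// lef_pV2 ?posrE ?exprn_gt0//.
    rewrite (le_trans Nv)// -[leLHS]expr1 ler_weXn2l ?(le_trans N1' Nv)//.
    by rewrite muln_gt0.
  have qm : q ^+ m <= r0.
    have r01 : r0 <= 1 by rewrite ge_min lexx.
    have q1 : q <= r0.
      rewrite /q -real_normK ?num_real// expr2.
      rewrite -[leRHS]mulr1 ler_pM//; exact: le_trans r01.
    rewrite (le_trans _ q1)// -[leRHS]expr1 ler_wiXn2l//.
    exact: le_trans r01.
  have Qr : Q * r0 <= eta1.
    by rewrite mulrC -ler_pdivlMr// ge_min lexx orbT.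
  have QL : Q * (L / N) <= eta1.
    rewrite mulrA ler_pdivrMr// -ler_pdivrMl// (le_trans _ N0N)// /N0 mulrC.
    by rewrite lerDr (le_trans ler01).
  have Cw : C * ((y - v) / v) ^+ (2 * m) <= Q * (p ^+ m + q ^+ m).
    by rewrite /Q -mulrA ler_wpM2l// ltW.
  have pm0 : 0 <= p ^+ m by rewrite exprn_ge0.
  have qm0 : 0 <= q ^+ m by rewrite exprn_ge0.
  have t1 : eta1 * gauss A y0 y <= eta1 * gauss (A0 / 2) y0 y by rewrite ler_wpM2l// ltW.
  have t2 : C * ((y - v) / v) ^+ (2 * m) * gauss A y0 y <= Q * (p ^+ m + q ^+ m) * gauss A y0 y.
    by rewrite ler_wpM2r.
  have t3 : Q * (p ^+ m * gauss A y0 y) <= eta1 * gauss (A0 / 2) y0 y.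
    by rewrite (le_trans (ler_wpM2l (ltW Q0) pg))// mulrA ler_wpM2r.
  have t4 : Q * q ^+ m * gauss A y0 y <= eta1 * gauss (A0 / 2) y0 y.
    apply: ler_pM => //; first by rewrite mulr_ge0// ltW.
    exact: le_trans (ler_wpM2l (ltW Q0) qm) Qr.
  move: Cw t2 t3 t4; set W := ((y - v) / v) ^+ (2 * m).
  set p' := p ^+ m; set q' := q ^+ m => Cw t2 t3 t4.
  rewrite [leLHS](_ : _ = eta1 * gauss A y0 y + C * W * gauss A y0 y); last by ring.
  rewrite [leRHS](_ : _ = eta1 * gauss (A0 / 2) y0 y + (eta1 * gauss (A0 / 2) y0 y +
    eta1 * gauss (A0 / 2) y0 y)); last by ring.
  rewrite lerD// (le_trans t2)//.
  rewrite [leLHS](_ : _ = Q * (p' * gauss A y0 y) + Q * q' * gauss A y0 y); last by ring.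
  by rewrite lerD.
have if1 : cintegrable leb f1.
  exact: (@cintegrable_dominated _ _ _ leb _ (fun y => kap * gauss (A0 / 2) y0 y)).
have ig : cintegrable leb (fun y => expi (x1 * (y - y0)) * (gauss A y0 y)%:C).
  apply: (@cintegrable_dominated _ _ _ leb _ (gauss A y0)).
  - apply: cmeasurableM; last by apply: cmeasurable_real; exact: measurable_gauss.
    by apply: cmeasurable_expi; apply: measurable_funM => //; exact: measurable_funB.
  - exact: integrable_gauss.
  - by move=> y; rewrite normcM normc_expi mul1r normc_real ger0_norm// gauss_ge0.
(* The main part of the symbol is constant and integrates explicitly. *)
have IE : I = cintegral leb setT f1 + (b%:R * v `^ a)%:C * phase minus a *
    (expi ((y0 - v) * x1) *
     (Num.sqrt (2 * pi / A) * expR (- (x1 ^+ 2 / (2 * A))))%:C).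
  rewrite -(cintegral_expi_gauss y0 x1 A_gt0).
  rewrite -!cintegralZ//; last exact: cintegrableZ.
  rewrite -cintegralD//; last by do 2 apply: cintegrableZ.
  apply: eq_cintegral => y; rewrite /f1 /D.
  have -> : expi ((y - v) * x1) = expi ((y0 - v) * x1) * expi (x1 * (y - y0)).
    by rewrite -expiD; congr expi; ring.
  by ring.
have phi1 : phase minus a * conjc (phase minus a) = 1.
  by rewrite conj_expi -expiD subrr expi0.
exists (((2 * pi : R)^-1)%:C * conjc (phase minus a) * ((v `^ a)^-1)%:C * cintegral leb setT f1).
split.
  have F1 := @normc_cintegral_le _ _ _ leb f1 (fun y => kap * gauss (A0 / 2) y0 y) mf1 i0 f1le.
  rewrite !normcM normcJ normc_expi mulr1 !normc_real.
  have p2 : 0 < 2 * pi :> R by rewrite mulr_gt0// pi_gt0.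
  rewrite (gtr0_norm (_ : 0 < (2 * pi)^-1)) ?invr_gt0// (gtr0_norm (_ : 0 < (v `^ a)^-1)) ?invr_gt0//.
  rewrite (le_trans (ler_wpM2l _ F1)) ?mulr_ge0 ?invr_ge0 ?(ltW p2) ?(ltW va0)//.
  rewrite RintegralZl//; last by apply: integrable_gauss; rewrite divr_gt0.
  rewrite Rintegral_gauss ?divr_gt0// -/S /kap.
  have p21 : (2 * pi)^-1 <= 2^-1 :> R.
    rewrite lef_pV2 ?posrE// ler_peMr//; have := pihalf_ge1 R; lra.
  move: p21; set p1 : R := (2 * pi)^-1 => p21; clearbody S.
  rewrite [leLHS](_ : _ = p1 * (6 * eta1 * S)); last by field; rewrite gt_eqF.
  have : p1 * (6 * eta1 * S) <= 2^-1 * (6 * eta1 * S).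
    rewrite ler_wpM2r// mulr_ge0//; apply: mulr_ge0 => //; exact: ltW.
  move=> /le_trans; apply; rewrite /eta1.
  rewrite [leLHS](_ : _ = (3 * S * eta) / (4 * (1 + S))); last by field; rewrite gt_eqF// ltr_pwDl.
  rewrite ler_pdivrMr// ; nra.
rewrite IE /density.
have va : (v `^ a)%:C * ((v `^ a)^-1)%:C = 1 :> R[i].
  by rewrite -mulC_real divff ?gt_eqF.
set F := cintegral leb setT f1; move: va phi1.
set V := v `^ a; set V' := V^-1; set p1 : R := (2 * pi)^-1; set G := Num.sqrt _ * _; clearbody G.
set ph := phase minus a; set ph' := conjc ph; set X := expi _ => va phi1.
rewrite !mulC_real.
transitivity (p1%:C * E%:C * ((V%:C * V'%:C) * (ph * ph') * F +
   (b%:R)%:C * V%:C * ph * (X * G%:C))).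
  by rewrite va phi1 !mul1r.
by ring.
Qed.

End kernel_estimates.

(** * Sums and products *)

Section sums_and_products.
Context (R : realType).

(** The factors are exchanged one at a time. *)
Lemma normc_prod_sub n (p q : 'I_n -> R[i]) (M dl : R) : 1 <= M ->
  (forall l, normc (p l) <= M) -> (forall l, normc (q l) <= M) ->
  (forall l, normc (p l - q l) <= dl) ->
  normc (\prod_(l < n) p l - \prod_(l < n) q l) <= n%:R * M ^+ n * dl.
Proof.
move=> M1; have M0 := le_trans ler01 M1.
elim: n p q => [|n ih] p q pM qM pq.
  by rewrite !big_ord0 subrr Normc.normc0 !mul0r.
rewrite !big_ord_recl.
set p0 := p ord0; set q0 := q ord0; set pp := \prod_(l < n) _; set qq := \prod_(l < n) _.
have dl0 : 0 <= dl by rewrite (le_trans (normc_ge0 _) (pq ord0)).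
have ppM : normc pp <= M ^+ n.
  rewrite normc_prod -[n in M ^+ n]card_ord -prodr_const ler_prod// => l _.
  by rewrite normc_ge0 pM.
have ihl : normc (pp - qq) <= n%:R * M ^+ n * dl by apply: ih.
have -> : p0 * pp - q0 * qq = (p0 - q0) * pp + q0 * (pp - qq) by ring.
rewrite (le_trans (le_normcD _ _))// !normcM.
have t1 : normc (p0 - q0) * normc pp <= dl * M ^+ n.
  by rewrite ler_pM ?normc_ge0//; exact: pq.
have t2 : normc q0 * normc (pp - qq) <= M * (n%:R * M ^+ n * dl).
  by rewrite ler_pM ?normc_ge0//; exact: qM.
have t3 : dl * M ^+ n <= M ^+ n.+1 * dl.
  by rewrite mulrC ler_wpM2r// exprS ler_peMl// exprn_ge0.
rewrite -natr1 exprS in t3 *; move: t1 t2 t3.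
set u := M ^+ n; set k : R := n%:R => t1 t2 t3.
rewrite [leRHS](_ : _ = M * (k * u * dl) + M * u * dl); last by ring.
by rewrite addrC lerD// (le_trans t1).
Qed.

Lemma atan_step (z : R) : (1 + z ^+ 2)^-1 <= 3 * (atan (z + 1) - atan z).
Proof.
have z1 : z <= z + 1 by rewrite lerDl.
have df (c : R) : c \in `]z, z + 1[ -> is_derive c (1 : R) (@atan R) (1 + c ^+ 2)^-1.
  by move=> cz; exact: is_derive1_atan.
have cf : {within `[z, z + 1], continuous (@atan R)}.
  by apply: continuous_subspaceT => c; exact: continuous_atan.
have [c c01 E] := MVT_segment z1 df cf.
have z2 : 0 < 1 + z ^+ 2 by rewrite ltr_pwDl// sqr_ge0.
have c2 : 0 < 1 + c ^+ 2 by rewrite ltr_pwDl// sqr_ge0.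
have cz : 1 + c ^+ 2 <= 3 * (1 + z ^+ 2).
  move: c01; rewrite in_itv/= => /andP[zc cz].
  have := sqr_ge0 (2 * z - c); have := sqr_ge0 z.
  have : 0 <= (c - z) * (z + 1 - c) by rewrite mulr_ge0 ?subr_ge0.
  by nra.
rewrite E (_ : z + 1 - z = 1) ?mulr1; last by ring.
by rewrite -[leLHS]mul1r ler_pdivrMr// mulrAC ler_pdivlMr// mul1r.
Qed.

(** Each term is at most three times an increment of the arctangent. *)
Lemma sum_cauchy_le (M : nat) (tau : R) : \sum_(i < M) (1 + (tau - i%:R) ^+ 2)^-1 <= 3 * pi.
Proof.
apply: (@le_trans _ _ (\sum_(i < M) (3 * (atan (i.+1%:R - tau) - atan (i%:R - tau))))).
  apply: ler_sum => i _; have := atan_step (i%:R - tau).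
  by rewrite -sqrrN opprB addrAC natr1.
rewrite -mulr_sumr ler_wpM2l// (_ : \sum_(i < M) _ = atan (M%:R - tau) - atan (0 - tau)).
  by have := atan_ltpi2 (M%:R - tau); have := atan_gtNpi2 (0 - tau); lra.
by rewrite -(big_mkord xpredT (fun i => atan (i.+1%:R - tau) - atan (i%:R - tau))) telescope_sumr.
Qed.

Lemma exp_pow_decay (c q : R) : 0 < c -> 0 < q -> exists2 C : R, 0 < C &
  forall z : R, 0 <= z -> expR (- (c * z `^ q)) <= C * (1 + z ^+ 2)^-1.
Proof.
move=> c0 q0; pose k := (Num.truncn (2 / q)).+1.
have qk : 2 <= q * k%:R.
  by rewrite mulrC -ler_pdivrMr// ltW// truncnS_gt.
have ck : 0 < c ^+ k by rewrite exprn_gt0.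
exists (2 * (1 + k`!%:R / c ^+ k)).
  by rewrite mulr_gt0// ltr_pwDl// divr_ge0 ?ler0n// ltW.
move=> z z0.
have z2 : 0 < 1 + z ^+ 2 by rewrite ltr_pwDl// sqr_ge0.
rewrite ler_pdivlMr//.
have e1 : expR (- (c * z `^ q)) <= 1.
  by rewrite expR_le1 oppr_le0 mulr_ge0 ?powR_ge0// ltW.
have e0 := expR_ge0 (- (c * z `^ q)).
have f0 : 0 <= k`!%:R / c ^+ k by rewrite divr_ge0 ?ler0n// ltW.
have [z1|z1] := leP z 1.
  have : z ^+ 2 <= 1 by rewrite exprn_ile1.
  by nra.
have zk : z ^+ 2 <= (z `^ q) ^+ k.
  rewrite -!powR_mulrn ?powR_ge0// -powRrM ler_powR//; exact: ltW.
have u0 : 0 <= c * z `^ q by rewrite mulr_ge0 ?powR_ge0// ltW.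
have := exp_ge_pow k u0; rewrite exprMn => h.
have h2 : (z `^ q) ^+ k * expR (- (c * z `^ q)) <= k`!%:R / c ^+ k.
  by rewrite expRN ler_pdivrMr ?expR_gt0// mulrAC ler_pdivlMr// mulrC.
have h3 : z ^+ 2 * expR (- (c * z `^ q)) <= k`!%:R / c ^+ k.
  by rewrite (le_trans _ h2)// ler_wpM2r.
by nra.
Qed.

(** The terms are dominated by those of the sum of [sum_cauchy_le], uniformly in
    the position [tau] of the grid. *)
Lemma grid_sum_le (c a q : R) : 0 < c -> 0 < a -> 0 < q -> exists2 C : R, 0 < C &
  forall (M : nat) (tau : R),
    \sum_(i < M) expR (- (c * (a * `|tau - i%:R|) `^ q)) <= C.
Proof.
move=> c0 a0 q0.
have ca : 0 < c * a `^ q by rewrite mulr_gt0// powR_gt0.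
have [C C0 h] := exp_pow_decay ca q0.
exists (C * (3 * pi)); first by rewrite mulr_gt0// mulr_gt0// pi_gt0.
move=> M tau.
apply: (@le_trans _ _ (\sum_(i < M) (C * (1 + (tau - i%:R) ^+ 2)^-1))).
  apply: ler_sum => i _; have := h `|tau - i%:R| (normr_ge0 _).
  by rewrite real_normK ?num_real// powRM// ?(ltW a0)// mulrA.
by rewrite -mulr_sumr ler_wpM2l ?(ltW C0)// sum_cauchy_le.
Qed.

End sums_and_products.

(** * Geometry of the covariance *)

(** What the analysis of the kernels uses of the law of one component. *)
Record regular_covariance (R : realType) (c : R -> R -> R) (H kap K : R) : Prop := {
  regular_sym : forall s t : R, c s t = c t s;
  regular_ge0 : forall s t y v : R, 0 <= s -> 0 <= t ->
    0 <= y ^+ 2 * c t t - 2 * y * v * c t s + v ^+ 2 * c s s;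
  regular_nondegenerate : forall s t lam : R, 0 < s -> 0 < t ->
    kap * Num.min (`|t - s| `^ (2 * H)) (t `^ (2 * H)) <=
      c t t - 2 * lam * c t s + lam ^+ 2 * c s s;
  regular_increment : forall s t : R, 0 <= s -> 0 <= t ->
    c t t - 2 * c t s + c s s <= K * `|t - s| `^ (2 * H) }.

Section covariance_geometry.
Context (R : realType).
Variables (c : R -> R -> R) (H kap K a : R).
Hypotheses (H0 : 0 < H) (kap0 : 0 < kap) (K0 : 0 < K) (a0 : 0 < a).
Hypothesis rc : regular_covariance c H kap K.
Let cC := regular_sym rc.
Let cpos := regular_ge0 rc.
Let clow := regular_nondegenerate rc.
Let cup := regular_increment rc.

Lemma variance_ge (t : R) : 0 < t -> kap * t `^ (2 * H) <= c t t.
Proof.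
move=> t0; have := @clow (2 * t) t 0 (mulr_gt0 (ltr0Sn R 1) t0) t0.
have -> : t - 2 * t = - t by ring.
by rewrite normrN gtr0_norm// minxx mulr0 mul0r subr0 expr0n mul0r addr0.
Qed.

Lemma variance_gt0 (t : R) : 0 < t -> 0 < c t t.
Proof. by move=> t0; rewrite (lt_le_trans _ (variance_ge t0))// mulr_gt0// powR_gt0. Qed.

Definition variance_inf := kap * (a / 2) `^ (2 * H).
Definition variance_sup := 2 * (K * a `^ (2 * H)) + 2 * c a a.

Lemma variance_inf_gt0 : 0 < variance_inf.
Proof. by rewrite mulr_gt0// powR_gt0// divr_gt0. Qed.

Lemma variance_inf_le (t : R) : a / 2 <= t -> variance_inf <= c t t.
Proof.
move=> t0; have h : 0 < a / 2 by rewrite divr_gt0.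
rewrite (le_trans _ (variance_ge (lt_le_trans h t0)))// ler_wpM2l ?(ltW kap0)//.
by rewrite ge0_ler_powR ?nnegrE ?(ltW h) ?(le_trans (ltW h) t0) ?mulr_ge0 ?(ltW H0).
Qed.

Lemma variance_le_sup (t : R) : 0 <= t -> t <= 2 * a -> c t t <= variance_sup.
Proof.
move=> t0 ta.
have h1 := cup (ltW a0) t0.
have h2 := cpos 1 2 (ltW a0) t0.
have h3 : `|t - a| `^ (2 * H) <= a `^ (2 * H).
  rewrite ge0_ler_powR ?nnegrE ?(ltW a0) ?mulr_ge0 ?(ltW H0)//.
  by rewrite ler_norml; apply/andP; split; lra.
have h4 : K * `|t - a| `^ (2 * H) <= K * a `^ (2 * H) by rewrite ler_wpM2l// ltW.
by rewrite /variance_sup; lra.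
Qed.

Lemma residualE (s t : R) (ct : c t t != 0) : residual (c t t) (c t s) (c s s) =
  c s s - 2 * (c t s / c t t) * c s t + (c t s / c t t) ^+ 2 * c t t.
Proof. by rewrite /residual (cC s t); field. Qed.

Lemma residual_ge (s t : R) : 0 < s -> 0 < t ->
  kap * Num.min (`|t - s| `^ (2 * H)) (s `^ (2 * H)) <=
    residual (c t t) (c t s) (c s s).
Proof.
move=> s0 t0; rewrite residualE ?gt_eqF ?variance_gt0// distrC.
exact: clow.
Qed.

Lemma residual_ge_near (s t : R) : 0 < s -> 0 < t -> `|t - s| <= s ->
  kap * `|t - s| `^ (2 * H) <= residual (c t t) (c t s) (c s s).
Proof.
move=> s0 t0 ts; have := residual_ge s0 t0; rewrite min_l//.
by rewrite ge0_ler_powR ?nnegrE ?(ltW s0) ?mulr_ge0 ?(ltW H0).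
Qed.

Lemma residual_increment (s t : R) (ct : c t t != 0) :
  c t t - 2 * c t s + c s s =
    residual (c t t) (c t s) (c s s) + c t t * (c t s / c t t - 1) ^+ 2.
Proof. by rewrite /residual; field. Qed.

Lemma residual_le (s t : R) : 0 < s -> 0 < t ->
  residual (c t t) (c t s) (c s s) <= K * `|t - s| `^ (2 * H).
Proof.
move=> s0 t0; have A0 := variance_gt0 t0.
apply: le_trans (cup (ltW s0) (ltW t0)); rewrite residual_increment ?gt_eqF//.
by rewrite lerDl mulr_ge0 ?sqr_ge0// ltW.
Qed.

Lemma residual_ge0 (s t : R) : 0 < s -> 0 < t -> 0 <= residual (c t t) (c t s) (c s s).
Proof.
move=> s0 t0; rewrite (le_trans _ (residual_ge s0 t0))// mulr_ge0// ?(ltW kap0)//.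
by rewrite le_min !powR_ge0.
Qed.

(** The increment variance splits into the residual variance and the variance of
    [X_t] times the squared deviation of the regression coefficient from one. *)
Lemma regression_near (s t : R) : 0 < s -> a / 2 <= t ->
  (c t s / c t t - 1) ^+ 2 <= K / variance_inf * `|t - s| `^ (2 * H).
Proof.
move=> s0 ta; have t0 : 0 < t by rewrite (lt_le_trans _ ta)// divr_gt0.
have A0 := variance_inf_le ta; have I0 := variance_inf_gt0.
have h := cup (ltW s0) (ltW t0).
rewrite residual_increment ?gt_eqF ?variance_gt0// in h.
have h2 := residual_ge0 s0 t0.
rewrite mulrAC ler_pdivlMr// mulrC.
apply: (@le_trans _ _ (c t t * (c t s / c t t - 1) ^+ 2)).
  by rewrite ler_wpM2r// sqr_ge0.
by apply: le_trans h; rewrite lerDr.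
Qed.

Definition nondegeneracy_rate :=
  (2 / variance_inf + (16 * K / variance_inf + 1) / kap)^-1.

Lemma nondegeneracy_rate_gt0 : 0 < nondegeneracy_rate.
Proof.
have I0 := variance_inf_gt0.
by rewrite invr_gt0 addr_gt0 ?divr_gt0// addr_gt0 ?divr_gt0// mulr_gt0.
Qed.

(** Completing the square splits the variance of [u X_t - v X_s] into a part
    that controls [u - v], up to the regression error, and the residual part,
    which controls [t - s]. *)
Lemma increment_variance_ge (N u v s t : R) : 0 < N -> N <= v -> v <= 2 * N ->
  a <= s -> s <= 2 * a -> a <= t -> t <= 2 * a ->
  nondegeneracy_rate * ((u - v) ^+ 2 + N ^+ 2 * `|t - s| `^ (2 * H)) <=
    u ^+ 2 * c t t - 2 * u * v * c t s + v ^+ 2 * c s s.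
Proof.
move=> N0 vN v2 as_ s2 at_ t2.
have s0 := lt_le_trans a0 as_; have t0 := lt_le_trans a0 at_.
have ta2 : a / 2 <= t by apply: le_trans at_; rewrite ler_pdivrMr// ler_peMr ?(ltW a0)// ler1n.
have A0 := variance_inf_le ta2; have I0 := variance_inf_gt0.
have ct0 := variance_gt0 t0.
have h1 := regression_near s0 ta2.
have ts : `|t - s| <= s by rewrite ler_norml; apply/andP; split; lra.
have h2 := residual_ge_near s0 t0 ts.
set D := `|t - s| `^ (2 * H) in h1 h2 *; have D0 : 0 <= D by exact: powR_ge0.
have -> : u ^+ 2 * c t t - 2 * u * v * c t s + v ^+ 2 * c s s =
    c t t * (u - v * (c t s / c t t)) ^+ 2 +
    v ^+ 2 * residual (c t t) (c t s) (c s s).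
  by rewrite /residual; field; rewrite gt_eqF.
set q := c t s / c t t in h1 *; set Res := residual _ _ _ in h2 *.
set p := (u - v * q) ^+ 2; have p0 : 0 <= p by exact: sqr_ge0.
have v0 : 0 < v := lt_le_trans N0 vN.
have vv1 : N ^+ 2 <= v ^+ 2 by rewrite lerXn2r ?nnegrE// ltW.
have vv2 : v ^+ 2 <= 4 * N ^+ 2.
  by rewrite (_ : 4 * N ^+ 2 = (2 * N) ^+ 2); [rewrite lerXn2r ?nnegrE ?mulr_ge0// ltW|ring].
have e1 : (u - v) ^+ 2 <= 2 * p + 2 * (v ^+ 2 * (q - 1) ^+ 2).
  have := sqr_ge0 ((u - v * q) - v * (q - 1)).
  rewrite /p; have -> : u - v = (u - v * q) + v * (q - 1) by ring.
  by rewrite -exprMn; set z1 := u - v * q; set z2 := v * (q - 1); nra.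
have e2 : v ^+ 2 * (q - 1) ^+ 2 <= 4 * N ^+ 2 * (K / variance_inf * D).
  by rewrite ler_pM ?sqr_ge0.
have N2 : 0 <= N ^+ 2 by exact: sqr_ge0.
have e3 : variance_inf * p <= c t t * p by rewrite ler_wpM2r.
have e4 : N ^+ 2 * (kap * D) <= v ^+ 2 * Res.
  by rewrite ler_pM// mulr_ge0// ltW.
apply: le_trans (lerD e3 e4).
rewrite /nondegeneracy_rate ler_pdivrMl; last first.
  by rewrite -invr_gt0; exact: nondegeneracy_rate_gt0.
set I := variance_inf in I0 e2 *.
have -> : (2 / I + (16 * K / I + 1) / kap) * (I * p + N ^+ 2 * (kap * D)) =
   2 * p + N ^+ 2 * D * (16 * K / I + 1) + 2 * (N ^+ 2 * (kap * D)) / I +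
   (16 * K / I + 1) / kap * (I * p).
  by field; rewrite !gt_eqF.
have f1 : 0 <= 2 * (N ^+ 2 * (kap * D)) / I.
  by rewrite divr_ge0 ?(ltW I0)// !mulr_ge0// ltW.
have f2 : 0 <= (16 * K / I + 1) / kap * (I * p).
  have g1 : 0 <= 16 * K / I + 1 by rewrite addr_ge0// divr_ge0 ?(ltW I0)// mulr_ge0// ltW.
  by apply: mulr_ge0; [exact: divr_ge0 g1 (ltW kap0)|exact: mulr_ge0 (ltW I0) p0].
have f3 : 0 <= K / I * (N ^+ 2 * D).
  by apply: mulr_ge0; [exact: divr_ge0 (ltW K0) (ltW I0)|exact: mulr_ge0 N2 D0].
move: e1 e2 f1 f2 f3.
have -> : 4 * N ^+ 2 * (K / I * D) = 4 * (K / I * (N ^+ 2 * D)) by ring.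
have -> : N ^+ 2 * D * (16 * K / I + 1) = 16 * (K / I * (N ^+ 2 * D)) + N ^+ 2 * D by ring.
by lra.
Qed.

End covariance_geometry.

(** * Local behaviour of the normalised kernels *)

Section trigonometric_bound.
Context (R : realType).

Lemma normr_sin_le (t : R) : `|sin t| <= `|t|.
Proof.
wlog t0 : t / 0 <= t => [hw|].
  have [/hw//|/ltW t0] := leP 0 t.
  by rewrite -normrN -sinN -[leRHS]normrN; apply: hw; rewrite oppr_ge0.
have df (u : R) : u \in `]0, t[ -> is_derive u (1 : R) (@sin R) (cos u).
  by move=> _; exact: is_derive_sin.
have cf : {within `[0, t], continuous (@sin R)}.
  by apply: continuous_subspaceT => u; exact: continuous_sin.
have [u _] := MVT_segment t0 df cf.
rewrite sin0 !subr0 => ->; rewrite normrM ler_piMl//.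
by rewrite ler_norml cos_geN1 cos_le1.
Qed.

Lemma normc_expi_sub1 (t : R) : normc (expi t - 1) <= 2 * `|t|.
Proof.
have h := normr_sin_le t; have hh := normr_sin_le (t / 2).
have e : cos t = 1 - 2 * sin (t / 2) ^+ 2.
  have {1}-> : t = (t / 2) *+ 2 by rewrite -mulr_natr -mulrA mulVf ?mulr1.
  by rewrite cos_mulr2n cos2sin2; ring.
apply: le_trans (normc_le_ReIm _) _; rewrite /expi/= subr0 e.
rewrite (_ : 2 * `|t| = `|t| + `|t|); last by ring.
apply: lerD => //.
have -> : `|1 - 2 * sin (t / 2) ^+ 2 - 1| = 2 * (`|sin (t / 2)| * `|sin (t / 2)|).
  rewrite addrAC subrr add0r normrN normrM expr2 normrM ger0_norm//.
have s1 : `|sin (t / 2)| <= 1 by rewrite ler_norml sin_geN1 sin_le1.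
have s0 := normr_ge0 (sin (t / 2)).
have tt : `|t / 2| = `|t| / 2 by rewrite normrM (@ger0_norm _ 2^-1).
by rewrite tt in hh; nra.
Qed.

End trigonometric_bound.

Section elementary_bounds.
Context (R : realType).

(** Half of the exponent absorbs the linear factor. *)
Lemma linear_gaussian_le (k D z : R) : 0 < k -> 0 <= D -> 0 <= z ->
  expR (- (k / 2 * z ^+ 2)) * (1 + 2 * D * z) <=
  (1 + D + D * (4 / k)) * expR (- (k / 4 * z ^+ 2)).
Proof.
move=> k0 D0 z0.
have e4 : 1 + k / 4 * z ^+ 2 <= expR (k / 4 * z ^+ 2) by exact: expR_ge1Dx.
have k4 : 0 <= k / 4 * z ^+ 2 by rewrite mulr_ge0 ?sqr_ge0// divr_ge0// ltW.
have F : 1 + 2 * D * z <= (1 + D + D * (4 / k)) * expR (k / 4 * z ^+ 2).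
  have z2 : 2 * z <= 1 + z ^+ 2 by have := sqr_ge0 (z - 1); nra.
  have a1 : 1 + 2 * D * z <= 1 + D + D * z ^+ 2 by nra.
  apply: (le_trans a1).
  have a2 : 1 <= expR (k / 4 * z ^+ 2) by lra.
  have a3 : z ^+ 2 <= 4 / k * expR (k / 4 * z ^+ 2).
    by rewrite mulrAC ler_pdivlMr//; lra.
  have a4 := ler_wpM2l D0 a3.
  have a5 := ler_wpM2l (addr_ge0 ler01 D0) a2.
  by lra.
apply: le_trans (ler_wpM2l (expR_ge0 _) F) _.
rewrite mulrCA -expRD (_ : - (k / 2 * z ^+ 2) + k / 4 * z ^+ 2 = - (k / 4 * z ^+ 2))//.
by lra.
Qed.

Lemma perturbation_le (E e1 e2 mc g k eta Q C X Y : R) : 0 <= E -> e1 <= E ->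
  E * Q <= C * e2 -> 0 <= k -> 0 <= eta -> 0 <= mc -> mc <= g ->
  - (k * (eta * Q)) <= X - g -> Y <= k * (eta * Q) ->
  mc * e1 - 2 * (k * C) * eta * e2 <= E * (X - Y).
Proof.
move=> E0 e1E EQ k0 eta0 mc0 mcg h1 h0.
have h2 : mc - 2 * (k * (eta * Q)) <= X - Y by lra.
apply: le_trans (ler_wpM2l E0 h2).
have h3 := ler_wpM2l mc0 e1E.
have h4 := ler_wpM2l (mulr_ge0 k0 eta0) EQ.
rewrite (_ : E * (mc - _) = mc * E - 2 * (k * eta * (E * Q))); last by ring.
rewrite (_ : 2 * (k * C) * eta * e2 = 2 * (k * eta * (C * e2))); last by ring.
by lra.
Qed.

End elementary_bounds.

Section finite_choice.
Context (R : realType).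

Lemma uniform_radius n (Q : 'I_n -> R -> Prop) :
  (forall l r r', 0 < r' -> r' <= r -> Q l r -> Q l r') ->
  (forall l, exists2 r : R, 0 < r & Q l r) ->
  exists2 r : R, 0 < r & forall l, Q l r.
Proof.
move=> Qle Qex.
have /choice[r rP] : forall l, exists r : R, 0 < r /\ Q l r.
  by move=> l; have [r r0 qr] := Qex l; exists r.
have S0 : 0 <= \sum_(l < n) (r l)^-1.
  by apply: sumr_ge0 => l _; rewrite invr_ge0 ltW//; exact: (rP l).1.
have S1 : 0 < 1 + \sum_(l < n) (r l)^-1 by rewrite ltr_pwDl.
exists (1 + \sum_(l < n) (r l)^-1)^-1; first by rewrite invr_gt0.
move=> l; have [r0 qr] := rP l; apply: Qle qr; first by rewrite invr_gt0.
rewrite invf_ple// ?posrE// (bigD1 l)//= [_ + (_ + _)]addrCA lerDl addr_ge0// sumr_ge0// => k _.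
by rewrite invr_ge0 ltW//; exact: (rP k).1.
Qed.

End finite_choice.

Section local_pairing.
Context (R : realType) (d : nat).
Hypothesis hd : (0 < d)%N.
Variables (minus : bool) (alpha : 'I_d -> R) (x : 'rV[R]_d).
Hypothesis alpha_ge0 : forall l, 0 <= alpha l.
Variables (c : R -> R -> R) (H kap K a : R).
Hypotheses (H0 : 0 < H) (kap0 : 0 < kap) (K0 : 0 < K) (a0 : 0 < a).
Hypothesis rc : regular_covariance c H kap K.
Hypothesis Hx : forall eta : R, 0 < eta -> exists2 r : R, 0 < r &
  forall s t : R, a <= s -> s <= 2 * a -> 0 < t -> t <= 2 * a -> `|t - s| <= r ->
  forall l, `|x 0 l| * `|c t s - c t t| <= eta * `|t - s| `^ H.

Local Notation Res t s := (residual (c t t) (c t s) (c s s)).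

(** Division by the value [v ^ alpha * phase] of the symbol makes the expected
    leading term real and positive. *)
Definition nkernel b N l t s v : R[i] :=
  conjc (phase minus (alpha l)) * ((v `^ (- alpha l))%:C *
  kernel1 minus (regularisation b N) (alpha l) (x 0 l) (c t t) (c t s) (c s s) v).

Definition pairing b N t s (v : 'I_d -> R) := \prod_(l < d) nkernel b N l t s (v l).

Definition density_inf l := (2 * pi)^-1 *
  (Num.sqrt (2 * pi / variance_sup c H K a) *
   expR (- (x 0 l ^+ 2 / (2 * variance_inf H kap a)))).
Definition density_sup := (2 * pi)^-1 * Num.sqrt (2 * pi / variance_inf H kap a) : R.

Let I0 := variance_inf_gt0 H kap0 a0.

Lemma variance_sup_gt0 : 0 < variance_sup c H K a.
Proof.
have := variance_le_sup H0 K0 a0 rc (ltW a0); have := variance_gt0 kap0 rc a0.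
by move=> h1 h2; rewrite (lt_le_trans h1)// h2// ler_peMl ?(ltW a0)// ler1n.
Qed.

Lemma density_inf_gt0 l : 0 < density_inf l.
Proof.
have p0 : 0 < 2 * pi :> R by rewrite mulr_gt0// pi_gt0.
by rewrite mulr_gt0 ?invr_gt0// mulr_gt0 ?expR_gt0// sqrtr_gt0 divr_gt0// variance_sup_gt0.
Qed.

Lemma density_sup_ge0 : 0 <= density_sup.
Proof.
have p0 : 0 < 2 * pi :> R by rewrite mulr_gt0// pi_gt0.
by rewrite mulr_ge0 ?invr_ge0 ?(ltW p0)// sqrtr_ge0.
Qed.

Lemma density_bounds t l : a / 2 <= t -> t <= 2 * a ->
  density_inf l <= density (c t t) (x 0 l) /\ 0 <= density (c t t) (x 0 l) <= density_sup.
Proof.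
move=> t1 t2; have t0 : 0 < t by rewrite (lt_le_trans _ t1)// divr_gt0.
have A1 := variance_inf_le H0 kap0 a0 rc t1.
have A2 := variance_le_sup H0 K0 a0 rc (ltW t0) t2.
have A0 := variance_gt0 kap0 rc t0.
have S0 := variance_sup_gt0.
have J0 := I0.
rewrite /density /density_inf /density_sup.
set A := c t t in A0 A1 A2 *; set I := variance_inf _ _ _ in J0 A1 *.
set S := variance_sup _ _ _ _ in A2 S0 *.
clearbody A I S.
have p0 : 0 < 2 * pi :> R by rewrite mulr_gt0// pi_gt0.
have pi0 : 0 <= (2 * pi)^-1 :> R by rewrite invr_ge0 ltW.
split; [|apply/andP; split].
- rewrite ler_wpM2l// ler_pM ?expR_ge0 ?sqrtr_ge0//.
    exact: sqrt_le_mono.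
  rewrite ler_expR lerN2 ler_wpM2l ?sqr_ge0// lef_pV2 ?posrE ?mulr_gt0//.
  by rewrite ler_wpM2l.
- by apply: mulr_ge0.
- rewrite ler_wpM2l// -[leRHS]mulr1 ler_pM ?expR_ge0 ?sqrtr_ge0//.
    exact: sqrt_le_mono.
  by rewrite expR_le1 oppr_le0 divr_ge0 ?sqr_ge0// mulr_ge0// ltW.
Qed.

Lemma regression_small (r0 : R) : 0 < r0 -> exists2 r : R, 0 < r &
  forall s t : R, 0 < s -> a / 2 <= t -> `|t - s| <= r -> `|c t s / c t t - 1| <= r0.
Proof.
move=> r00; have k0 : 0 < K / variance_inf H kap a by rewrite divr_gt0.
have q0 : 0 < r0 ^+ 2 / (K / variance_inf H kap a) by rewrite divr_gt0// exprn_gt0.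
exists ((r0 ^+ 2 / (K / variance_inf H kap a)) `^ (2 * H)^-1); first exact: powR_gt0.
move=> s t s0 ta ts.
have := regression_near H0 kap0 a0 rc s0 ta => h.
rewrite -(@ler_pXn2r _ 2) ?nnegrE ?(ltW r00)// real_normK ?num_real// (le_trans h)//.
rewrite mulrC -ler_pdivlMr//.
have : `|t - s| `^ (2 * H) <= ((r0 ^+ 2 / (K / variance_inf H kap a)) `^ (2 * H)^-1) `^ (2 * H).
  by rewrite ge0_ler_powR ?nnegrE ?mulr_ge0 ?(ltW H0) ?powR_ge0.
by rewrite -powRrM mulVf ?powRr1 ?(ltW q0)// mulf_neq0// gt_eqF.
Qed.

(** The exponential undoes the cost of completing the square. The quantity
    [N * |t - s| ^ H] measures the distance to the diagonal at the frequency
    [N]; the phase error is a small multiple of it. *)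
Lemma nkernel_near (eta : R) : 0 < eta -> exists2 r : R, 0 < r & forall l,
  forall (N v s t : R) (b : bool), r^-1 <= N -> N <= v -> v <= 2 * N ->
  a <= s -> s <= 2 * a -> 0 < t -> t <= 2 * a -> `|t - s| <= r ->
  normc ((expR (v ^+ 2 * Res t s / 2))%:C * nkernel b N l t s v) <= density_sup + eta /\
  normc ((expR (v ^+ 2 * Res t s / 2))%:C * nkernel b N l t s v
     - (b%:R * density (c t t) (x 0 l))%:C) <=
     eta * (1 + 2 * density_sup * (N * `|t - s| `^ H)).
Proof.
move=> eta0; apply: uniform_radius.
  move=> l r r' r0 rr h N v s t b N1 N2 N3 s1 s2 t0 t1 ts.
  apply: h => //; last exact: le_trans ts rr.
  by apply: le_trans N1; rewrite lef_pV2 ?posrE//; exact: lt_le_trans rr.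
move=> l.
have [r0 [N0 [r00 N01 hk]]] := kernel_near minus (x 0 l) (alpha_ge0 l) I0 eta0.
have [r1 r10 h1] := Hx (divr_gt0 (mulr_gt0 eta0 I0) (ltr0Sn R 1)).
have [r2 r20 h2] := regression_small r00.
have N00 := lt_le_trans ltr01 N01.
exists (Num.min (Num.min r1 r2) (Num.min (a / 2) N0^-1)).
  by rewrite !lt_min r10 r20 invr_gt0 N00 divr_gt0.
move=> N v s t b N1 N2 N3 s1 s2 t0 t1.
rewrite !le_min => /andP[/andP[ts1 ts2] /andP[ts3 ts4]].
have NN : N0 <= N.
  apply: le_trans N1; rewrite invf_pge ?posrE// ?ge_min ?lexx ?orbT//.
  by rewrite !lt_min r10 r20 invr_gt0 N00 divr_gt0.
have s0 := lt_le_trans a0 s1.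
have ta : a / 2 <= t by move: ts3; rewrite ler_norml => /andP[? ?]; lra.
have A1 := variance_inf_le H0 kap0 a0 rc ta.
have A0 := lt_le_trans I0 A1.
have v0 : 0 < v by rewrite (lt_le_trans _ N2)// (lt_le_trans N00).
have Np : 0 < N by rewrite (lt_le_trans N00).
have [e [eE kE]] := hk N v (c t t) (c t s) (c s s) b NN N2 N3 A1 (h2 s t s0 ta ts2).
have [_ /andP[g0 g1]] := density_bounds l ta t1.
pose th := (v * c t s / c t t - v) * x 0 l.
set g := density _ _ in g0 g1 kE *.
have thE : `|th| <= eta * (N * `|t - s| `^ H).
  have -> : th = v / c t t * (x 0 l * (c t s - c t t)).
    by rewrite /th; field; rewrite gt_eqF.
  rewrite !normrM normfV (gtr0_norm v0) (gtr0_norm A0).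
  have := h1 s t s1 s2 t0 t1 ts1 l.
  have vA : v / c t t <= 2 * N / variance_inf H kap a.
    by rewrite ler_pM ?invr_ge0 ?(ltW v0) ?(ltW A0)// lef_pV2 ?posrE.
  move=> h; apply: le_trans (ler_pM _ _ vA h) _.
  - by rewrite divr_ge0 ?(ltW v0) ?(ltW A0).
  - by rewrite mulr_ge0.
  rewrite le_eqVlt; apply/orP; left; apply/eqP.
  by field; rewrite gt_eqF.
rewrite /nkernel kE -/th.
set E := expR _; set ph := phase _ _.
have phE : conjc ph * ph = 1.
  by rewrite /ph /phase conj_expi -expiD addNr expi0.
have -> : E%:C * (conjc ph * ((v `^ (- alpha l))%:C *
   ((v `^ alpha l * expR (- (v ^+ 2 * Res t s / 2)))%:C * ph *
    ((b%:R * g)%:C * expi th + e)))) = (b%:R * g)%:C * expi th + e.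
  transitivity ((conjc ph * ph) * (E * (v `^ (- alpha l)) * (v `^ alpha l * expR (- (v ^+ 2 * Res t s / 2))))%:C *
    ((b%:R * g)%:C * expi th + e)).
    by rewrite !rmorphM/=; ring.
  rewrite phE mul1r powRN.
  have -> : E / v `^ alpha l * (v `^ alpha l * expR (- (v ^+ 2 * Res t s / 2))) = 1.
    rewrite /E expRN; field; rewrite !gt_eqF ?powR_gt0 ?expR_gt0//.
  by rewrite mul1r.
have bg : `|b%:R * g| <= density_sup.
  by case: (b); rewrite ?mul1r ?mul0r ?ger0_norm// density_sup_ge0.
split.
  rewrite (le_trans (le_normcD _ _))// lerD// normcM normc_expi mulr1 normc_real//.
have -> : (b%:R * g)%:C * expi th + e - (b%:R * g)%:C = (b%:R * g)%:C * (expi th - 1) + e by ring.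
rewrite (le_trans (le_normcD _ _))// normcM normc_real.
have h3 := normc_expi_sub1 th.
have h4 : `|b%:R * g| * normc (expi th - 1) <= density_sup * (2 * `|th|) by rewrite ler_pM// normc_ge0.
have D0 := density_sup_ge0.
have h5 : density_sup * (2 * `|th|) <= density_sup * (2 * (eta * (N * `|t - s| `^ H))).
  by rewrite ler_wpM2l// ler_wpM2l.
by rewrite (_ : eta * _ = density_sup * (2 * (eta * (N * `|t - s| `^ H))) + eta);
  [rewrite lerD// (le_trans h4)|ring].
Qed.

Definition main_constant := \prod_(l < d) density_inf l.
Definition error_constant := 2 * (d%:R * (density_sup + 1) ^+ d *
  (1 + density_sup + density_sup * (4 / kap))).

Lemma main_constant_gt0 : 0 < main_constant.
Proof. by apply: prodr_gt0 => l _; exact: density_inf_gt0. Qed.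

Lemma error_constant_ge0 : 0 <= error_constant.
Proof.
have D0 := density_sup_ge0.
have D1 : 0 <= density_sup * (4 / kap) by rewrite mulr_ge0// divr_ge0// ltW.
rewrite /error_constant mulr_ge0// mulr_ge0//; last by rewrite !addr_ge0.
by rewrite mulr_ge0// exprn_ge0// addr_ge0.
Qed.

(** Completing the square costs a factor comparable to a Gaussian in
    [N |t - s|^H], and the relative errors grow at most linearly in this
    quantity. *)
Lemma pairing_near (eta : R) : 0 < eta -> eta <= 1 -> exists2 r : R, 0 < r &
  forall (N s t : R) (v : 'I_d -> R), r^-1 <= N ->
  (forall l, N <= v l <= 2 * N) ->
  a <= s -> s <= 2 * a -> 0 < t -> t <= 2 * a -> `|t - s| <= r ->
  main_constant * expR (- (2 * d%:R * K * (N ^+ 2 * `|t - s| `^ (2 * H))))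
   - error_constant * eta * expR (- (kap / 4 * (N ^+ 2 * `|t - s| `^ (2 * H)))) <=
  Re (pairing true N t s v - pairing false N t s v).
Proof.
move=> eta0 eta1; have [r r0 hr] := nkernel_near eta0.
exists (Num.min r (a / 2)); first by rewrite lt_min r0 divr_gt0.
move=> N s t v N1 vN s1 s2 t0 t1; rewrite le_min => /andP[tr ta].
have rN : r^-1 <= N.
  apply: le_trans N1; rewrite lef_pV2 ?posrE ?ge_min ?lexx// lt_min r0 divr_gt0//.
have Np : 0 < N by rewrite (lt_le_trans _ rN)// invr_gt0.
have s0 := lt_le_trans a0 s1.
have t2 : a / 2 <= t by move: ta; rewrite ler_norml => /andP[? ?]; lra.
have ts : `|t - s| <= s by lra.
have D0 := density_sup_ge0.
have RK := residual_le kap0 rc s0 t0.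
have Rk := residual_ge_near H0 kap0 rc s0 t0 ts.
set z := N * `|t - s| `^ H.
have z0 : 0 <= z by rewrite mulr_ge0 ?powR_ge0 ?(ltW Np).
have zW : N ^+ 2 * `|t - s| `^ (2 * H) = z ^+ 2.
  by rewrite /z exprMn; congr (_ * _); rewrite -powR_mulrn ?powR_ge0// -powRrM mulrC.
rewrite zW.
pose E := \prod_(l < d) expR (- (v l ^+ 2 * Res t s / 2)).
pose q b l := (expR (v l ^+ 2 * Res t s / 2))%:C * nkernel b N l t s (v l).
have pE b : pairing b N t s v = E%:C * \prod_(l < d) q b l.
  rewrite /pairing /E rmorph_prod/= -big_split/=; apply: eq_bigr => l _.
  by rewrite /q mulrA -rmorphM/= -expRD addNr expR0 mul1r.
pose g b l : R[i] := (b%:R * density (c t t) (x 0 l))%:C.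
have M1 : 1 <= density_sup + 1 by rewrite lerDr.
have hd1 b : normc (\prod_(l < d) q b l - \prod_(l < d) g b l) <=
    d%:R * (density_sup + 1) ^+ d * (eta * (1 + 2 * density_sup * z)).
  apply: normc_prod_sub => // l.
  - have /andP[v1 v2] := vN l.
    by have [+ _] := hr l N (v l) s t b rN v1 v2 s1 s2 t0 t1 tr; rewrite /q; lra.
  - have [_ /andP[g0 g1]] := density_bounds l t2 t1.
    rewrite /g normc_real normrM (ger0_norm g0); case: (b); rewrite ?normr1 ?normr0; lra.
  - have /andP[v1 v2] := vN l.
    by have [_] := hr l N (v l) s t b rN v1 v2 s1 s2 t0 t1 tr.
have g1E : \prod_(l < d) g true l = (\prod_(l < d) density (c t t) (x 0 l))%:C.
  by rewrite rmorph_prod/=; apply: eq_bigr => l _; rewrite /g mul1r.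
have g0E : \prod_(l < d) g false l = 0.
  by rewrite (bigD1 (Ordinal hd))//= /g mul0r mul0r.
have h1 := le_trans (normr_Re_le _) (hd1 true).
have h0 := le_trans (normr_Re_le _) (hd1 false).
rewrite g1E ReD ReN ler_norml/= in h1; rewrite g0E subr0 ler_norml in h0.
move: h1 h0 => /andP[h1 _] /andP[_ h0].
rewrite !pE -mulrBr ReM/= mul0r subr0 ReD ReN.
have gi : main_constant <= \prod_(l < d) density (c t t) (x 0 l).
  apply: ler_prod => l _; rewrite (ltW (density_inf_gt0 l))/=.
  by have [] := density_bounds l t2 t1.
have W0 : 0 <= z ^+ 2 by exact: sqr_ge0.
have vv l : N ^+ 2 <= v l ^+ 2 /\ v l ^+ 2 <= 4 * N ^+ 2.
  have /andP[v1 v2] := vN l; have v0 := lt_le_trans Np v1.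
  split; first by rewrite lerXn2r ?nnegrE// ltW.
  by rewrite (_ : 4 * N ^+ 2 = (2 * N) ^+ 2); [rewrite lerXn2r ?nnegrE ?mulr_ge0// ltW|ring].
have R0 : 0 <= Res t s by rewrite (le_trans _ Rk)// mulr_ge0 ?powR_ge0// ltW.
have EE : E = expR (- \sum_(l < d) (v l ^+ 2 * Res t s / 2)).
  by rewrite -sumrN expR_sum.
have E1 : expR (- (2 * d%:R * K * z ^+ 2)) <= E.
  rewrite EE ler_expR lerN2.
  apply: (@le_trans _ _ (\sum_(l < d) (2 * K * z ^+ 2))).
    apply: ler_sum => l _; have [_ v2] := vv l.
    rewrite ler_pdivrMr// -zW.
    rewrite (_ : 2 * K * _ * 2 = 4 * N ^+ 2 * (K * `|t - s| `^ (2 * H))); last by ring.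
    by rewrite ler_pM ?sqr_ge0.
  rewrite sumr_const card_ord -[leLHS]mulr_natl le_eqVlt; apply/orP; left; apply/eqP; ring.
have E2 : E <= expR (- (kap / 2 * z ^+ 2)).
  rewrite EE ler_expR lerN2 (bigD1 (Ordinal hd))//=.
  have v1 := (vv (Ordinal hd)).1.
  have h : N ^+ 2 * (kap * `|t - s| `^ (2 * H)) <= v (Ordinal hd) ^+ 2 * Res t s.
    by rewrite ler_pM ?sqr_ge0// mulr_ge0 ?powR_ge0// ltW.
  rewrite mulrCA zW in h.
  apply: ler_wpDr.
    by apply: sumr_ge0 => l _; rewrite divr_ge0// mulr_ge0// sqr_ge0.
  by rewrite ler_pdivlMr// mulrAC divfK.
have E0 : 0 <= E by rewrite EE expR_ge0.
have F2 := linear_gaussian_le kap0 D0 z0.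
set Q := 1 + 2 * density_sup * z in h1 h0 F2 *.
set k := d%:R * (density_sup + 1) ^+ d in h1 h0 *.
have k0 : 0 <= k by rewrite mulr_ge0// exprn_ge0// addr_ge0.
have Q0 : 0 <= Q := addr_ge0 ler01 (mulr_ge0 (mulr_ge0 (ler0n R 2) D0) z0).
have m0 := main_constant_gt0.
have EQ : E * Q <= (1 + density_sup + density_sup * (4 / kap)) * expR (- (kap / 4 * z ^+ 2)).
  by apply: le_trans F2; rewrite ler_wpM2r.
by apply: (perturbation_le E0 E1 EQ k0 (ltW eta0) (ltW m0) gi h1 h0).
Qed.

(** Away from the diagonal the residual variance is bounded below, so that only
    the exponential size in the frequency matters. *)
Lemma pairing_far : exists C : R, exists m : nat, 0 < C /\
  forall b (N s t : R) (v : 'I_d -> R), 1 <= N -> (forall l, N <= v l) ->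
  0 < s -> 0 < t ->
  normc (pairing b N t s v) <= C * N ^+ m * expR (- (N ^+ 2 * Res t s / 2)).
Proof.
have /choice[C /choice[m hC]] := fun l => @kernel_far R _ (alpha_ge0 l).
exists (\prod_(l < d) C l), (\sum_(l < d) 3 * m l)%N.
split; first by apply: prodr_gt0 => l _; have [] := hC l.
move=> b N s t v N1 vN s0 t0.
have N0 := lt_le_trans ltr01 N1.
have R0 := residual_ge0 kap0 rc s0 t0.
have A0 := variance_gt0 kap0 rc t0.
have [e0 e1] := regularisation_bounds b N1.
have e3 : (regularisation b N)^-1 <= N ^+ 3.
  rewrite /regularisation; case: (b); rewrite invrK//.
  by rewrite -[leLHS]expr1 ler_weXn2l.
have b1 l : normc (nkernel b N l t s (v l)) <=
    C l * N ^+ (3 * m l) * expR (- (v l ^+ 2 * Res t s / 2)).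
  rewrite /nkernel normcM normcJ /phase normc_expi mul1r normcM normc_real.
  have v1 := le_trans N1 (vN l).
  have -> : `|v l `^ (- alpha l)| = v l `^ (- alpha l) by rewrite ger0_norm// powR_ge0.
  have w1 : v l `^ (- alpha l) <= 1.
    by rewrite powRN invf_le1 ?powR_gt0 ?(lt_le_trans ltr01 v1)// -[leLHS](powRr0 (v l)) ler_powR.
  have [C0 h] := hC l.
  have := h minus (regularisation b N) (x 0 l) (c t t) (c t s) (c s s) (v l) e0 e1 A0.
  move=> h1; apply: le_trans (ler_pM (powR_ge0 _ _) (normc_ge0 _) w1 h1) _.
  rewrite mul1r ler_wpM2r ?expR_ge0// ler_wpM2l ?(ltW C0)//.
  rewrite -exprVn exprM lerXn2r ?nnegrE ?invr_ge0 ?(ltW e0) ?exprn_ge0 ?(ltW N0)//.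
rewrite /pairing normc_prod.
apply: le_trans (_ : \prod_(l < d) (C l * N ^+ (3 * m l) * expR (- (v l ^+ 2 * Res t s / 2))) <= _).
  by apply: ler_prod => l _; rewrite normc_ge0 b1.
rewrite [leLHS]big_split/= [X in X * _ <= _]big_split/= -expr_sum.
have C0 : 0 <= \prod_(l < d) C l * N ^+ (\sum_(l < d) 3 * m l).
  by rewrite mulr_ge0 ?exprn_ge0 ?(ltW N0)// prodr_ge0// => l _; have [/ltW] := hC l.
rewrite ler_wpM2l// -expR_sum ler_expR sumrN lerN2 (bigD1 (Ordinal hd))//=.
apply: ler_wpDr; first by apply: sumr_ge0 => l _; rewrite divr_ge0// mulr_ge0// sqr_ge0.
have v0 := vN (Ordinal hd).
rewrite ler_pM2r// ler_wpM2r// lerXn2r ?nnegrE ?(ltW N0)//.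
exact: le_trans (ltW N0) v0.
Qed.

End local_pairing.

(** * Summation over the time grid *)

Section grid.
Context (R : realType).
Implicit Types (H a t : R) (M : nat).

Definition grid a M (i : nat) : R := a + a / M%:R * i%:R.

Lemma grid_distance H a M t i : 0 < a -> (0 < M)%N ->
  (M%:R `^ H) ^+ 2 * `|t - grid a M i| `^ (2 * H) =
  (a * `|(t - a) * M%:R / a - i%:R|) `^ (2 * H).
Proof.
move=> a0 M0; have M1 : 0 < M%:R :> R by rewrite ltr0n.
rewrite -powR_mulrn ?powR_ge0// -powRrM [H * 2]mulrC -powRM ?ler0n//.
congr (_ `^ _).
have -> : t - grid a M i = a / M%:R * ((t - a) * M%:R / a - i%:R).
  by rewrite /grid; field; rewrite !gt_eqF.
rewrite normrM (gtr0_norm (divr_gt0 a0 M1)) mulrA; congr (_ * _).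
by field; rewrite gt_eqF.
Qed.

Lemma grid_bounds a M i : 0 < a -> (i < M)%N -> a <= grid a M i <= 2 * a.
Proof.
move=> a0 iM; have M1 : 0 < M%:R :> R by rewrite ltr0n (leq_ltn_trans _ iM).
rewrite /grid lerDl mulr_ge0 ?divr_ge0 ?(ltW a0)//=.
rewrite (_ : 2 * a = a + a); last by ring.
by rewrite lerD2l mulrAC ler_pdivrMr// ler_wpM2l ?(ltW a0)// ler_nat ltnW.
Qed.

Lemma eventually_natr (B : R) : exists M0 : nat, forall M, (M0 <= M)%N -> B <= M%:R.
Proof.
exists (Num.truncn B).+1 => M hM.
by apply/ltW/(lt_le_trans (truncnS_gt B)); rewrite ler_nat.
Qed.

Lemma eventually_powR H (B : R) : 0 < H ->
  exists M0 : nat, forall M, (M0 <= M)%N -> B <= M%:R `^ H.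
Proof.
move=> H0; have [M0 h] := eventually_natr (`|B| `^ H^-1); exists M0 => M /h hM.
apply: (le_trans (ler_norm B)).
have : (`|B| `^ H^-1) `^ H <= M%:R `^ H.
  by rewrite ge0_ler_powR ?nnegrE ?powR_ge0 ?(ltW H0).
by rewrite -powRrM mulVf ?gt_eqF// powRr1.
Qed.

Lemma exponential_beats_powers H (c dl : R) (m : nat) : 0 < H -> 0 < c -> 0 < dl ->
  exists M0 : nat, forall M, (M0 <= M)%N ->
  M%:R * (M%:R `^ H) ^+ m * expR (- (c * (M%:R `^ H) ^+ 2)) <= dl.
Proof.
move=> H0 c0 dl0; pose k := (Num.truncn ((2 + H * m%:R) / (2 * H))).+1.
have kE : 2 + H * m%:R <= 2 * H * k%:R.
  by rewrite [leRHS]mulrC -ler_pdivrMr ?mulr_gt0// ltW// truncnS_gt.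
have ck : 0 < c ^+ k by rewrite exprn_gt0.
have [M0 h0] := eventually_natr (k`!%:R / c ^+ k / dl).
exists (maxn M0 1) => M; rewrite geq_max => /andP[/h0 hM M1].
have Mp : 0 < M%:R :> R by rewrite ltr0n.
have M1' : 1 <= M%:R :> R by rewrite ler1n.
have u0 : 0 <= c * (M%:R `^ H) ^+ 2 by rewrite mulr_ge0 ?sqr_ge0// ltW.
have := exp_ge_pow k u0; set e := expR _ => h.
have e0 : 0 < e by exact: expR_gt0.
rewrite expRN -/e ler_pdivrMr//.
have h2 : M%:R * (M%:R `^ H) ^+ m * M%:R <= ((M%:R `^ H) ^+ 2) ^+ k.
  rewrite -exprM -!powR_mulrn ?powR_ge0// -!powRrM mulrAC.
  rewrite -expr2 -[in leLHS]powR_mulrn ?ler0n// -powRD; last first.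
    by rewrite (gt_eqF Mp) implybT.
  rewrite ler_powR// natrM; lra.
have h3 : (M%:R * (M%:R `^ H) ^+ m) * M%:R <= k`!%:R / c ^+ k * e.
  apply: (le_trans h2); rewrite mulrAC ler_pdivlMr// mulrC -exprMn//.
rewrite -(ler_pM2r Mp) (le_trans h3)// [leRHS]mulrAC ler_wpM2r ?(ltW e0)//.
by rewrite [leRHS]mulrC -ler_pdivrMr.
Qed.

End grid.

Lemma Re_sub_ge (R : realType) (p q : R[i]) (u : R) :
  normc p <= u -> normc q <= u -> - (2 * u) <= Re (p - q).
Proof.
move=> /(le_trans (normr_Re_le _)) + /(le_trans (normr_Re_le _)).
by rewrite !ler_norml ReD ReN => /andP[? ?] /andP[? ?]; lra.
Qed.

Lemma sub_errors_le (R : realType) (g x1 x2 x3 y : R) :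
  x1 <= g / 8 -> x2 <= g / 8 -> y <= x3 -> y - g / 4 <= x3 - x1 - x2.
Proof. by lra. Qed.

Section grid_pairing.
Context (R : realType) (d : nat).
Hypothesis hd : (0 < d)%N.
Variables (minus : bool) (alpha : 'I_d -> R) (x : 'rV[R]_d).
Hypothesis alpha_ge0 : forall l, 0 <= alpha l.
Variables (c : R -> R -> R) (H kap K a : R).
Hypotheses (H0 : 0 < H) (kap0 : 0 < kap) (K0 : 0 < K) (a0 : 0 < a).
Hypothesis rc : regular_covariance c H kap K.
Hypothesis Hx : forall eta : R, 0 < eta -> exists2 r : R, 0 < r &
  forall s t : R, a <= s -> s <= 2 * a -> 0 < t -> t <= 2 * a -> `|t - s| <= r ->
  forall l, `|x 0 l| * `|c t s - c t t| <= eta * `|t - s| `^ H.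

Local Notation pairing := (pairing minus alpha x c).

(** On the grid the distance of [t] to the nearest point is comparable to the
    spacing, so that the main terms add up to a constant, uniformly in [t];
    the sum of the errors is bounded by the same kind of grid sum. *)
Lemma pairing_grid_sum : exists2 g : R, 0 < g &
  exists M0 : nat, forall M, (M0 <= M)%N ->
  forall v : 'I_d -> R, (forall l, M%:R `^ H <= v l <= 2 * M%:R `^ H) ->
  forall t : R, 0 < t -> t <= 2 * a ->
  g * (a <= t < 2 * a)%R%:R - g / 4 <=
  \sum_(i < M) Re (pairing true (M%:R `^ H) t (grid a M i) v -
                   pairing false (M%:R `^ H) t (grid a M i) v).
Proof.
have HH : 0 < 2 * H by rewrite mulr_gt0.
have k40 : 0 < kap / 4 by rewrite divr_gt0.
have [C4 C40 hC4] := grid_sum_le k40 a0 HH.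
pose mc := main_constant x c H kap K a; pose ec := error_constant d H kap a.
have mc0 : 0 < mc := main_constant_gt0 x H0 kap0 K0 a0 rc.
have ec0 : 0 <= ec by exact: error_constant_ge0.
pose L := 2 * d%:R * K.
have L0 : 0 <= L by rewrite !mulr_ge0// ltW.
pose g := mc * expR (- (L * a `^ (2 * H))).
have g0 : 0 < g by rewrite mulr_gt0// expR_gt0.
exists g => //.
have ecC : 0 < (ec + 1) * C4 by rewrite mulr_gt0// ltr_wpDl.
(* The near errors and the far terms are allowed [g / 8] each. *)
pose eta := Num.min 1 (g / 8 / ((ec + 1) * C4)).
have eta0 : 0 < eta by rewrite lt_min ltr01/= !divr_gt0.
have eta1 : eta <= 1 by rewrite ge_min lexx.
have etaC : ec * eta * C4 <= g / 8.
  have : eta <= g / 8 / ((ec + 1) * C4) by rewrite ge_min lexx orbT.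
  rewrite ler_pdivlMr// => h; apply: le_trans h.
  rewrite -mulrA mulrC -mulrA ler_wpM2l ?(ltW eta0)// mulrC ler_wpM2r ?(ltW C40)//.
  by rewrite lerDl.
have [r r0 near] := pairing_near hd minus alpha_ge0 H0 kap0 K0 a0 rc Hx eta0 eta1.
rewrite -/mc -/ec -/L in near.
have [C [m [C0 far]]] := pairing_far hd minus x alpha_ge0 kap0 rc.
pose rho := kap * Num.min (r `^ (2 * H)) (a `^ (2 * H)).
have rhoE : rho = kap * Num.min (r `^ (2 * H)) (a `^ (2 * H)) by [].
have rho0 : 0 < rho by rewrite mulr_gt0// lt_min !powR_gt0.
have dl0 : 0 < g / 8 / (2 * C) by rewrite !divr_gt0// mulr_gt0.
have [M1 hM1] := exponential_beats_powers m H0 (divr_gt0 rho0 (ltr0Sn R 1)) dl0.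
have [M2 hM2] := eventually_powR r^-1 H0.
have [M3 hM3] := eventually_powR 1 H0.
have [M4 hM4] := eventually_natr (a / r).
have gE : g = mc * expR (- (L * a `^ (2 * H))) by [].
clearbody mc ec L g eta rho.
exists (maxn (maxn M1 M2) (maxn (maxn M3 M4) 1)) => M.
rewrite !geq_max => /andP[/andP[/hM1 e1 /hM2 e2] /andP[/andP[/hM3 e3 /hM4 e4] e5]] v vN t t0 t2.
have Mp : 0 < M%:R :> R by rewrite ltr0n.
set N := M%:R `^ H in e1 e2 e3 vN *.
have N0 : 0 < N := lt_le_trans ltr01 e3.
pose tau := (t - a) * M%:R / a.
pose W (i : nat) := (a * `|tau - i%:R|) `^ (2 * H).
have WE i : N ^+ 2 * `|t - grid a M i| `^ (2 * H) = W i by exact: grid_distance.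
pose nr (i : nat) : R := (`|t - grid a M i| <= r)%R%:R.
pose tiny := 2 * (C * N ^+ m * expR (- (rho / 2 * N ^+ 2))).
have tinyE : tiny = 2 * (C * N ^+ m * expR (- (rho / 2 * N ^+ 2))) by [].
have tiny0 : 0 <= tiny.
  by rewrite mulr_ge0// mulr_ge0 ?expR_ge0// mulr_ge0 ?exprn_ge0// ltW.
clearbody tiny.
have term (i : 'I_M) :
    nr i * (mc * expR (- (L * W i))) - ec * eta * expR (- (kap / 4 * W i)) - tiny <=
    Re (pairing true N t (grid a M i) v - pairing false N t (grid a M i) v).
  have /andP[s1 s2] := grid_bounds a0 (ltn_ord i).
  have s0 := lt_le_trans a0 s1.
  rewrite /nr; have [tr|tr] := leP `|t - grid a M i| r.
    have := near N (grid a M i) t v e2 vN s1 s2 t0 t2 tr.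
    by rewrite WE mul1r => h; apply: le_trans h; rewrite lerBlDr lerDl.
  rewrite mul0r sub0r.
  have h0 : 0 <= ec * eta * expR (- (kap / 4 * W i)).
    by rewrite mulr_ge0 ?expR_ge0// mulr_ge0// ltW.
  suff fb b : normc (pairing b N t (grid a M i) v) <= tiny / 2.
    apply: le_trans (Re_sub_ge (fb true) (fb false)).
    have -> : 2 * (tiny / 2) = tiny by rewrite mulrC divfK.
    by rewrite lerBlDr addNr oppr_le0.
  apply: le_trans (far b N (grid a M i) t v e3 _ s0 t0) _.
    by move=> l; have /andP[] := vN l.
  have -> : tiny / 2 = C * N ^+ m * expR (- (rho / 2 * N ^+ 2)).
    by rewrite tinyE mulrAC mulfV ?mul1r// pnatr_eq0.
  rewrite ler_wpM2l ?mulr_ge0 ?exprn_ge0 ?(ltW C0) ?(ltW N0)//.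
  rewrite ler_expR lerN2 mulrC mulrA ler_wpM2r// ler_wpM2l ?sqr_ge0//.
  apply: le_trans (residual_ge kap0 rc s0 t0); rewrite rhoE ler_wpM2l ?(ltW kap0)//.
  rewrite le_min !ge_min; apply/andP; split; apply/orP; [left|right].
    by rewrite ge0_ler_powR ?nnegrE ?(ltW HH) ?(ltW r0) ?(ltW tr).
  by rewrite ge0_ler_powR ?nnegrE ?(ltW HH) ?(ltW a0) ?(ltW s0).
apply: le_trans (_ : \sum_(i < M) _ <= _); last by apply: ler_sum => i _; exact: term.
rewrite !sumrB -!mulr_sumr sumr_const card_ord.
have S1 : ec * eta * \sum_(i < M) expR (- (kap / 4 * W i)) <= g / 8.
  by apply: le_trans etaC; apply: ler_wpM2l; [exact: mulr_ge0 ec0 (ltW eta0)|exact: hC4].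
have S2 : tiny *+ M <= g / 8.
  rewrite tinyE -mulr_natl.
  have := ler_wpM2l (mulr_ge0 (ler0n R 2) (ltW C0)) e1.
  rewrite [leRHS]mulrC divfK ?mulf_neq0 ?gt_eqF// => h; apply: le_trans h.
  by rewrite le_eqVlt; apply/orP; left; apply/eqP; ring.
suff S3 : g * (a <= t < 2 * a)%R%:R <= \sum_(i < M) nr i * (mc * expR (- (L * W i))).
  exact: sub_errors_le S1 S2 S3.
have tm0 (i : nat) : 0 <= nr i * (mc * expR (- (L * W i))).
  by rewrite mulr_ge0 ?ler0n// mulr_ge0 ?expR_ge0// ltW.
have [/andP[at_ ta]|_] := boolP (a <= t < 2 * a); last first.
  by rewrite mulr0; apply: sumr_ge0 => i _.
have tau0 : 0 <= tau by rewrite divr_ge0 ?(ltW a0)// mulr_ge0 ?(ltW Mp)// subr_ge0.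
have tauM : tau < M%:R by rewrite ltr_pdivrMr// mulrC ltr_pM2l//; lra.
have /andP[i1 i2] := truncn_itv tau0.
have iM : (Num.truncn tau < M)%N by rewrite -(ltr_nat R) (le_lt_trans i1).
rewrite (bigD1 (Ordinal iM))//= mulr1.
apply: ler_wpDr; first by apply: sumr_ge0 => i _.
have ti : `|tau - (Num.truncn tau)%:R| <= 1.
  by rewrite ger0_norm ?subr_ge0// lerBlDr addrC natr1 ltW.
have -> : nr (Num.truncn tau) = 1.
  rewrite /nr (_ : _ <= _ = true)//.
  have -> : t - grid a M (Num.truncn tau) = a / M%:R * (tau - (Num.truncn tau)%:R).
    by rewrite /grid /tau; field; rewrite !gt_eqF.
  rewrite normrM (gtr0_norm (divr_gt0 a0 Mp)).
  apply: (@le_trans _ _ (a / M%:R)); first by rewrite ler_piMr// divr_ge0 ?(ltW a0)// ltW.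
  by rewrite ler_pdivrMr// mulrC -ler_pdivrMr.
rewrite gE mul1r ler_wpM2l ?(ltW mc0)// ler_expR lerN2 ler_wpM2l//.
rewrite ge0_ler_powR ?nnegrE ?(ltW HH) ?(ltW a0) ?mulr_ge0 ?(ltW a0)//.
by rewrite ler_piMr ?(ltW a0).
Qed.

End grid_pairing.

(** * Test functions *)

Section indicator_integrals.
Context (R : realType).
Local Notation leb := (@lebesgue_measure R).

Lemma Rintegral_indic_itv (b1 b2 : bool) (u v : R) : u <= v ->
  \int[leb]_t (\1_([set` Interval (BSide b1 u) (BSide b2 v)] : set R) t) = v - u.
Proof.
move=> uv; rewrite /Rintegral integral_indic//= setIT.
have := @lebesgue_measure_itv R (Interval (BSide b1 u) (BSide b2 v)) => /= ->.
rewrite lte_fin; case: ltP => //= vu.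
by rewrite (@le_anti _ _ u v) ?subrr// uv vu.
Qed.

(** At time 0 the process may be degenerate; the indicator of that single point
    compensates for the missing bound without changing the integral. *)
Lemma Rintegral_lower_bound (f : R -> R) (g a : R) : 0 < a ->
  leb.-integrable setT (EFin \o f) ->
  (forall t, ~~ (0 <= t <= 2 * a) -> f t = 0) ->
  (forall t, 0 < t -> t <= 2 * a -> g * (a <= t < 2 * a)%R%:R - g / 4 <= f t) ->
  g * a / 2 <= \int[leb]_t f t.
Proof.
move=> a0 fi f0 fg.
pose i1 t : R := \1_(`[a, 2 * a[%classic : set R) t.
pose i2 t : R := \1_(`[0, 2 * a]%classic : set R) t.
pose i3 t : R := \1_(`[0, 0]%classic : set R) t.
pose B := `|f 0| + `|g|.
have j1 (k : R) : leb.-integrable setT (EFin \o (fun t => k * i1 t)).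
  exact/integrable_realZ/integrable_indic_itv.
have j2 (k : R) : leb.-integrable setT (EFin \o (fun t => k * i2 t)).
  exact/integrable_realZ/integrable_indic_itv.
have j3 (k : R) : leb.-integrable setT (EFin \o (fun t => k * i3 t)).
  exact/integrable_realZ/integrable_indic_itv.
have aa : a <= 2 * a by rewrite ler_peMl ?(ltW a0)// ler1n.
have -> : g * a / 2 = \int[leb]_t (g * i1 t - g / 4 * i2 t - B * i3 t).
  rewrite RintegralB//; last exact: integrable_realB.
  rewrite RintegralB// !RintegralZl//; first last.
  - exact: integrable_indic_itv.
  - exact: integrable_indic_itv.
  - exact: integrable_indic_itv.
  rewrite !Rintegral_indic_itv// ?mulr_ge0 ?(ltW a0)//.
  by field.
apply: Rintegral_le => //; first by apply: integrable_realB => //; exact: integrable_realB.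
move=> t; rewrite /i1 /i2 /i3 !indicE !mem_setE !in_itv/=.
have [t0|t0|->] := ltgtP t 0.
- rewrite f0; last by rewrite negb_and -ltNge t0.
  by rewrite [a <= t]leNgt (lt_trans t0 a0)/= !mulr0 !subr0.
- rewrite /= mulr0 subr0.
  have [t2|t2] := leP t (2 * a).
    by rewrite mulr1; exact: fg.
  rewrite f0; last by rewrite negb_and -!ltNge t2 orbT.
  by rewrite [t < _]ltNge (ltW t2) andbF !mulr0 subrr.
- rewrite mulr_ge0 ?(ltW a0)//= [a <= 0]leNgt a0/= mulr0 !mulr1 sub0r /B.
  have := ler_norm (- f 0); have := ler_norm (- g); have := normr_ge0 g.
  by rewrite !normrN; lra.
Qed.

End indicator_integrals.

Section test_function.
Context disp (Omega : measurableType disp) (R : realType).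
Variables (P : probability Omega R) (d : nat) (hd : (0 < d)%N).
Variable X : R -> Omega -> 'rV[R]_d.
Hypothesis jmX : forall l, jointly_measurable (component X l).
Hypothesis gX : forall l, centered_gaussian_process P (component X l).
Hypothesis indX : independent_components P X.
Hypothesis lawX : forall l l', same_law P (component X l) (component X l').
Variables (minus : bool) (alpha : 'I_d -> R) (x : 'rV[R]_d) (H kap K a : R).
Hypothesis alpha_ge0 : forall l, 0 <= alpha l.
Hypotheses (H0 : 0 < H) (kap0 : 0 < kap) (K0 : 0 < K) (a0 : 0 < a).
Local Notation leb := (@lebesgue_measure R).
Local Notation c := (cov P (first_component hd X)).
Hypothesis rc : regular_covariance c H kap K.

(** The phase of the multiplier at [v] divided by its size: with these weights
    all the waves of a test function contribute positively to the pairing. *)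
Definition modulation (v : 'I_d -> R) : R[i] :=
  \prod_(l < d) (phase minus (alpha l) * (v l `^ (- alpha l))%:C).

Definition frequency M (k : {ffun 'I_d -> 'I_(Num.truncn (M%:R `^ H : R))}) (l : 'I_d) : R :=
  M%:R `^ H + (k l)%:R.

Definition test_index M : finType := ({ffun 'I_d -> 'I_(Num.truncn (M%:R `^ H : R))} * 'I_M)%type.

Definition test_wave M (j : test_index M) := wave X x (frequency j.1) (grid a M j.2).

Definition test_function M (w : Omega) : R[i] :=
  \sum_(j : test_index M) modulation (frequency j.1) * test_wave j w.

Lemma frequency_bounds M (k : {ffun 'I_d -> 'I_(Num.truncn (M%:R `^ H : R))}) l :
  M%:R `^ H <= frequency k l <= 2 * M%:R `^ H.
Proof.
rewrite /frequency lerDl ler0n/= (_ : 2 * M%:R `^ H = M%:R `^ H + M%:R `^ H); last by ring.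
rewrite lerD2l; have := truncn_itv (powR_ge0 M%:R H) => /andP[h _].
by apply: le_trans h; rewrite ler_nat ltnW.
Qed.

Lemma conj_modulation b N t s (v : 'I_d -> R) :
  conjc (modulation v) * \prod_(l < d) kernel1 minus (regularisation b N) (alpha l) (x 0 l)
    (c t t) (c t s) (c s s) (v l) = pairing minus alpha x c b N t s v.
Proof.
rewrite /modulation rmorph_prod -big_split; apply: eq_bigr => l _.
rewrite rmorphM -[LHS]mulrA; congr (_ * (_ * _)).
by rewrite /conjc/= oppr0.
Qed.

Lemma normc_modulation v : normc (modulation v) = \prod_(l < d) (v l `^ (- alpha l)).
Proof.
rewrite normc_prod; apply: eq_bigr => l _.
by rewrite normcM /phase normc_expi mul1r normc_real ger0_norm// powR_ge0.
Qed.

Lemma normc_test_wave M (j : test_index M) w : normc (test_wave j w) = 1.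
Proof. exact: normc_wave. Qed.

Lemma grid_ge0 M (i : 'I_M) : 0 <= grid a M i.
Proof. by have /andP[/(le_trans (ltW a0))] := grid_bounds a0 (ltn_ord i). Qed.

Lemma cmeasurable_test_wave M (j : test_index M) : cmeasurable (test_wave j).
Proof. by apply: (cmeasurable_wave gX); exact: grid_ge0. Qed.

Lemma cmeasurable_test_function M : cmeasurable (@test_function M).
Proof.
apply: cmeasurable_sum => j; apply: cmeasurableM; first exact: cmeasurable_cst.
exact: cmeasurable_test_wave.
Qed.

Lemma test_function_bounded M : exists B : R, forall w, normc (@test_function M w) <= B.
Proof.
exists (\sum_(j : test_index M) normc (modulation (frequency j.1))) => w.
rewrite (le_trans (normc_sum _ _ _))//; apply: ler_sum => j _.
by rewrite normcM normc_test_wave mulr1.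
Qed.

Local Notation F eps := (local_time_derivative X minus alpha eps (2 * a) x).

Let paired b M t (j : test_index M) : R[i] :=
  (\1_(`[0, 2 * a]%classic : set R) t)%:C *
    pairing minus alpha x c b (M%:R `^ H) t (grid a M j.2) (frequency j.1).

Lemma pairing_test b M : 1 <= M%:R `^ H :> R ->
  (forall j : test_index M, cintegrable leb (fun t => paired b t j)) /\
  cintegral P setT (fun w => F (regularisation b (M%:R `^ H)) w * conjc (test_function M w)) =
  \sum_(j : test_index M) cintegral leb setT (fun t => paired b t j).
Proof.
move=> N1; have [e0 e1] := regularisation_bounds b N1.
set eps := regularisation b _ in e0 e1 *.
have key (j : test_index M) := @pairing_formula _ _ _ _ _ hd _ jmX gX indX lawX minus _ x (2 * a)
  alpha_ge0 _ e0 e1 (frequency j.1) _ (grid_ge0 j.2).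
pose ker (j : test_index M) t := (\1_(`[0, 2 * a]%classic : set R) t)%:C *
    \prod_(l < d) kernel1 minus eps (alpha l) (x 0 l) (c t t) (c t (grid a M j.2))
       (c (grid a M j.2) (grid a M j.2)) (frequency j.1 l).
have pE j t : paired b t j = conjc (modulation (frequency j.1)) * ker j t.
  rewrite /paired -conj_modulation -/eps /ker.
  by move: (\prod_(l < d) _) (conjc _) (_%:C) => u1 u2 u3; rewrite mulrCA.
have Fm := cmeasurable_local_time_derivative jmX minus x (2 * a) alpha_ge0 e0 e1.
have [B FB] := local_time_derivative_bounded jmX minus x (2 * a) alpha_ge0 e0 e1.
have Wi (j : test_index M) : cintegrable P (fun w => F eps w * conjc (test_wave j w)).
  apply: (@cintegrable_dominated _ _ _ P _ (fun=> B)).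
  - by apply: cmeasurableM => //; apply: cmeasurable_conj; exact: cmeasurable_test_wave.
  - exact: finite_measure_integrable_cst.
  - by move=> w; rewrite normcM normcJ normc_test_wave mulr1.
split=> [j|].
  rewrite (_ : (fun t => paired b t j) = fun t => conjc (modulation (frequency j.1)) * ker j t).
    by apply: cintegrableZ; have [] := key j.
  by apply/funext => t; exact: pE.
transitivity (cintegral P setT (fun w => \sum_(j : test_index M)
   conjc (modulation (frequency j.1)) * (F eps w * conjc (test_wave j w)))).
  apply: eq_cintegral => w; rewrite /test_function rmorph_sum mulr_sumr; apply: eq_bigr => j _.
  by rewrite rmorphM mulrCA.
rewrite cintegral_sum; last by move=> j; exact: cintegrableZ.
apply: eq_bigr => j _; rewrite cintegralZ//.
have [ki ->] := key j; rewrite -cintegralZ//.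
by apply: eq_cintegral => t; rewrite pE.
Qed.

Hypothesis Hx : forall eta : R, 0 < eta -> exists2 r : R, 0 < r &
  forall s t : R, a <= s -> s <= 2 * a -> 0 < t -> t <= 2 * a -> `|t - s| <= r ->
  forall l, `|x 0 l| * `|c t s - c t t| <= eta * `|t - s| `^ H.

Lemma cintegrable_test b M : 1 <= M%:R `^ H :> R ->
  cintegrable P (fun w => F (regularisation b (M%:R `^ H)) w * conjc (test_function M w)).
Proof.
move=> N1; have [e0 e1] := regularisation_bounds b N1.
have Fm := cmeasurable_local_time_derivative jmX minus x (2 * a) alpha_ge0 e0 e1.
have [B FB] := local_time_derivative_bounded jmX minus x (2 * a) alpha_ge0 e0 e1.
have [C GC] := test_function_bounded M.
apply: (@cintegrable_dominated _ _ _ P _ (fun=> B * C)).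
- by apply: cmeasurableM => //; apply: cmeasurable_conj; exact: cmeasurable_test_function.
- exact: finite_measure_integrable_cst.
- by move=> w; rewrite normcM normcJ ler_pM ?normc_ge0.
Qed.

Lemma cintegralB d0 (T0 : measurableType d0) (mu : {measure set T0 -> \bar R}) (f h : T0 -> R[i]) :
  cintegrable mu f -> cintegrable mu h ->
  cintegrable mu (fun t => f t - h t) /\
  cintegral mu setT (fun t => f t - h t) = cintegral mu setT f - cintegral mu setT h.
Proof.
move=> fi hi; have hi' := cintegrableZ (-1) hi.
rewrite (_ : (fun t => f t - h t) = fun t => f t + (-1) * h t); last first.
  by apply/funext => t; rewrite mulN1r.
by split; [exact: cintegrableD|rewrite cintegralD// cintegralZ// mulN1r].
Qed.

Lemma card_frequencies M :
  #|{ffun 'I_d -> 'I_(Num.truncn (M%:R `^ H : R))}| = (Num.truncn (M%:R `^ H : R) ^ d)%N.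
Proof. by rewrite card_ffun !card_ord. Qed.

(** The frequencies of a test function resonate with the fast regularisation
    but are damped by the slow one. *)
Lemma test_pairing_lower : exists2 g : R, 0 < g & exists M0 : nat, forall M, (M0 <= M)%N ->
  g * (Num.truncn (M%:R `^ H : R))%:R ^+ d <=
  Re (cintegral P setT (fun w => (F (regularisation true (M%:R `^ H)) w -
        F (regularisation false (M%:R `^ H)) w) * conjc (test_function M w))).
Proof.
have [g g0 [M0 hM0]] := pairing_grid_sum hd minus alpha_ge0 H0 kap0 K0 a0 rc Hx.
have [M1 hM1] := eventually_powR 1 H0.
exists (g * a / 2); first by rewrite divr_gt0// mulr_gt0.
exists (maxn M0 M1) => M; rewrite geq_max => /andP[/hM0 hM /hM1 N1].
have [i1 p1] := pairing_test true N1; have [i0 p0] := pairing_test false N1.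
have -> : cintegral P setT (fun w => (F (regularisation true (M%:R `^ H)) w -
        F (regularisation false (M%:R `^ H)) w) * conjc (test_function M w)) =
    \sum_(j : test_index M) cintegral leb setT (fun t => paired true t j - paired false t j).
  transitivity (cintegral P setT (fun w => F (regularisation true (M%:R `^ H)) w * conjc (test_function M w)
        - F (regularisation false (M%:R `^ H)) w * conjc (test_function M w))).
    by apply: eq_cintegral => w; rewrite mulrBl.
  have [_ ->] := cintegralB (cintegrable_test true N1) (cintegrable_test false N1).
  transitivity (\sum_(j : test_index M) cintegral leb setT (fun t => paired true t j) -
      \sum_(j : test_index M) cintegral leb setT (fun t => paired false t j)).
    by congr (_ - _); [exact: p1|exact: p0].
  rewrite -sumrB; apply: eq_bigr => j _; symmetry.
  exact: (cintegralB (i1 j) (i0 j)).2.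
rewrite -(pair_bigA _ (fun k i => cintegral leb setT (fun t => paired true t (k, i) - paired false t (k, i))))/=.
rewrite Re_sum.
have -> : (Num.truncn (M%:R `^ H : R))%:R ^+ d =
    #|{ffun 'I_d -> 'I_(Num.truncn (M%:R `^ H : R))}|%:R :> R.
  by rewrite card_frequencies natrX.
rewrite mulr_natr -sumr_const; apply: ler_sum => k _.
have ii (i : 'I_M) := (cintegralB (i1 (k, i)) (i0 (k, i))).1.
rewrite -(cintegral_sum _ ii).
have fE t : Re (\sum_(i < M) (paired true t (k, i) - paired false t (k, i))) =
    (\1_(`[0, 2 * a]%classic : set R) t) *
    \sum_(i < M) Re (pairing minus alpha x c true (M%:R `^ H) t (grid a M i) (frequency k) -
      pairing minus alpha x c false (M%:R `^ H) t (grid a M i) (frequency k)).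
  rewrite Re_sum mulr_sumr; apply: eq_bigr => i _.
  by rewrite /paired/= -mulrBr ReM/= mul0r subr0.
apply: Rintegral_lower_bound => //.
- by have [] := cintegrable_sum (index_enum _) ii.
- move=> t nt; rewrite fE indicE mem_setE in_itv/=.
  by rewrite (negbTE nt) mul0r.
- move=> t t0 t2; rewrite fE indicE mem_setE in_itv/= (ltW t0) t2 mul1r.
  by apply: hM => // l; exact: frequency_bounds.
Qed.

Lemma wave_pair v v' s t w : wave X x v s w * conjc (wave X x v' t w) =
  (\prod_(l < d) expi ((v l - v' l) * x 0 l)) *
  \prod_(l < d) expi (v l * X s w 0 l - v' l * X t w 0 l).
Proof.
have -> : conjc (wave X x v' t w) = \prod_(l < d) expi (- (v' l * (X t w 0 l + x 0 l))).
  by rewrite /wave rmorph_prod; apply: eq_bigr => l _; exact: conj_expi.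
rewrite /wave -!big_split; apply: eq_bigr => l _ /=.
by rewrite -!expiD; congr expi; ring.
Qed.

Lemma cintegrable_wave_pair M (j j' : test_index M) :
  cintegrable P (fun w => test_wave j w * conjc (test_wave j' w)).
Proof.
apply: (@cintegrable_dominated _ _ _ P _ (fun=> 1)).
- apply: cmeasurableM; first exact: cmeasurable_test_wave.
  by apply: cmeasurable_conj; exact: cmeasurable_test_wave.
- exact: finite_measure_integrable_cst.
- by move=> w; rewrite normcM normcJ !normc_test_wave mulr1.
Qed.

Let rate := nondegeneracy_rate H kap K a.
Let rate0 : 0 < rate := nondegeneracy_rate_gt0 H kap0 K0 a0.

(** The variance of [v X_t - v' X_s] is bounded below both by the gap between the
    frequencies and by the gap between the times. *)
Lemma wave_pair_decay M (j j' : test_index M) : 1 <= M%:R `^ H :> R ->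
  normc (cintegral P setT (fun w => test_wave j w * conjc (test_wave j' w))) <=
  \prod_(l < d) expR (- (rate / 2 * (1 * `|(j.1 l)%:R - (j'.1 l)%:R|) `^ 2)) *
  expR (- (rate / 2 * (a * `|(j.2)%:R - (j'.2)%:R|) `^ (2 * H))).
Proof.
move=> N1; have N0 : 0 < M%:R `^ H :> R := lt_le_trans ltr01 N1.
case: j j' => [k i] [k' i'].
have M0 : (0 < M)%N by rewrite (leq_ltn_trans _ (ltn_ord i)).
have Mp : 0 < M%:R :> R by rewrite ltr0n.
have -> : cintegral P setT (fun w => test_wave (k, i) w * conjc (test_wave (k', i') w)) =
  cintegral P setT (fun w => (\prod_(l < d) expi ((frequency k l - frequency k' l) * x 0 l)) *
    \prod_(l < d) expi (frequency k l * X (grid a M i) w 0 l - frequency k' l * X (grid a M i') w 0 l)).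
  by apply: eq_cintegral => w; exact: wave_pair.
rewrite [(k, i).1]/= [(k, i).2]/= [(k', i').1]/= [(k', i').2]/=.
rewrite cintegralZ; last first.
  apply: (@cintegrable_dominated _ _ _ P _ (fun=> 1)).
  - apply: cmeasurable_prod => l; apply: cmeasurable_expi.
    by apply: measurable_funB; apply: measurable_funM => //; apply: (measurable_component gX l);
      exact: grid_ge0.
  - exact: finite_measure_integrable_cst.
  - by move=> w; rewrite normc_prod big1// => l _; rewrite normc_expi.
rewrite normcM normc_prod big1 ?mul1r; last by move=> l _; exact: normc_expi.
rewrite (joint_characteristic hd gX indX lawX); [|exact: grid_ge0|exact: grid_ge0].
rewrite -rmorph_prod normc_real ger0_norm; last by apply: prodr_ge0 => l _; exact: expR_ge0.
rewrite -!expR_sum -expRD ler_expR !sumrN -opprD lerN2.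
have /andP[s1 s2] := grid_bounds a0 (ltn_ord i').
have /andP[t1 t2] := grid_bounds a0 (ltn_ord i).
have gd : (M%:R `^ H) ^+ 2 * `|grid a M i - grid a M i'| `^ (2 * H) =
    (a * `|i%:R - i'%:R|) `^ (2 * H).
  rewrite grid_distance//; congr ((_ * `| _ - _|) `^ _).
  by rewrite /grid; field; rewrite !gt_eqF.
have lower l : rate / 2 * (1 * `|(k l)%:R - (k' l)%:R|) `^ 2 +
    rate / 2 * (a * `|i%:R - i'%:R|) `^ (2 * H) <=
    increment_form P hd X (grid a M i') (grid a M i) (frequency k l) (frequency k' l) / 2.
  have /andP[f1 f2] := frequency_bounds k' l.
  have := increment_variance_ge H0 kap0 K0 a0 rc (frequency k l) N0 f1 f2 s1 s2 t1 t2.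
  rewrite gd /increment_form -/rate => h.
  have -> : (1 * `|(k l)%:R - (k' l)%:R|) `^ 2 = (frequency k l - frequency k' l) ^+ 2 :> R.
    rewrite mul1r powR_mulrn ?normr_ge0// real_normK ?num_real//; congr (_ ^+ 2).
    by rewrite /frequency; ring.
  by rewrite -mulrDr mulrAC ler_pM2r.
apply: le_trans (ler_sum _ (fun l _ => lower l)).
rewrite big_split/= lerD2l sumr_const card_ord -[leRHS]mulr_natl ler_peMl ?ler1n//.
by rewrite mulr_ge0 ?powR_ge0// divr_ge0// ltW.
Qed.

Lemma normc_sqr_complex (z : R[i]) : z * conjc z = ((normc z) ^+ 2)%:C.
Proof. by rewrite sqr_normcE; apply: eqc => /=; case: z => u v /=; ring. Qed.

(** Distinct plane waves are nearly uncorrelated, so the second moment of the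
    test function is comparable to its number of terms. *)
Lemma test_function_second_moment : exists2 C : R, 0 < C &
  exists M0 : nat, forall M, (M0 <= M)%N ->
  \int[P]_w (normc (test_function M w) ^+ 2) <=
  C * (\prod_(l < d) (M%:R `^ H) `^ (- alpha l)) ^+ 2 *
    ((Num.truncn (M%:R `^ H : R))%:R ^+ d * M%:R).
Proof.
have r2 : 0 < rate / 2 by rewrite divr_gt0.
have [C2 C20 h2] := grid_sum_le r2 (ltr01 : 0 < 1 :> R) (ltr0Sn R 1).
have [C3 C30 h3] := grid_sum_le r2 a0 (mulr_gt0 (ltr0Sn R 1) H0).
have [M1 hM1] := eventually_powR 1 H0.
exists (C2 ^+ d * C3); first by rewrite mulr_gt0// exprn_gt0.
exists M1 => M /hM1 N1.
set W := \prod_(l < d) _.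
have W0 : 0 <= W by apply: prodr_ge0 => l _; exact: powR_ge0.
have mW (j : test_index M) : normc (modulation (frequency j.1)) <= W.
  rewrite normc_modulation; apply: ler_prod => l _; rewrite powR_ge0/= !powRN.
  have /andP[f1 f2] := frequency_bounds j.1 l.
  have f0 := lt_le_trans ltr01 N1.
  have g0 := lt_le_trans f0 f1.
  rewrite lef_pV2; [|exact: powR_gt0|exact: powR_gt0].
  by apply: ge0_ler_powR; rewrite ?nnegrE// ltW.
have -> : \int[P]_w (normc (test_function M w) ^+ 2) =
    Re (\sum_(j : test_index M) \sum_(j' : test_index M)
      modulation (frequency j.1) * conjc (modulation (frequency j'.1)) *
      cintegral P setT (fun w => test_wave j w * conjc (test_wave j' w))).
  transitivity (Re (cintegral P setT (fun w => \sum_(j : test_index M) \sum_(j' : test_index M)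
      modulation (frequency j.1) * conjc (modulation (frequency j'.1)) *
      (test_wave j w * conjc (test_wave j' w))))).
    rewrite -[LHS]/(Re (_%:C)) -cintegral_real; congr Re; apply: eq_cintegral => w.
    rewrite -normc_sqr_complex /test_function rmorph_sum big_distrlr.
    apply: eq_bigr => j _; apply: eq_bigr => j' _.
    by rewrite rmorphM; move: (modulation _) (modulation _) (test_wave _ _) => u1 u2 u3; rewrite mulrACA.
  rewrite cintegral_sum; last first.
    move=> j; apply: cintegrable_sum => j'; apply: cintegrableZ; exact: cintegrable_wave_pair.
  congr Re; apply: eq_bigr => j _; rewrite cintegral_sum; last first.
    move=> j'; apply: cintegrableZ; exact: cintegrable_wave_pair.
  by apply: eq_bigr => j' _; rewrite cintegralZ//; exact: cintegrable_wave_pair.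
apply: (le_trans (ler_norm _)); apply: (le_trans (normr_Re_le _)).
apply: (le_trans (normc_sum _ _ _)).
have -> : C2 ^+ d * C3 * W ^+ 2 * ((Num.truncn (M%:R `^ H : R))%:R ^+ d * M%:R) =
    \sum_(j : test_index M) (W ^+ 2 * (C2 ^+ d * C3)).
  rewrite sumr_const /test_index card_prod card_frequencies card_ord -[RHS]mulr_natl natrM natrX.
  by ring.
apply: ler_sum => j _.
apply: (le_trans (normc_sum _ _ _)).
pose e (j' : test_index M) : R :=
  \prod_(l < d) expR (- (rate / 2 * (1 * `|(j.1 l)%:R - (j'.1 l)%:R|) `^ 2)) *
  expR (- (rate / 2 * (a * `|(j.2)%:R - (j'.2)%:R|) `^ (2 * H))).
apply: (@le_trans _ _ (\sum_(j' : test_index M) W ^+ 2 * e j')).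
  apply: ler_sum => j' _; rewrite !normcM normcJ.
  apply: ler_pM; rewrite ?mulr_ge0 ?normc_ge0//.
    by rewrite expr2 ler_pM ?normc_ge0.
  exact: wave_pair_decay.
rewrite -mulr_sumr ler_wpM2l ?sqr_ge0//.
rewrite /e -(pair_bigA _ (fun (k' : {ffun 'I_d -> 'I_(Num.truncn (M%:R `^ H : R))}) (i' : 'I_M) =>
  \prod_(l < d) expR (- (rate / 2 * (1 * `|(j.1 l)%:R - (k' l)%:R|) `^ 2)) *
  expR (- (rate / 2 * (a * `|(j.2)%:R - i'%:R|) `^ (2 * H)))))/=.
under eq_bigr do rewrite -mulr_sumr.
rewrite -mulr_suml.
apply: ler_pM => //.
- by apply: sumr_ge0 => k _; apply: prodr_ge0 => l _; exact: expR_ge0.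
- by apply: sumr_ge0 => k _; exact: expR_ge0.
- rewrite -(bigA_distr_bigA (fun (l : 'I_d) (i : 'I_(Num.truncn (M%:R `^ H : R))) =>
  expR (- (rate / 2 * (1 * `|(j.1 l)%:R - i%:R|) `^ 2)))).
  rewrite -[d in C2 ^+ d]card_ord -prodr_const; apply: ler_prod => l _.
  by rewrite h2 andbT; apply: sumr_ge0 => k _; exact: expR_ge0.
- exact: h3.
Qed.

End test_function.

(** * Mean-square convergence *)

Lemma sqr_add_le (R : realType) (p q t : R) : 0 <= p -> p <= q + t ->
  p ^+ 2 <= 2 * q ^+ 2 + 2 * t ^+ 2.
Proof.
move=> p0 h; have := sqr_ge0 (q - t).
have : p ^+ 2 <= (q + t) ^+ 2 by rewrite lerXn2r ?nnegrE// (le_trans p0 h).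
by nra.
Qed.

Section mean_square.
Context disp (Omega : measurableType disp) (R : realType) (P : probability Omega R).

Lemma L2norm_lt (f : Omega -> R[i]) (dl : R) : 0 <= dl -> cmeasurable f ->
  (cL2norm P f < dl%:E)%E ->
  P.-integrable setT (EFin \o (fun w => normc (f w) ^+ 2)) /\
  \int[P]_w (normc (f w) ^+ 2) <= dl ^+ 2.
Proof.
move=> dl0 mf h.
have m2 : measurable_fun setT (fun w => normc (f w) ^+ 2).
  by apply: measurable_funX; exact: measurable_normc.
have hI : (\int[P]_w ((normc (f w) ^+ 2)%:E) <= (dl ^+ 2)%:E)%E.
  have n2 : (2 : R) != 0 by [].
  have := @poweR_Lnorm _ _ _ P (fun w => (normc (f w))%:E) 2 n2.
  rewrite -/(cL2norm P f) => E.
  rewrite (_ : (\int[P]_w ((normc (f w) ^+ 2)%:E))%E = (cL2norm P f `^ 2)%E).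
    rewrite (_ : (dl ^+ 2)%:E = (dl%:E `^ 2)%E); last by rewrite /= powR_mulrn.
    apply: gt0_ler_poweR => //; rewrite ?nnegrE ?in_itv/= ?leey ?lee_fin ?dl0 ?Lnorm_ge0//.
    exact: ltW.
  rewrite E; apply: eq_integral => w _ /=.
  by rewrite (ger0_norm (normc_ge0 _)) powR_mulrn// normc_ge0.
have fi : P.-integrable setT (EFin \o (fun w => normc (f w) ^+ 2)).
  apply/integrableP; split; first exact/measurable_EFinP.
  apply: le_lt_trans (ltry (dl ^+ 2)); apply: le_trans hI.
  by under eq_integral do rewrite gee0_abs ?lee_fin ?sqr_ge0//.
split=> //.
rewrite -lee_fin; apply: le_trans hI.
rewrite /Rintegral fineK//; exact: integrable_fin_num.
Qed.

Lemma converges_L2_cauchy (F : R -> Omega -> R[i]) : converges_L2 P F ->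
  (forall eps, 0 < eps -> eps <= 1 -> cmeasurable (F eps)) ->
  forall dl : R, 0 < dl -> exists2 e0 : R, 0 < e0 &
  forall u v : R, 0 < u -> u < e0 -> u <= 1 -> 0 < v -> v < e0 -> v <= 1 ->
  P.-integrable setT (EFin \o (fun w => normc (F u w - F v w) ^+ 2)) /\
  \int[P]_w (normc (F u w - F v w) ^+ 2) <= dl.
Proof.
move=> [Z [mZ _ hZ]] mF dl dl0.
pose r := Num.sqrt (dl / 4).
have r0 : 0 < r by rewrite sqrtr_gt0 divr_gt0.
have r2 : r ^+ 2 = dl / 4 by rewrite sqr_sqrtr// ltW// divr_gt0.
have := hZ [set y | (y < r%:E)%E].
have nb : nbhs (0%E : \bar R) [set y | (y < r%:E)%E].
  by apply: open_ereal_lt'; rewrite lte_fin.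
move=> /(_ nb) /nbhs_ballP[e0 /= e00 he].
exists e0 => // u v u0 ue u1 v0 ve v1.
have cl z : 0 < z -> z < e0 -> z <= 1 ->
    P.-integrable setT (EFin \o (fun w => normc (F z w - Z w) ^+ 2)) /\
    \int[P]_w (normc (F z w - Z w) ^+ 2) <= dl / 4.
  move=> z0 ze z1; rewrite -r2; apply: L2norm_lt; first exact: ltW.
    by have [F1 F2] := mF z z0 z1; have [Z1 Z2] := mZ; split;
      [under eq_fun do rewrite ReD ReN|under eq_fun do rewrite ImD ImN]; exact: measurable_funB.
  by apply: he => //; rewrite /ball/= sub0r normrN gtr0_norm.
have [iu hu] := cl u u0 ue u1; have [iv hv] := cl v v0 ve v1.
have ib : P.-integrable setT (EFin \o (fun w => 2 * normc (F u w - Z w) ^+ 2 + 2 * normc (F v w - Z w) ^+ 2)).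
  by apply: integrable_realD; exact: integrable_realZ.
have hb w : normc (F u w - F v w) ^+ 2 <= 2 * normc (F u w - Z w) ^+ 2 + 2 * normc (F v w - Z w) ^+ 2.
  have : normc (F u w - F v w) <= normc (F u w - Z w) + normc (F v w - Z w).
    rewrite -[normc (F v w - Z w)]normcN opprB (_ : F u w - F v w = (F u w - Z w) + (Z w - F v w)); last by ring.
    exact: le_normcD.
  exact/sqr_add_le/normc_ge0.
have mD : measurable_fun setT (fun w => normc (F u w - F v w) ^+ 2).
  apply: measurable_funX; apply: measurable_normc.
  by have [F1 F2] := mF u u0 u1; have [Z1 Z2] := mF v v0 v1; split;
      [under eq_fun do rewrite ReD ReN|under eq_fun do rewrite ImD ImN]; exact: measurable_funB.
have iD : P.-integrable setT (EFin \o (fun w => normc (F u w - F v w) ^+ 2)).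
  by apply: (integrable_le mD ib) => w; rewrite ger0_norm ?sqr_ge0.
split=> //.
apply: le_trans (Rintegral_le iD ib hb) _.
rewrite RintegralD//; [|exact: integrable_realZ|exact: integrable_realZ].
rewrite !RintegralZl//; lra.
Qed.

Lemma pairing_young (D G : Omega -> R[i]) (mu : R) : 0 < mu ->
  P.-integrable setT (EFin \o (fun w => normc (D w) ^+ 2)) ->
  P.-integrable setT (EFin \o (fun w => normc (G w) ^+ 2)) ->
  cintegrable P (fun w => D w * conjc (G w)) ->
  2 * Re (cintegral P setT (fun w => D w * conjc (G w))) <=
    mu * \int[P]_w (normc (D w) ^+ 2) + mu^-1 * \int[P]_w (normc (G w) ^+ 2).
Proof.
move=> mu0 iD iG [iDG _].
rewrite /cintegral/= -!RintegralZl// -RintegralD//; [|exact: integrable_realZ|exact: integrable_realZ].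
apply: Rintegral_le; [exact: integrable_realZ|apply: integrable_realD; exact: integrable_realZ|].
move=> w; have := le_trans (ler_norm _) (normr_Re_le (D w * conjc (G w))).
rewrite normcM normcJ => h.
apply: (@le_trans _ _ (2 * (normc (D w) * normc (G w)))); first by rewrite ler_wpM2l.
move: (normc (D w)) (normc (G w)) => p q.
have e : mu * p ^+ 2 + mu^-1 * q ^+ 2 - 2 * (p * q) = mu^-1 * (mu * p - q) ^+ 2.
  by field; rewrite gt_eqF.
by rewrite -subr_ge0 e mulr_ge0 ?sqr_ge0// invr_ge0 ltW.
Qed.

End mean_square.

(** * Divergence *)

Lemma shift_arith (R : realType) (tt ts ss e : R) :
  `|ts - ss| <= e -> 0 <= tt - 2 * ts + ss -> tt - 2 * ts + ss <= e ->
  `|ts - tt| <= 2 * e.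
Proof. by rewrite !ler_norml => /andP[h1 h2] h3 h4; apply/andP; split; lra. Qed.

Section divergence.
Context disp (Omega : measurableType disp) (R : realType).
Variables (P : probability Omega R) (d : nat) (hd : (0 < d)%N).
Variables (H T : R) (x : 'rV[R]_d) (alpha : 'I_d -> R).
Variables (X : R -> Omega -> 'rV[R]_d) (minus : bool).
Hypotheses (H0 : 0 < H) (T0 : 0 < T) (alpha_ge0 : forall l, 0 <= alpha l).
Hypothesis XSU : class_SU P hd H X.
Hypothesis Halpha : 1 <= H * (2 * multi_abs alpha + d%:R).
Local Notation c := (cov P (first_component hd X)).

Lemma class_SU_regular : exists kap K : R, [/\ 0 < kap, 0 < K & regular_covariance c H kap K].
Proof.
have [[_ gX _ _ slnd] inc] := XSU.
have g1 := gX (Ordinal hd).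
have [kap kap0 hk] := cov_slnd g1 slnd; have [K K0 hK] := cov_increment g1 inc.
exists kap, K; split => //; split => //.
- by move=> s t; exact: covC.
- by move=> s t y v s0 t0; exact: (variance_comb_ge0 g1).
Qed.

(** Decorrelation of the increments from the past makes the regression of the
    process on itself shift the frequency by less than its fluctuations. *)
Lemma regression_shift_small (kap K a eta : R) : 0 < kap -> 0 < K -> 0 < a ->
  regular_covariance c H kap K ->
  x = 0 \/ increment_decorrelation P (first_component hd X) ->
  0 < eta -> exists2 r : R, 0 < r &
  forall s t : R, a <= s -> s <= 2 * a -> 0 < t -> t <= 2 * a -> `|t - s| <= r ->
  forall l, `|x 0 l| * `|c t s - c t t| <= eta * `|t - s| `^ H.
Proof.
move=> kap0 K0 a0 rc [x0|dec] eta0.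
  exists 1 => // s t _ _ _ _ _ l; rewrite x0 mxE normr0 mul0r.
  by rewrite mulr_ge0 ?powR_ge0// ltW.
have [[_ gX _ _ _] _] := XSU; have g1 := gX (Ordinal hd).
pose B := 1 + \sum_(l < d) `|x 0 l|.
have B0 : 0 < B by rewrite ltr_pwDl// sumr_ge0.
have xB l : `|x 0 l| <= B.
  by rewrite /B (bigD1 l)//= addrCA lerDl addr_ge0// sumr_ge0.
pose S := variance_sup c H K a.
pose Q := Num.sqrt K * Num.sqrt S.
have Q0 : 0 <= Q by rewrite mulr_ge0 ?sqrtr_ge0.
have Q1 : 0 < Q + 1 by rewrite ltr_wpDl.
have eta10 : 0 < eta / (2 * B * (Q + 1)) by rewrite divr_gt0// !mulr_gt0.
have [g g1_ hg] := cov_decorrelation g1 dec eta10.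
have g0 : 0 < g := lt_trans ltr01 g1_.
have q0 : 0 < eta / (2 * B * K) by rewrite divr_gt0// !mulr_gt0.
pose r := Num.min (a / (2 * g)) ((eta / (2 * B * K)) `^ H^-1).
have r0 : 0 < r by rewrite lt_min divr_gt0 ?mulr_gt0//= powR_gt0.
exists r => // s t s1 s2 t0 t2.
rewrite /r le_min => /andP[tsg tsK] l.
set D := `|t - s| `^ H; have D0 : 0 <= D by exact: powR_ge0.
have s0 := lt_le_trans a0 s1.
have tsa : `|t - s| <= a / 2.
  apply: le_trans tsg _; rewrite ler_wpM2l ?(ltW a0)// lef_pV2 ?posrE ?mulr_gt0//.
  by rewrite ler_peMr// ltW.
have ta : a / 2 <= t by move: tsa; rewrite ler_norml => /andP[? ?]; lra.
have DK : D <= eta / (2 * B * K).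
  have : D <= ((eta / (2 * B * K)) `^ H^-1) `^ H by rewrite ge0_ler_powR ?nnegrE ?powR_ge0 ?(ltW H0).
  by rewrite -powRrM mulVf ?gt_eqF// powRr1// ltW.
have D2 : `|t - s| `^ (2 * H) = D ^+ 2 by rewrite mulrC powRrM powR_mulrn ?powR_ge0.
(* Here [u] and [w] are the two times in increasing order. *)
have dec_le (u w : R) : a / 2 <= u -> u < w -> w <= 2 * a -> `|w - u| = `|t - s| ->
    `|c w u - c u u| <= eta / (2 * B) * D.
  move=> ua uw w2 wu; have u0 : 0 < u by rewrite (lt_le_trans _ ua)// divr_gt0.
  have rel : (w - u) / u <= 1 / g.
    rewrite ler_pdivrMr// div1r mulrC.
    apply: (@le_trans _ _ (a / 2 / g)); last by rewrite ler_pM2r ?invr_gt0.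
    have : w - u <= a / (2 * g) by rewrite (le_trans (ler_norm _))// wu.
    by rewrite invfM mulrA.
  apply: le_trans (hg u w u0 uw rel) _.
  have i1 : Num.sqrt (c w w - 2 * c w u + c u u) <= Num.sqrt K * D.
    rewrite -[D](ger0_norm D0) -sqrtr_sqr -sqrtrM ?(ltW K0)// ler_wsqrtr// -D2 -wu.
    exact: (regular_increment rc (ltW u0) (ltW (lt_trans u0 uw))).
  have i2 : Num.sqrt (c u u) <= Num.sqrt S.
    rewrite ler_wsqrtr//; apply: (variance_le_sup H0 K0 a0 rc (ltW u0)).
    exact: le_trans (ltW uw) w2.
  apply: (@le_trans _ _ (eta / (2 * B * (Q + 1)) * (Q + 1) * D)); last first.
    rewrite le_eqVlt; apply/orP; left; apply/eqP; field.
    by rewrite !gt_eqF.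
  apply: le_trans (_ : eta / (2 * B * (Q + 1)) * Q * D <= _).
    rewrite -!mulrA ler_wpM2l ?(ltW eta0)// ler_wpM2l ?invr_ge0 ?(ltW (mulr_gt0 _ Q1)) ?mulr_ge0 ?(ltW B0) ?(ltW Q1)//.
    rewrite /Q mulrA [leRHS]mulrAC.
    by rewrite ler_pM ?sqrtr_ge0.
  rewrite ler_wpM2r// ler_wpM2l ?(ltW eta10)//.
  by rewrite lerDl.
have hB2 : 0 < 2 * B by rewrite mulr_gt0.
have half : B * (eta / (2 * B) * D) = eta / 2 * D by field; rewrite gt_eqF.
have [ts|st|ts] := ltgtP t s.
- rewrite (regular_sym rc t s).
  apply: (@le_trans _ _ (eta / 2 * D)).
    by rewrite -half ler_pM//; apply: dec_le => //; rewrite distrC.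
  by rewrite ler_wpM2r// ler_pdivrMr// ler_peMr ?(ltW eta0)// ler1n.
- have a2s : a / 2 <= s by apply: le_trans s1; rewrite ler_pdivrMr// ler_peMr ?(ltW a0)// ler1n.
  have h1 := dec_le s t a2s st t2 erefl.
  have h2 := regular_increment rc (ltW s0) (ltW t0).
  have h3 : 0 <= c t t - 2 * c t s + c s s.
    by have := regular_ge0 rc 1 1 (ltW s0) (ltW t0); rewrite !expr1n !mul1r !mulr1.
  have h4 : K * D ^+ 2 <= eta / (2 * B) * D.
    rewrite expr2 mulrA ler_wpM2r//.
    have := ler_wpM2l (ltW K0) DK.
    rewrite (_ : K * (eta / (2 * B * K)) = eta / (2 * B))//.
    by field; rewrite !gt_eqF.
  rewrite D2 in h2.
  have h5 : `|c t s - c t t| <= 2 * (eta / (2 * B) * D).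
    apply: shift_arith h1 h3 (le_trans h2 h4).
  have -> : eta * D = B * (2 * (eta / (2 * B) * D)) by rewrite mulrCA half; field.
  by rewrite ler_pM.
- by rewrite ts subrr normr0 mulr0 mulr_ge0// ltW.
Qed.

Lemma sum_powR_exponents (N : R) (b : 'I_d -> R) : 0 < N ->
  \prod_(l < d) N `^ b l = N `^ (\sum_(l < d) b l).
Proof.
move=> N0; elim/big_rec2: _ => [|l u v _ ->]; first by rewrite powRr0.
by rewrite powRD// (gt_eqF N0) implybT.
Qed.

(** The choice of scales: with [N = M^H] the grid of [M] times and about [N^d]
    frequencies, the condition on [alpha] says exactly that the weighted number
    of terms of the test function does not outgrow its number of frequencies. *)
Lemma critical_scaling (M : nat) : 2 <= M%:R `^ H :> R -> (0 < M)%N ->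
  (\prod_(l < d) (M%:R `^ H) `^ (- alpha l)) ^+ 2 * M%:R <=
  2 ^+ d * (Num.truncn (M%:R `^ H : R))%:R ^+ d.
Proof.
move=> N2 M0; have Mp : 0 < M%:R :> R by rewrite ltr0n.
set N := M%:R `^ H in N2 *; have N0 : 0 < N by rewrite (lt_le_trans _ N2).
have W0 : 0 < N `^ (multi_abs alpha) by exact: powR_gt0.
rewrite sum_powR_exponents// sumrN powRN -/(multi_abs alpha) exprVn.
rewrite ler_pdivrMl ?exprn_gt0//.
apply: (@le_trans _ _ (N `^ (2 * multi_abs alpha + d%:R))).
  rewrite -[leLHS]powRr1 ?(ltW Mp)// /N -powRrM ler_powR//.
  by rewrite ler1n.
rewrite powRD ?(gt_eqF N0) ?implybT// mulrC.
have -> : N `^ (2 * multi_abs alpha) = N `^ multi_abs alpha ^+ 2.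
  by rewrite mulrC powRrM powR_mulrn// ltW.
rewrite mulrC ler_wpM2l ?sqr_ge0// powR_mulrn ?(ltW N0)// -exprMn.
have /andP[n1 n2] := truncn_itv (ltW N0).
rewrite lerXn2r ?nnegrE ?(ltW N0) ?mulr_ge0//.
by move: n2; rewrite -natr1; lra.
Qed.

Lemma contradiction_arith (g C mu I J W n M e : R) : 0 < g -> 0 < C -> 0 < n ->
  mu = C * e / g -> 0 < e -> J <= C * W * (n * M) -> W * M <= e * n ->
  0 <= I -> I <= g / (2 * mu) ->
  2 * (g * n) <= mu * n * I + (mu * n)^-1 * J -> False.
Proof.
move=> g0 C0 n0 muE e0 hJ hW I0 hI h.
have mu0 : 0 < mu by rewrite muE divr_gt0 ?mulr_gt0.
have h1 : mu * n * I <= g * n / 2.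
  have := ler_wpM2l (mulr_ge0 (ltW mu0) (ltW n0)) hI.
  by rewrite (_ : mu * n * (g / (2 * mu)) = g * n / 2)//; field; rewrite gt_eqF.
have h2 : (mu * n)^-1 * J <= g * n.
  rewrite ler_pdivrMl ?mulr_gt0//; apply: (le_trans hJ).
  rewrite (_ : C * W * (n * M) = C * n * (W * M)); last by ring.
  rewrite (_ : mu * n * (g * n) = C * n * (e * n)); last by rewrite muE; field; rewrite gt_eqF.
  by rewrite ler_wpM2l// mulr_ge0// ltW.
have : 0 < g * n by rewrite mulr_gt0.
by lra.
Qed.

Lemma not_converges_L2 : x = 0 \/ increment_decorrelation P (first_component hd X) ->
  ~ converges_L2 P (fun eps => local_time_derivative X minus alpha eps T x).
Proof.
move=> hx conv.
have [[jmX gX indX lawX _] _] := XSU.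
have [kap [K [kap0 K0 rc]]] := class_SU_regular.
pose a := T / 2; have a0 : 0 < a by rewrite divr_gt0.
have Ta : T = 2 * a by rewrite /a mulrC divfK.
have Hx := fun eta => @regression_shift_small kap K a eta kap0 K0 a0 rc hx.
have [g g0 [M0 lower]] := test_pairing_lower jmX gX indX lawX minus alpha_ge0 H0 kap0 K0 a0 rc Hx.
have [C C0 [M1 upper]] := test_function_second_moment gX indX lawX minus x alpha_ge0 H0 kap0 K0 a0 rc.
have e0 : 0 < 2 ^+ d :> R by rewrite exprn_gt0.
(* With this [mu] the second moment of the test function uses up half of the
   lower bound. *)
pose mu := C * 2 ^+ d / g.
have mu0 : 0 < mu by rewrite divr_gt0// mulr_gt0.
have dl0 : 0 < g / (2 * mu) by rewrite divr_gt0// mulr_gt0.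
have mF eps : 0 < eps -> eps <= 1 -> cmeasurable (local_time_derivative X minus alpha eps T x).
  by move=> ? ?; exact: cmeasurable_local_time_derivative.
have [e1 e10 cauchy] := converges_L2_cauchy conv mF dl0.
have [M2 hM2] := eventually_powR 2 H0.
have [M3 hM3] := eventually_powR (2 / e1) H0.
pose M := maxn (maxn M0 M1) (maxn (maxn M2 M3) 1).
have /and5P[k0 k1 k2 k3 k4] : [&& M0 <= M, M1 <= M, M2 <= M, M3 <= M & 0 < M]%N.
  by rewrite !leq_max !leqnn ?orbT.
have N2 := hM2 _ k2; have N3 := hM3 _ k3; have lowerM := lower _ k0; have upperM := upper _ k1.
have N1 : 1 <= M%:R `^ H :> R by rewrite (le_trans _ N2)// ler1n.
have crit := critical_scaling N2 k4.
have e_small b : regularisation b (M%:R `^ H) < e1.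
  have N0 : 0 < M%:R `^ H :> R by rewrite (lt_le_trans _ N1).
  apply: (@le_lt_trans _ _ (M%:R `^ H)^-1).
    rewrite /regularisation; case: (b) => //.
    by rewrite lef_pV2 ?posrE ?exprn_gt0// -[leLHS]expr1 ler_weXn2l.
  rewrite invf_plt ?posrE// (lt_le_trans _ N3)// ltr_pdivlMr// mulVf ?gt_eqF//.
  by rewrite ltr1n.
have [r10 r11] := regularisation_bounds true N1.
have [r00 r01] := regularisation_bounds false N1.
have [iD hD] := cauchy _ _ r10 (e_small true) r11 r00 (e_small false) r01.
set n : R := (Num.truncn (M%:R `^ H : R))%:R in lowerM upperM crit.
have n0 : 0 < n ^+ d.
  apply: exprn_gt0; rewrite ltr0n truncn_gt0//.
have [B hB] := test_function_bounded X minus alpha x H a M.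
pose G := test_function X minus alpha x H a M.
have mG : cmeasurable G by exact: cmeasurable_test_function.
have iG : P.-integrable setT (EFin \o (fun w => normc (G w) ^+ 2)).
  apply: (@integrable_le _ _ _ P _ (fun=> B ^+ 2)).
  - by apply: measurable_funX; exact: measurable_normc.
  - exact: finite_measure_integrable_cst.
  - move=> w; rewrite ger0_norm ?sqr_ge0// lerXn2r ?nnegrE ?normc_ge0//.
    exact: le_trans (normc_ge0 _) (hB w).
rewrite -/G in upperM.
have iDG : cintegrable P (fun w => (local_time_derivative X minus alpha (regularisation true (M%:R `^ H)) T x w -
    local_time_derivative X minus alpha (regularisation false (M%:R `^ H)) T x w) * conjc (G w)).
  rewrite Ta.
  have := cintegralB (cintegrable_test jmX gX minus x alpha_ge0 a0 true N1)
     (cintegrable_test jmX gX minus x alpha_ge0 a0 false N1).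
  move=> [h _]; rewrite (_ : (fun w => _) = (fun w =>
     local_time_derivative X minus alpha (regularisation true (M%:R `^ H)) (2 * a) x w * conjc (G w) -
     local_time_derivative X minus alpha (regularisation false (M%:R `^ H)) (2 * a) x w * conjc (G w)))//.
  by apply/funext => w; rewrite mulrBl.
have mun0 : 0 < mu * n ^+ d by rewrite mulr_gt0.
have young := pairing_young mun0 iD iG iDG.
rewrite -Ta -/G in lowerM.
apply: (@contradiction_arith g C mu _ _ _ (n ^+ d) M%:R (2 ^+ d) g0 C0 n0 erefl e0 upperM crit _ hD).
  exact: Rintegral_sqr_ge0.
by apply: le_trans young; rewrite ler_wpM2l.
Qed.

End divergence.

Theorem theorem1p4 (R : realType) (disp : measure_display)
    (Omega : measurableType disp) (P : probability Omega R)
    (d : nat) (hd : (0 < d)%N) (H T : R) (x : 'rV[R]_d) (alpha : 'I_d -> R)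
    (X : R -> Omega -> 'rV[R]_d) (minus : bool)
    (H_gt0 : 0 < H) (H_lt1 : H < 1) (T_gt0 : 0 < T)
    (alpha_ge0 : forall l, 0 <= alpha l)
    (XSU : class_SU P hd H X)
    (Halpha : 1 <= H * (2 * multi_abs alpha + d%:R)) :
  (x = 0 ->
    [/\ H * d%:R <= 1 ->
          ~ converges_L2 P
              (fun eps => local_time_derivative X minus alpha eps T x),
        1 < H * d%:R -> even_real (int_entries_sum alpha) ->
          ~ converges_L2 P
              (fun eps => local_time_derivative X minus alpha eps T x) &
        1 < H * d%:R -> odd_real (int_entries_sum alpha) ->
          class_SU_hat P hd H X ->
          ~ converges_L2 P
              (fun eps => local_time_derivative X minus alpha eps T x)]) /\
  (x <> 0 -> class_SU_tilde P hd H X ->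
    (exists l : 'I_d, alpha l \is a Num.int /\ x 0 l <> 0) ->
    ~ converges_L2 P
        (fun eps => local_time_derivative X minus alpha eps T x)).
Proof.
split=> [x0|x0 [_ dec] _].
  by split=> *; apply: (not_converges_L2 H_gt0 T_gt0 alpha_ge0 XSU Halpha); left.
by apply: (not_converges_L2 H_gt0 T_gt0 alpha_ge0 XSU Halpha); right.
Qed.
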